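(* Let $0<\alpha<1$, $\lambda>0$, $T>0$. Let $f$ be a continuous bounded function on $[0,\infty)$ and let $g$ be a continuous function on $[0,T)$. Then the function $$c(x,t)=\frac{1}{2\lambda t^{\alpha/2}}\int_0^{\infty}\left[M_{\alpha/2}\left(\frac{x+\xi}{\lambda t^{\alpha/2}}\right)+M_{\alpha/2}\left(\frac{|x-\xi|}{\lambda t^{\alpha/2}}\right)\right]f(\xi)\,d\xi-\int_x^{\infty}\int_0^t M_{\alpha/2}\left(\frac{\xi}{\lambda (t-\tau)^{\alpha/2}}\right)\frac{\xi}{\lambda (t-\tau)^{\alpha/2+1}}\,\frac{\alpha}{2}\,g(\tau)\,d\tau\,d\xi$$ is a solution to the problem $$\begin{cases} {}_0D^{\alpha}_t c(x,t)=\lambda^2\dfrac{\partial^2 c}{\partial x^2}(x,t), & 0<x<\infty,\ 0<t<T,\\ c(x,0)=f(x), & 0<x<\infty,\\ \dfrac{\partial c}{\partial x}(0,t)=g(t), & 0<t<T.\end{cases}$$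
   Context: For $0<\alpha<1$ the Caputo derivative in $t$ is ${}_0D^{\alpha}_t u(x,t)=\frac{1}{\Gamma(1-\alpha)}\int_0^t (t-\tau)^{-\alpha}\frac{\partial u}{\partial \tau}(x,\tau)\,d\tau$. For $0<\nu<1$ the Mainardi function is $M_{\nu}(z)=\sum_{k=0}^{\infty}\frac{(-z)^k}{k!\,\Gamma(-\nu k+1-\nu)}$, with the convention $1/\Gamma=0$ at the poles of $\Gamma$. Initial and boundary values are understood as limits: $c(x,0)=\lim_{t\searrow 0}c(x,t)$ for each $x>0$ and $\frac{\partial c}{\partial x}(0,t)=\lim_{x\searrow 0}\frac{\partial c}{\partial x}(x,t)$ for each $t\in(0,T)$. *)

(* Defs.v *)
From HB Require Import structures.
From mathcomp Require Import all_boot all_order all_algebra.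
From mathcomp Require Import all_classical all_reals all_analysis.

Set Implicit Arguments.
Unset Strict Implicit.
Unset Printing Implicit Defensive.

Import Order.TTheory GRing.Theory Num.Theory.
Import numFieldNormedType.Exports.

Local Open Scope ring_scope.
Local Open Scope classical_set_scope.

Section SpecialFunctions.
Context {R : realType}.
Local Notation mu := (@lebesgue_measure R).

Definition euler_integral (z : R) : R :=
  \int[mu]_(s in `]0, +oo[) (s `^ (z - 1) * expR (- s)).

(* For z <= 0, the continuation Gamma (z + n) / (z (z + 1) ... (z + n - 1)),
   with n a natural number greater than |z|.  At the poles the denominator
   vanishes, so that Gamma z = 0 there because x / 0 = 0, and hence
   (Gamma z)^-1 = 0: this is the convention 1 / Gamma = 0 at the poles. *)
Definition Gamma (z : R) : R :=
  if 0 < z then euler_integral z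
  else let n := Num.bound z in
       euler_integral (z + n%:R) / \prod_(i < n) (z + i%:R).

Definition mainardi_term (nu z : R) (k : nat) : R :=
  (- z) ^+ k / (k`!%:R * Gamma (- nu * k%:R + 1 - nu)).

Definition mainardi (nu z : R) : R := limn (series (mainardi_term nu z)).

End SpecialFunctions.

Section FractionalDiffusion.
Context {R : realType}.
Local Notation mu := (@lebesgue_measure R).

Definition caputo_integrand (alpha : R) (u : R -> R) (t tau : R) : R :=
  (t - tau) `^ (- alpha) * derive1 u tau.

(* u has Caputo derivative l of order alpha at t.  The integral over ]0, t[ is
   improper at 0 only: the derivative of u need not be absolutely integrable
   near 0 when u is merely continuous there.  If the integrand is Lebesgue
   integrable on ]0, t[, the limit is its Lebesgue integral. *)
Definition is_caputo_derivative (alpha : R) (u : R -> R) (t l : R) : Prop :=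
  [/\ forall tau : R, 0 < tau < t -> derivable u tau 1,
      forall e : R, 0 < e < t ->
        mu.-integrable `]e, t[ (EFin \o caputo_integrand alpha u t) &
      (Gamma (1 - alpha))^-1 *
        (\int[mu]_(tau in `]e, t[) caputo_integrand alpha u t tau)
        @[e --> 0^'+] --> l].

Definition solves_problem (alpha lambda T : R) (f g : R -> R)
    (c : R -> R -> R) : Prop :=
  [/\ forall x t : R, 0 < x -> 0 < t < T ->
        [/\ derivable (c ^~ t) x 1,
            derivable (derive1 (c ^~ t)) x 1 &
            is_caputo_derivative alpha (c x) t
              (lambda ^+ 2 * derive1n 2 (c ^~ t) x)],
      forall x : R, 0 < x -> c x t @[t --> 0^'+] --> f x &
      forall t : R, 0 < t < T -> derive1 (c ^~ t) x @[x --> 0^'+] --> g t].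

Section Candidate.
Variables (alpha lambda : R) (f g : R -> R).

Definition initial_integrand (x t xi : R) : R :=
  (mainardi (alpha / 2) ((x + xi) / (lambda * t `^ (alpha / 2))) +
   mainardi (alpha / 2) (`|x - xi| / (lambda * t `^ (alpha / 2)))) * f xi.

Definition boundary_integrand (t xi tau : R) : R :=
  mainardi (alpha / 2) (xi / (lambda * (t - tau) `^ (alpha / 2))) *
  (xi / (lambda * (t - tau) `^ (alpha / 2 + 1))) * (alpha / 2) * g tau.

Definition candidate (x t : R) : R :=
  1 / (2 * lambda * t `^ (alpha / 2)) *
    (\int[mu]_(xi in `[0, +oo[) initial_integrand x t xi)
  - \int[mu]_(xi in `[x, +oo[)
      (\int[mu]_(tau in `[0, t]) boundary_integrand t xi tau).

(* The Rocq expressions limn and \int are total; this says that the series and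
   integrals in the candidate actually converge for 0 < x and 0 < t < T. *)
Definition candidate_well_defined (T : R) : Prop :=
  (forall z : R, cvgn (series (mainardi_term (alpha / 2) z))) /\
  (forall x t : R, 0 < x -> 0 < t < T ->
     [/\ mu.-integrable `[0, +oo[ (EFin \o initial_integrand x t),
         forall xi : R, x <= xi ->
           mu.-integrable `[0, t] (EFin \o boundary_integrand t xi) &
         mu.-integrable `[x, +oo[ (EFin \o (fun xi =>
           \int[mu]_(tau in `[0, t]) boundary_integrand t xi tau))]).

End Candidate.
End FractionalDiffusion.

(* Main.v *)
Require Import Defs.
From HB Require Import structures.
From mathcomp Require Import all_boot all_order all_algebra.
From mathcomp Require Import all_classical all_reals all_analysis.
From mathcomp Require Import measurable_realfun.
From mathcomp Require Import ring lra.

Set Implicit Arguments.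
Unset Strict Implicit.
Unset Printing Implicit Defensive.

Import Order.TTheory GRing.Theory Num.Theory.
Import numFieldNormedType.Exports.

Local Open Scope ring_scope.
Local Open Scope classical_set_scope.

(** Put nu = alpha / 2, and let P_b(y, t) denote the inverse Laplace transform
    in t of p^(- b) exp (- y p^nu), for b < 1 and y > 0.  On transforms, the
    derivative in t, the derivative in y and the convolution with t^(a - 1) are
    multiplications by p, by - p^nu and by Gamma(a) p^(- a), so all three only
    shift the index b:

      d/dt P_b = P_(b - 1),      d/dy P_b = - P_(b - nu),
      int_0^t (t - s)^(a - 1) P_b(y, s) ds = Gamma(a) P_(a + b)(y, t).

    The Mainardi function is the profile of one of these kernels,
    P_(1 - nu)(y, t) = t^(- nu) M(y t^(- nu)), and P_0 is the one-sided stable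
    density, which satisfies t P_0 = nu y P_(1 - nu).  With the even
    extension h of f to the line, the candidate therefore reads

      c(x, t) = 1/2 int_0^oo P_(1 - nu)(y, t) (h(x + lambda y) + h(x - lambda y)) dy
                - lambda int_0^t P_nu(x / lambda, t - s) g(s) ds.

    For the second term the equation is immediate from the index shifts: both
    sides have the kernel P_(- nu).  For the first term, two
    derivatives in x give the kernel P_(1 - 3 nu) and a local term
    - f(x) t^(- alpha) / Gamma(1 - alpha), created at y = 0 because P_(1 - 2 nu)
    does not vanish there.  The Caputo derivative gives the same kernel, and the
    same local term appears because it subtracts the initial value from the
    potential.  The initial condition holds because P_(1 - nu) has mass 1 in y
    and concentrates at y = 0.  The flux condition holds because the first
    term contributes an odd function of x to dc/dx and the second one the
    convolution of g with P_0, which has mass 1 in t and concentrates at t = 0.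

    The kernels are treated as real integrals: a kernel is, up to 1 / pi, the
    integral over r > 0 of the imaginary part of p^(- b) exp (p t - y p^nu) dp
    on the ray of angle th.  That it does not depend on th
    (Rintegral_ray_rotation) follows by differentiating in th.  The angle pi/2
    gives smoothness in t and causality, the angle pi gives the behaviour at
    y = 0.  The index shift by a convolution is wU_convolution.  The masses come
    with Euler's reflection formula: testing P_0 against (1 - s)^(a - 1)
    evaluates its mass as Gamma(a) Gamma(1 - a) sin(pi a) / pi for every a in
    ]0, 1[ (stable_mass_reflection), and a -> 1 shows that it is 1
    (stable_mass1).  The reflection formula turns the coefficients of the
    Mainardi series into Euler integrals, and summation under the integral
    identifies the series with a kernel (mainardiE).  The two terms of the
    candidate are handled by has_deriv_potential_x and caputo_potential, and by
    caputo_boundary_potential. *)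

(** * Differentiation rules *)

Section Derivatives.
Context {R : realType}.
Implicit Types f g : R -> R.

(** The same proposition as is_derive, under a name that is not a class:
    derivatives of long expressions are assembled from the rules below rather
    than found by instance search. *)
Definition has_deriv f (x a : R) : Prop := is_derive x 1 f a.

Lemma has_deriv_eq f (x a b : R) : has_deriv f x a -> a = b -> has_deriv f x b.
Proof. by move=> df <-. Qed.

Lemma has_deriv_cst (k x : R) : has_deriv (fun=> k) x 0.
Proof. exact: is_derive_cst. Qed.

Lemma has_deriv_id (x : R) : has_deriv (fun t => t) x 1.
Proof. exact: is_derive_id. Qed.

Lemma has_deriv_mul f g (x a b : R) : has_deriv f x a -> has_deriv g x b ->
  has_deriv (fun t => f t * g t) x (a * g x + f x * b).
Proof.
move=> df dg; apply: has_deriv_eq (is_deriveM df dg) _.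
by rewrite /GRing.scale/=; ring.
Qed.

Lemma has_deriv_add f g (x a b : R) : has_deriv f x a -> has_deriv g x b ->
  has_deriv (fun t => f t + g t) x (a + b).
Proof. by move=> df dg; exact: is_deriveD. Qed.

Lemma has_deriv_sub f g (x a b : R) : has_deriv f x a -> has_deriv g x b ->
  has_deriv (fun t => f t - g t) x (a - b).
Proof. by move=> df dg; exact: is_deriveB. Qed.

Lemma has_deriv_opp f (x a : R) : has_deriv f x a -> has_deriv (fun t => - f t) x (- a).
Proof. by move=> df; exact: is_deriveN. Qed.

Lemma has_deriv_scale f (k x a : R) :
  has_deriv f x a -> has_deriv (fun t => k * f t) x (k * a).
Proof. by move=> df; exact: is_deriveZ. Qed.

Lemma has_deriv_comp f g (x a b : R) :
  has_deriv f (g x) a -> has_deriv g x b -> has_deriv (fun t => f (g t)) x (a * b).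
Proof. by move=> df dg; exact: (is_derive1_comp (f := f)). Qed.

Lemma has_deriv_expR f (x a : R) :
  has_deriv f x a -> has_deriv (fun t => expR (f t)) x (expR (f x) * a).
Proof. by move=> df; exact: (has_deriv_comp (is_derive_expR _) df). Qed.

Lemma has_deriv_sin f (x a : R) :
  has_deriv f x a -> has_deriv (fun t => sin (f t)) x (cos (f x) * a).
Proof. by move=> df; exact: (has_deriv_comp (is_derive_sin _) df). Qed.

Lemma has_deriv_cos f (x a : R) :
  has_deriv f x a -> has_deriv (fun t => cos (f t)) x (- sin (f x) * a).
Proof. by move=> df; exact: (has_deriv_comp (is_derive_cos _) df). Qed.

Lemma has_deriv_powR f (p x a : R) : 0 < f x -> has_deriv f x a ->
  has_deriv (fun t => f t `^ p) x (p * f x `^ (p - 1) * a).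
Proof.
by move=> fx0 df; exact: (has_deriv_comp (f := fun y => y `^ p) (is_derive1_powR p fx0) df).
Qed.

Lemma has_deriv_powR_id (p x : R) : 0 < x ->
  has_deriv (fun t => t `^ p) x (p * x `^ (p - 1)).
Proof. exact: is_derive1_powR. Qed.

Lemma has_deriv_continuous f (x a : R) : has_deriv f x a -> {for x, continuous f}.
Proof.
move=> [df _]; apply: differentiable_continuous.
exact/derivable1_diffP.
Qed.

Lemma has_deriv_derive1 f (x a : R) : has_deriv f x a -> f^`() x = a.
Proof. by move=> [_ h]; rewrite derive1E. Qed.

Lemma has_deriv_near f g (x a : R) : (\forall y \near x, f y = g y) ->
  has_deriv g x a -> has_deriv f x a.
Proof.
by move=> fg; apply: near_eq_is_derive; near=> y; rewrite (near fg y).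
Unshelve. all: by end_near. Qed.

Lemma has_deriv_cvg_right f (x k : R) : has_deriv f x k ->
  (f (x + e) - f x) / e @[e --> 0^'+] --> k.
Proof.
move=> [df <-]; have h : h^-1 *: (f (h *: 1 + x) - f x) @[h --> 0^'] --> 'D_1 f x by exact: df.
have := cvg_dnbhs_at_right h.
apply: cvg_trans; apply: near_eq_cvg; near=> e.
by rewrite (_ : e%:A = e); [rewrite [e + x]addrC [RHS]mulrC|exact: mulr1].
Unshelve. all: by end_near. Qed.

(** The mean value theorem applies to g - f and g + f, which vanish at 0
    and have nonnegative derivatives. *)
Lemma has_deriv_le (f df g dg : R -> R) (Q : R) : 0 < Q ->
  (forall s, has_deriv f s (df s)) -> (forall s, has_deriv g s (dg s)) ->
  f 0 = 0 -> g 0 = 0 -> (forall s, 0 < s < Q -> `|df s| <= dg s) -> `|f Q| <= g Q.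
Proof.
move=> Q0 hf hg f0 g0 fg.
have H (e : R) : `|e| = 1 -> 0 <= g Q - e * f Q.
  move=> e1; pose h s := g s - e * f s.
  have dh s : has_deriv h s (dg s - e * df s) by apply/has_deriv_sub/has_deriv_scale.
  have ch : {within `[0, Q], continuous h}.
    by apply: continuous_subspaceT => s; exact: has_deriv_continuous (dh s).
  have [s s0Q] := MVT Q0 (fun s _ => dh s) ch.
  rewrite /h f0 g0 mulr0 !subr0 => ->; rewrite mulr_ge0 ?(ltW Q0)// subr_ge0.
  rewrite (le_trans (ler_norm _))// normrM e1 mul1r; apply: fg.
  by move: s0Q; rewrite in_itv.
rewrite ler_norml; apply/andP; split.
  by have := H (-1); rewrite normrN1 => /(_ erefl); lra.
by have := H 1; rewrite normr1 => /(_ erefl); lra.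
Qed.

Lemma has_deriv_exprn (n : nat) (q : R) : has_deriv (fun q => q ^+ n.+1) q (n.+1%:R * q ^+ n).
Proof.
elim: n => [|n IHn].
  by under eq_fun do rewrite expr1; rewrite expr0 mulr1; exact: has_deriv_id.
under eq_fun do rewrite exprS.
apply: has_deriv_eq; first by apply: has_deriv_mul; [exact: has_deriv_id|exact: IHn].
by rewrite mul1r mulrCA -exprS -(natr1 n.+1) mulrDl mul1r addrC.
Qed.

End Derivatives.

(** * Changes of variables and limits under the integral sign *)

Section MeasureInvariance.
Context {R : realType}.
Local Notation mu := (@lebesgue_measure R).
Local Notation mR := (measurableTypeR R).

Lemma lebesgue_measure_shift (c : R) (A : set R) : measurable A ->
  pushforward mu ((fun x : R => x + c) : mR -> mR) A = mu A.
Proof.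
move=> mA.
apply/esym/lebesgue_measure_unique => //=.
  exact: measurable_funD.
move=> _ _ [[a b]] _ <-.
rewrite /pushforward.
rewrite (_ : _ @^-1` _ = `]a - c, b - c]%classic); last first.
  by apply/seteqP; split => x /=; rewrite !in_itv/= ltrBlDr lerBrDr.
rewrite !lebesgue_measure_itv/= !lte_fin ltrD2r.
by case: ifP => // _; rewrite -!EFinD; congr EFin; ring.
Qed.

Lemma lebesgue_measure_scale (k : {nonneg R}) (k0 : 0 < k%:num) (A : set R) :
  measurable A ->
  pushforward (mscale k mu) ((fun x => k%:num * x) : mR -> mR) A = mu A.
Proof.
move=> mA.
apply/esym/lebesgue_measure_unique => //=.
  exact: measurable_funM.
move=> _ _ [[a b]] _ <-.
rewrite /mscale /pushforward/=.
rewrite (_ : _ @^-1` _ = `]a / k%:num, b / k%:num]%classic); last first.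
  by apply/seteqP; split => x /=; rewrite !in_itv/= ltr_pdivrMr// ler_pdivlMr// ![_ * x]mulrC.
rewrite !lebesgue_measure_itv/= !lte_fin ltr_pM2r ?invr_gt0//.
case: ifP => // _; rewrite ?mule0// -!EFinD -EFinM; congr EFin.
by field; rewrite gt_eqF.
Qed.

(** For nonnegative functions this is integration against a push-forward.
    The positive and negative parts are treated separately, so that no
    integrability is needed. *)
Lemma integral_transfer (m : {measure set mR -> \bar R}) (phi : mR -> mR)
    (mphi : measurable_fun setT phi)
    (mE : forall A : set R, measurable A -> pushforward m phi A = mu A)
    (D : set R) (f : R -> \bar R) :
  measurable D -> measurable_fun D f ->
  (\int[mu]_(x in D) f x = \int[m]_(x in phi @^-1` D) f (phi x))%E.
Proof.
move=> mD mf.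
have H (g : R -> \bar R) : measurable_fun D g -> (forall x, (0 <= g x)%E) ->
  (\int[mu]_(x in D) g x = \int[m]_(x in phi @^-1` D) g (phi x))%E.
  move=> mg g0.
  rewrite -(@ge0_integral_pushforward _ _ _ _ _ _ mphi)//.
  apply: eq_measure_integral => //= A mA AD; exact/esym/mE.
rewrite integralE [RHS]integralE.
have mp : measurable_fun D f^\+%E by exact: measurable_funepos.
have mn : measurable_fun D f^\-%E by exact: measurable_funeneg.
congr (_ - _)%E.
- apply: etrans (H _ mp (funepos_ge0 f)) _; apply: eq_integral => x _.
  by rewrite !funeposE.
- apply: etrans (H _ mn (funeneg_ge0 f)) _; apply: eq_integral => x _.
  by rewrite !funenegE.
Qed.

Lemma integral_shift (c : R) (D : set R) (f : R -> \bar R) :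
  measurable D -> measurable_fun D f ->
  (\int[mu]_(x in D) f x = \int[mu]_(x in (fun x : R => x + c)%R @^-1` D) f (x + c)%R)%E.
Proof.
move=> mD mf; apply: (integral_transfer (phi := fun x : R => x + c)) => //.
  exact: measurable_funD.
exact: lebesgue_measure_shift.
Qed.

Lemma integral_opp (D : set R) (f : R -> \bar R) :
  measurable D -> measurable_fun D f ->
  (\int[mu]_(x in D) f x = \int[mu]_(x in -%R @^-1` D) f (- x)%R)%E.
Proof.
move=> mD mf; apply: (integral_transfer (phi := -%R)) => //.
exact: lebesgue_measureN.
Qed.

Lemma ge0_integral_scale (k : R) (D : set R) (f : R -> \bar R) : 0 < k ->
  measurable D -> measurable_fun D f -> (forall x, (0 <= f x)%E) ->
  (\int[mu]_(x in D) f x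
   = k%:E * \int[mu]_(x in (fun x : R => k * x)%R @^-1` D) f (k * x)%R)%E.
Proof.
move=> k0 mD mf f0.
pose kn := NngNum (ltW k0).
have mk : measurable_fun [set: mR] ((fun x => k * x) : mR -> mR).
  exact: measurable_funM.
have mkD : measurable ((fun x : R => k * x) @^-1` D).
  by rewrite -[X in measurable X]setTI; exact: mk.
rewrite (integral_transfer (m := mscale kn mu) (phi := fun x => k * x))//; last first.
  exact: (lebesgue_measure_scale (k := kn)).
rewrite ge0_integral_mscale//.
apply: (measurable_comp (F := D)) => //; first by move=> _ [x + <-].
Qed.

Lemma Rintegral_scale (k : R) (D : set R) (f : R -> R) : 0 < k ->
  measurable D -> mu.-integrable D (EFin \o f) ->
  mu.-integrable ((fun x => k * x) @^-1` D) (EFin \o (fun x => f (k * x))) /\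
  \int[mu]_(x in D) f x = k * \int[mu]_(x in (fun x => k * x) @^-1` D) f (k * x).
Proof.
move=> k0 mD intf.
have mk : measurable_fun [set: mR] ((fun x => k * x) : mR -> mR).
  exact: measurable_funM.
have mkD : measurable ((fun x : R => k * x) @^-1` D).
  by rewrite -[X in measurable X]setTI; exact: mk.
have mf := measurable_int _ intf.
have mfk : measurable_fun ((fun x : R => k * x) @^-1` D) (EFin \o (fun x => f (k * x))).
  apply: (measurable_comp (F := D) (f := EFin \o f)) => //; first by move=> _ [x + <-].
have ik : mu.-integrable ((fun x => k * x) @^-1` D) (EFin \o (fun x => f (k * x))).
  apply/integrableP; split => //.
  move/integrableP : intf => [_].
  (* an infinite integral would remain infinite after multiplication by k > 0 *)
  rewrite (ge0_integral_scale k0)//; last exact: measurableT_comp.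
  move=> h; rewrite ltNge; apply/negP; rewrite leye_eq => /eqP hy.
  by move: h; rewrite hy gt0_muley ?lte_fin// ltxx.
split => //.
rewrite /Rintegral integralE [in RHS]integralE.
rewrite (ge0_integral_scale k0 mD (measurable_funepos mf) (funepos_ge0 _)).
rewrite (ge0_integral_scale k0 mD (measurable_funeneg mf) (funeneg_ge0 _)).
have ip := @integrable_fin_num _ _ _ mu _ mkD _ (@integrable_funepos _ _ _ mu _ mkD _ ik).
have iN := @integrable_fin_num _ _ _ mu _ mkD _ (@integrable_funeneg _ _ _ mu _ mkD _ ik).
have Ep : (\int[mu]_(x in (fun x : R => k * x)%R @^-1` D) (EFin \o f)^\+ (k * x)%R =
  \int[mu]_(x in (fun x : R => k * x)%R @^-1` D) (EFin \o (fun x : R => f (k * x)%R))^\+ x)%E.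
  by apply: eq_integral => x _; rewrite !funeposE.
have En : (\int[mu]_(x in (fun x : R => k * x)%R @^-1` D) (EFin \o f)^\- (k * x)%R =
  \int[mu]_(x in (fun x : R => k * x)%R @^-1` D) (EFin \o (fun x : R => f (k * x)%R))^\- x)%E.
  by apply: eq_integral => x _; rewrite !funenegE.
rewrite Ep En -muleBr//; last by rewrite fin_num_adde_defr.
by rewrite fineM// fin_numB ip iN.
Qed.

Lemma Rintegral_shift (c : R) (D : set R) (f : R -> R) :
  measurable D -> mu.-integrable D (EFin \o f) ->
  mu.-integrable ((fun x => x + c) @^-1` D) (EFin \o (fun x => f (x + c))) /\
  \int[mu]_(x in D) f x = \int[mu]_(x in (fun x => x + c) @^-1` D) f (x + c).
Proof.
move=> mD /integrableP[mf intf].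
have mk : measurable_fun [set: mR] ((fun x => x + c) : mR -> mR).
  exact: measurable_funD.
split; last by rewrite /Rintegral (integral_shift c).
apply/integrableP; split.
  apply: (measurable_comp (F := D) (f := EFin \o f)) => //; first by move=> _ [x + <-].
  exact: measurable_funTS.
by move: intf; rewrite (integral_shift c)//; exact: measurableT_comp.
Qed.

Lemma Rintegral_opp (D : set R) (f : R -> R) :
  measurable D -> mu.-integrable D (EFin \o f) ->
  mu.-integrable (-%R @^-1` D) (EFin \o (fun x => f (- x))) /\
  \int[mu]_(x in D) f x = \int[mu]_(x in -%R @^-1` D) f (- x).
Proof.
move=> mD /integrableP[mf intf].
split; last by rewrite /Rintegral integral_opp.
apply/integrableP; split.
  apply: (measurable_comp (F := D) (f := EFin \o f)) => //; first by move=> _ [x + <-].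
by move: intf; rewrite integral_opp//; exact: measurableT_comp.
Qed.

End MeasureInvariance.

Section DominatedConvergence.
Context {R : realType}.
Local Notation mu := (@lebesgue_measure R).

Lemma Rdominated_cvg (D : set R) (f_ : nat -> R -> R) (f g : R -> R) :
  measurable D -> (forall n, measurable_fun D (f_ n)) ->
  (forall x, D x -> f_ n x @[n --> \oo] --> f x) ->
  mu.-integrable D (EFin \o g) ->
  (forall n x, D x -> `|f_ n x| <= g x) ->
  mu.-integrable D (EFin \o f) /\
  \int[mu]_(x in D) f_ n x @[n --> \oo] --> \int[mu]_(x in D) f x.
Proof.
move=> mD mf_ f_f ig fg.
have mf : measurable_fun D f.
  by apply: (measurable_fun_cvg (h := f_)) => //.
have fle x : D x -> `|f x| <= g x.
  move=> Dx; have h : `|f_ n x| @[n --> \oo] --> `|f x| by apply: cvg_norm; exact: f_f.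
  rewrite -(cvg_lim _ h)//; apply: limr_le; first by apply/cvg_ex; exists (`|f x|).
  by apply: nearW => n; exact: fg.
have itf : mu.-integrable D (EFin \o f).
  apply: le_integrable ig => //; first exact/measurable_EFinP.
  by move=> x Dx /=; rewrite lee_fin (le_trans (fle _ Dx))// ler_norm.
split => //.
apply: fine_cvg; rewrite fineK; last exact: (integrable_fin_num _ itf).
apply: (@dominated_cvg _ _ _ mu D mD (fun n x => (f_ n x)%:E) (EFin \o f) (EFin \o g)) => //.
- by move=> n; apply/measurable_EFinP; exact: mf_.
- by move=> x Dx; apply: cvg_EFin; [exact: nearW|exact: f_f].
Qed.

(** Limits on the right of a point are determined by sequences. *)
Lemma Rdominated_cvg_at_right (a d : R) (D : set R) (f_ : R -> R -> R)
    (f g : R -> R) : 0 < d ->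
  measurable D -> (forall e, a < e < a + d -> measurable_fun D (f_ e)) ->
  (forall x, D x -> f_ e x @[e --> a^'+] --> f x) ->
  mu.-integrable D (EFin \o g) ->
  (forall e x, a < e < a + d -> D x -> `|f_ e x| <= g x) ->
  mu.-integrable D (EFin \o f) /\
  \int[mu]_(x in D) f_ e x @[e --> a^'+] --> \int[mu]_(x in D) f x.
Proof.
move=> d0 mD mf_ f_f ig fg.
have H (u : nat -> R) : (forall n, a < u n) /\ u n @[n --> \oo] --> a ->
  mu.-integrable D (EFin \o f) /\
  \int[mu]_(x in D) f_ (u n) x @[n --> \oo] --> \int[mu]_(x in D) f x.
  move=> [au ua].
  have [N _ Nu] : \forall n \near \oo, u n < a + d.
    by apply: (cvgr_lt a) => //; rewrite ltrDl.
  have uN n : a < u (n + N)%N < a + d by rewrite au/= Nu//= leq_addl.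
  have [h1 h2] : mu.-integrable D (EFin \o f) /\
    \int[mu]_(x in D) f_ (u (n + N)%N) x @[n --> \oo] --> \int[mu]_(x in D) f x.
    apply: (@Rdominated_cvg D (fun n => f_ (u (n + N)%N)) f g) => //.
    - by move=> n; exact: mf_.
    - move=> x Dx; rewrite (cvg_shiftn N (fun n => f_ (u n) x)).
      by have /cvg_at_rightP := f_f _ Dx; apply.
    - by move=> n x Dx; exact: fg.
  split => //.
  by rewrite -(cvg_shiftn N).
split; last by apply/cvg_at_rightP => u /H [].
suff [] : exists u : nat -> R, (forall n, a < u n) /\ u n @[n --> \oo] --> a.
  by move=> u /H [].
exists (fun n => a + n.+1%:R^-1); split; first by move=> n; rewrite ltrDl.
rewrite -[X in _ --> X]addr0; apply: cvgD; first exact: cvg_cst.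
exact: cvg_harmonic.
Qed.

Lemma cvg_right_eq (a d : R) (f g : R -> R) (l : R) : 0 < d ->
  (forall y, a < y < a + d -> f y = g y) ->
  f y @[y --> a^'+] --> l -> g y @[y --> a^'+] --> l.
Proof.
move=> d0 fg; apply: cvg_trans; apply: near_eq_cvg; near=> y; apply: fg.
apply/andP; split; first by near: y; exact: nbhs_right_gt.
by near: y; apply: nbhs_right_lt; rewrite ltrDl.
Unshelve. all: by end_near. Qed.

End DominatedConvergence.

Section UnderIntegral.
Context {R : realType}.
Local Notation mu := (@lebesgue_measure R).

(** Differentiation under the integral sign, for a parameter ranging over
    an open interval on which one integrable function bounds the derivative. *)
Lemma has_deriv_Rintegral (D : set R) (f df : R -> R -> R) (g : R -> R) (x0 u v : R) :
  measurable D -> u < x0 < v ->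
  (forall x, u < x < v -> mu.-integrable D (EFin \o f x)) ->
  (forall x y, u < x < v -> D y -> has_deriv (f ^~ y) x (df x y)) ->
  mu.-integrable D (EFin \o g) ->
  (forall x y, u < x < v -> D y -> `|df x y| <= g y) ->
  has_deriv (fun x => \int[mu]_(y in D) f x y) x0 (\int[mu]_(y in D) df x0 y).
Proof.
move=> mD x0uv itf dfE itg dfg.
have Ix0 : `]u, v[%classic x0 by rewrite /= in_itv.
have I1 x : `]u, v[%classic x -> mu.-integrable D (EFin \o f x).
  by rewrite /= in_itv/= => /itf.
have I2 x y : `]u, v[%classic x -> D y -> derivable (f ^~ y) x 1.
  by rewrite /= in_itv/= => xuv Dy; have [] := dfE _ _ xuv Dy.
have I3 : mu.-integrable D (EFin \o (fun y => `|g y|)) by exact: integrable_norm.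
have I4 x y : `]u, v[%classic x -> D y -> `|partial1of2 f x y| <= `|g y|.
  rewrite /= in_itv/= => xuv Dy.
  rewrite /partial1of2 (has_deriv_derive1 (dfE _ _ xuv Dy)).
  by rewrite (le_trans (dfg _ _ xuv Dy))// ler_norm.
have h1 := @derivable_under_integral R _ _ mu f D mD _ _ _ Ix0 I1 I2 _ (fun y => normr_ge0 (g y)) I3 I4.
have h2 := @differentiation_under_integral R _ _ mu f D mD _ _ _ Ix0 I1 I2 _ (fun y => normr_ge0 (g y)) I3 I4.
apply: DeriveDef => //; rewrite -derive1E h2.
apply: eq_Rintegral => y; rewrite inE => Dy.
by rewrite /partial1of2 (has_deriv_derive1 (dfE _ _ x0uv Dy)).
Qed.

Lemma RintegrableD (D : set R) (f g : R -> R) : measurable D ->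
  mu.-integrable D (EFin \o f) -> mu.-integrable D (EFin \o g) ->
  mu.-integrable D (EFin \o (fun x => f x + g x)).
Proof.
move=> mD itf itg; apply: (@eq_integrable _ _ _ mu D mD _ _ _ (@integrableD _ _ _ mu D mD _ _ itf itg)).
by move=> x _.
Qed.

Lemma RintegrableB (D : set R) (f g : R -> R) : measurable D ->
  mu.-integrable D (EFin \o f) -> mu.-integrable D (EFin \o g) ->
  mu.-integrable D (EFin \o (fun x => f x - g x)).
Proof.
move=> mD itf itg; apply: (@eq_integrable _ _ _ mu D mD _ _ _ (@integrableB _ _ _ mu D mD _ _ itf itg)).
by move=> x _.
Qed.

Lemma RintegrableZ (D : set R) (k : R) (f : R -> R) : measurable D ->
  mu.-integrable D (EFin \o f) ->
  mu.-integrable D (EFin \o (fun x => k * f x)).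
Proof.
move=> mD itf; apply: (@eq_integrable _ _ _ mu D mD _ _ _ (@integrableZl _ _ _ mu D mD k _ itf)).
by move=> x _.
Qed.

Lemma Rle_integrable (D : set R) (f g : R -> R) : measurable D ->
  measurable_fun D f -> mu.-integrable D (EFin \o g) ->
  (forall x, D x -> `|f x| <= g x) -> mu.-integrable D (EFin \o f).
Proof.
move=> mD mf itg fg; apply: (@le_integrable _ _ _ mu D mD _ (EFin \o g)) => //.
  exact/measurable_EFinP.
by move=> x Dx /=; rewrite lee_fin (le_trans (fg _ Dx))// ler_norm.
Qed.

End UnderIntegral.

Section Fubini.
Context {R : realType}.
Local Notation mu := (@lebesgue_measure R).
Local Notation mR := (measurableTypeR R).

(** The product majorant makes f, extended by 0 outside A `*` B, integrable
    for the product measure. *)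
Lemma Rfubini (A B : set R) (f : R -> R -> R) (g h : R -> R) :
  measurable A -> measurable B ->
  measurable_fun (A `*` B : set (mR * mR)) (fun z : mR * mR => f z.1 z.2) ->
  mu.-integrable A (EFin \o g) -> mu.-integrable B (EFin \o h) ->
  (forall x y, A x -> B y -> `|f x y| <= g x * h y) ->
  mu.-integrable A (EFin \o (fun x => \int[mu]_(y in B) f x y)) /\
  \int[mu]_(x in A) (\int[mu]_(y in B) f x y) =
  \int[mu]_(y in B) (\int[mu]_(x in A) f x y).
Proof.
move=> mA mB mf ig ih fgh.
pose F : mR * mR -> R := (fun z : mR * mR => f z.1 z.2) \_ (A `*` B).
have mAB : measurable (A `*` B : set (mR * mR)) by exact: measurableX.
have mF : measurable_fun setT (EFin \o F).
  by apply/measurable_EFinP; apply/(measurable_restrictT _ mAB).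
have FE x y : F (x, y) = if (x \in A) && (y \in B) then f x y else 0.
  by rewrite /F patchE in_setX.
have mfx x : A x -> measurable_fun B (f x).
  move=> Ax.
  have mFx : measurable_fun setT (fun y => F (x, y)).
    apply: (measurableT_comp (f := F)); last exact: measurable_pair1.
    by apply/(measurable_restrictT _ mAB).
  apply: (eq_measurable_fun (fun y => F (x, y))); last exact: measurable_funTS.
  by move=> y yB; rewrite FE mem_set//= yB.
have mfy y : B y -> measurable_fun A (f ^~ y).
  move=> By.
  have mFy : measurable_fun setT (fun x => F (x, y)).
    apply: (measurableT_comp (f := F)); last exact: measurable_pair2.
    by apply/(measurable_restrictT _ mAB).
  apply: (eq_measurable_fun (fun x => F (x, y))); last exact: measurable_funTS.
  by move=> x xA; rewrite FE xA mem_set.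
have igx x : A x -> mu.-integrable B (EFin \o f x).
  move=> Ax; apply: (Rle_integrable (g := fun y => g x * h y)) => //.
  - exact: mfx.
  - exact: RintegrableZ.
  - by move=> y By; exact: fgh.
have igy y : B y -> mu.-integrable A (EFin \o (f ^~ y)).
  move=> By; apply: (Rle_integrable (g := fun x => h y * g x)) => //.
  - exact: mfy.
  - exact: RintegrableZ.
  - by move=> x Ax; rewrite mulrC; exact: fgh.
have F1 x : (\int[mu]_y (EFin \o F) (x, y))%E =
    (((fun x => \int[mu]_(y in B) f x y) \_ A) x)%:E.
  have [xA|xA] := boolP (x \in A).
    rewrite patchE xA /Rintegral fineK; last first.
      by apply: integrable_fin_num => //; apply: igx; exact: set_mem.
    rewrite [RHS]integral_mkcond; apply: eq_integral => y _ /=.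
    by rewrite FE xA/= patchE; case: ifP.
  rewrite patchE (negbTE xA); apply: integral0_eq => y _ /=.
  by rewrite FE (negbTE xA).
have F2 y : (\int[mu]_x (EFin \o F) (x, y))%E =
    (((fun y => \int[mu]_(x in A) f x y) \_ B) y)%:E.
  have [yB|yB] := boolP (y \in B).
    rewrite patchE yB /Rintegral fineK; last first.
      by apply: integrable_fin_num => //; apply: igy; exact: set_mem.
    rewrite [RHS]integral_mkcond; apply: eq_integral => x _ /=.
    by rewrite FE yB andbT patchE; case: ifP.
  rewrite patchE (negbTE yB); apply: integral0_eq => x _ /=.
  by rewrite FE (negbTE yB) andbF.
have iF : (mu \x mu)%E.-integrable setT (EFin \o F).
  apply/integrable12ltyP => //.
  pose c := \int[mu]_(y in B) `|h y|.
  pose k : R -> R := (fun x => c * `|g x|) \_ A.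
  have ig' : mu.-integrable setT (EFin \o k).
    rewrite -restrict_EFin; apply/integrable_restrict => //; rewrite setTI.
    by apply: RintegrableZ => //; exact: integrable_norm.
  have /integrableP[_] := ig'; apply: le_lt_trans.
  apply: ge0_le_integral => //.
  - by move=> x _; exact: integral_ge0.
  - apply: (@measurable_fun_fubini_tonelli_F _ _ mR mR R mu (abse \o (EFin \o F))) => //.
      exact: measurableT_comp.
    by move=> z; exact: abse_ge0.
  - by have /integrableP[m _] := ig'; exact: measurableT_comp.
  move=> x _; have [xA|xA] := boolP (x \in A); last first.
    rewrite [leLHS]integral0_eq//.
    by move=> y _ /=; rewrite FE (negbTE xA)/= normr0.
  have ihn : mu.-integrable B (EFin \o (fun y => `|g x| * `|h y|)).
    by apply: RintegrableZ => //; exact: integrable_norm.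
  have -> : (`|(EFin \o k) x| =
            \int[mu]_(y in B) (`|g x| * `|h y|)%:E)%E.
    rewrite /= /k patchE xA ger0_norm; last by rewrite mulr_ge0// Rintegral_ge0.
    rewrite -[RHS]fineK; last exact: (integrable_fin_num _ ihn).
    rewrite -[fine _]/(Rintegral _ _ _) RintegralZl//; first by rewrite mulrC.
    exact: integrable_norm.
  rewrite [leRHS]integral_mkcond; apply: ge0_le_integral => //.
  - apply: (@measurableT_comp _ _ _ _ _ _ abse) => //.
    by apply: (measurableT_comp (f := EFin \o F)) => //; exact: measurable_pair1.
  - apply/(measurable_restrictT _ mB).
    by have /integrableP[] := ihn.
  move=> y _ /=; rewrite FE xA/= patchE; case: ifPn => yB; last by rewrite normr0.
  rewrite lee_fin (le_trans (fgh _ _ (set_mem xA) (set_mem yB)))//.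
  by rewrite -normrM ler_norm.
have iFx := @integrable_fubini_F _ _ _ _ _ mu mu _ iF.
have iG : mu.-integrable A (EFin \o (fun x => \int[mu]_(y in B) f x y)).
  rewrite -[A]setTI; apply/integrable_restrict => //; rewrite restrict_EFin.
  by apply: eq_integrable iFx => // x _; rewrite /fubini_F F1.
split => //.
rewrite Rintegral_mkcond [RHS]Rintegral_mkcond /Rintegral; congr fine.
have FF := Fubini iF.
apply: etrans; first by apply: eq_integral => x _; exact: (esym (F1 x)).
apply: etrans; first exact: FF.
by apply: eq_integral => y _; exact: F2.
Qed.

End Fubini.

(** * Integrals over half-lines and intervals *)

Section HalfLine.
Context {R : realType}.
Local Notation mu := (@lebesgue_measure R).
Local Notation HL := [set` @Interval R (BRight 0%R) +oo%O].
Implicit Types f F : R -> R.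

Let I_ (n : nat) : set R := `[n.+1%:R^-1, n.+1%:R]%classic.

Let I_bigcup : \bigcup_n I_ n = HL.
Proof.
apply/seteqP; split => x.
  move=> [n _]; rewrite /I_ /= !in_itv/= andbT => /andP[+ _].
  by apply: lt_le_trans.
rewrite /= in_itv/= andbT => x0.
exists (Num.bound (Num.max x x^-1)) => //.
rewrite /I_/= in_itv/=.
have h : Num.max x x^-1 < (Num.bound (Num.max x x^-1))%:R.
  by apply: archi_boundP; rewrite le_max ltW.
have h' : Num.max x x^-1 <= (Num.bound (Num.max x x^-1)).+1%:R.
  by rewrite (le_trans (ltW h))// ler_nat.
move: h'; rewrite ge_max => /andP[-> h2]; rewrite andbT.
by rewrite invf_ple// posrE.
Qed.

Let I_homo : {homo I_ : n m / (n <= m)%N >-> (n <= m)%O}.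
Proof.
move=> n m nm; rewrite subsetEset => x; rewrite /I_ /= !in_itv/= => /andP[nx xn].
rewrite (le_trans _ nx) ?lef_pV2 ?posrE ?ler_nat//=.
by rewrite (le_trans xn)// ler_nat.
Qed.

Let I_sub n : I_ n `<=` HL.
Proof. by rewrite -I_bigcup; exact: bigcup_sup. Qed.

Let FTC_I f F n :
  (forall x : R, 0 < x -> has_deriv F x (f x)) ->
  (forall x : R, 0 < x -> {for x, continuous f}) ->
  (\int[mu]_(x in I_ n) (f x)%:E = (F n.+1%:R)%:E - (F n.+1%:R^-1)%:E)%E.
Proof.
move=> dF cf; have [->|n0] := eqVneq n 0%N.
  by rewrite /I_ invr1 set_itv1 integral_set1 -EFinB subrr.
have lt0 : 0 < n.+1%:R^-1 :> R by rewrite invr_gt0.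
have ltn : n.+1%:R^-1 < n.+1%:R :> R.
  rewrite (@lt_trans _ _ 1)//; first by rewrite invf_lt1 ?ltr1n ?ltnS ?lt0n.
  by rewrite ltr1n ltnS lt0n.
apply: continuous_FTC2 => //.
- apply: continuous_in_subspaceT => x; rewrite inE/= in_itv/= => /andP[xa _].
  by apply: cf; exact: lt_le_trans xa.
- split.
  + by move=> x; rewrite in_itv/= => /andP[xa _]; have [] := dF x (lt_trans lt0 xa).
  + apply: cvg_at_right_filter; apply: differentiable_continuous.
    by apply/derivable1_diffP; have [] := dF _ lt0.
  + apply: cvg_at_left_filter; apply: differentiable_continuous.
    by apply/derivable1_diffP; have [] := dF n.+1%:R (ltr0Sn _ _).
- move=> x; rewrite in_itv/= => /andP[xa _].
  by rewrite derive1E; have [_ ->] := dF x (lt_trans lt0 xa).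
Qed.

Lemma continuous_half_line_measurable f :
  (forall x : R, 0 < x -> {for x, continuous f}) -> measurable_fun HL f.
Proof.
move=> cf; apply: open_continuous_measurable_fun; first exact: interval_open.
by move=> x; rewrite inE/= in_itv/= andbT => /cf.
Qed.

(** The integrals over the exhausting segments are increments of F, at most
    2 C, and they converge monotonically to the integral over the half-line. *)
Lemma ge0_integrable_half_line f F (C : R) :
  (forall x : R, 0 < x -> 0 <= f x) ->
  (forall x : R, 0 < x -> has_deriv F x (f x)) ->
  (forall x : R, 0 < x -> {for x, continuous f}) ->
  (forall x : R, 0 < x -> `|F x| <= C) ->
  mu.-integrable HL (EFin \o f).
Proof.
move=> f0 dF cf FC.
have mf := continuous_half_line_measurable cf.
apply/integrableP; split; first exact/measurable_EFinP.
rewrite (_ : (\int[mu]_(x in _) _)%E = (\int[mu]_(x in HL) (f x)%:E)%E); last first.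
  apply: eq_integral => x; rewrite inE/= in_itv/= andbT => x0.
  by rewrite /= ger0_norm// f0.
apply: (@le_lt_trans _ _ (C + C)%:E); last exact: ltry.
have h : (\int[mu]_(x in I_ n) (f x)%:E)%E @[n --> \oo] -->
     (\int[mu]_(x in \bigcup_n I_ n) (f x)%:E)%E.
  apply: ge0_nondecreasing_set_cvg_integral => //.
  - by move=> n; exact: measurable_itv.
  - by move=> n; apply/measurable_EFinP; apply: measurable_funS mf => //; exact: I_sub.
  - by move=> n x /I_sub; rewrite /= in_itv/= andbT lee_fin => /f0.
rewrite I_bigcup in h.
rewrite -(cvg_lim _ h)//; apply: lime_le; first by apply/cvg_ex; eexists; exact: h.
apply: nearW => n; rewrite (FTC_I _ dF cf) -EFinB lee_fin.
rewrite (le_trans (ler_norm _))// (le_trans (ler_normB _ _))//.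
by rewrite lerD// FC// ?invr_gt0.
Qed.

(** The fundamental theorem of calculus on the exhausting segments; the
    limits of F take the place of its values at the ends. *)
Lemma Rintegral_half_line f F (l0 l1 : R) :
  (forall x : R, 0 < x -> has_deriv F x (f x)) ->
  (forall x : R, 0 < x -> {for x, continuous f}) ->
  mu.-integrable HL (EFin \o f) ->
  F x @[x --> 0^'+] --> l0 -> F x @[x --> +oo] --> l1 ->
  \int[mu]_(x in HL) f x = l1 - l0.
Proof.
move=> dF cf itf Fl0 Fl1.
have mf := continuous_half_line_measurable cf.
have [_ h] : mu.-integrable HL (EFin \o f) /\
   \int[mu]_(x in HL) (f \_ (I_ n)) x @[n --> \oo] --> \int[mu]_(x in HL) f x.
  apply: (Rdominated_cvg (g := fun x => `|f x|)) => //.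
  - move=> n; apply/(measurable_restrict f) => //; first exact: measurable_itv.
    by apply: measurable_funS mf => // x [].
  - move=> x /= x0; apply: cvg_near_cst.
    have : HL x by [].
    rewrite -I_bigcup => -[N _ INx].
    exists N => // n /= Nn; rewrite patchE mem_set//.
    by have := I_homo Nn; rewrite subsetEset; exact.
  - exact: integrable_norm.
  - by move=> n x _; rewrite patchE; case: ifP => // _; rewrite normr0.
have h2 : F n.+1%:R - F n.+1%:R^-1 @[n --> \oo] --> l1 - l0.
  apply: cvgB.
    move/cvg_pinftyP : Fl1; apply; apply/cvgryPge => A.
    exists (Num.bound `|A|) => // n /= An.
    rewrite (@le_trans _ _ (Num.bound `|A|)%:R)//.
      by rewrite (le_trans (ler_norm _))// ltW// archi_boundP.
    by rewrite ler_nat ltnW.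
  move/cvg_at_rightP : Fl0; apply; split=> [n|]; first by rewrite invr_gt0.
  exact: cvg_harmonic.
rewrite -(cvg_lim _ h2)// -(cvg_lim _ h)//; congr (limn _).
apply/funext => n; rewrite -Rintegral_mkcondr setIidr; last exact: I_sub.
by rewrite /Rintegral (FTC_I _ dF cf).
Qed.

End HalfLine.

Section HalfLineIntegrals.
Context {R : realType}.
Local Notation mu := (@lebesgue_measure R).
Local Notation HL := [set` @Interval R (BRight 0%R) +oo%O].

Lemma le_integrable_half_line (f g : R -> R) : measurable_fun HL f ->
  mu.-integrable HL (EFin \o g) -> (forall r, 0 < r -> `|f r| <= g r) ->
  mu.-integrable HL (EFin \o f).
Proof.
move=> mf ig fg; apply: (@Rle_integrable _ _ _ _ (measurable_itv _) mf ig) => r.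
by rewrite /= in_itv/= andbT; exact: fg.
Qed.

Lemma RintegralZ_half_line (k : R) (f : R -> R) : mu.-integrable HL (EFin \o f) ->
  \int[mu]_(r in HL) (k * f r) = k * \int[mu]_(r in HL) f r.
Proof. exact: (@RintegralZl _ _ _ mu HL f k (measurable_itv _)). Qed.

Lemma eq_Rintegral_half_line (f g : R -> R) : (forall r, 0 < r -> f r = g r) ->
  \int[mu]_(x in HL) f x = \int[mu]_(x in HL) g x.
Proof.
move=> fg; apply: eq_Rintegral => r; rewrite inE/= in_itv/= andbT; exact: fg.
Qed.

Lemma preimage_scale_half_line (k : R) : 0 < k -> (fun x => k * x) @^-1` HL = HL.
Proof.
by move=> k0; apply/seteqP; split => x /=; rewrite !in_itv/= !andbT pmulr_rgt0.
Qed.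

Lemma Rintegral_scale_half_line (k : R) (f : R -> R) : 0 < k ->
  mu.-integrable HL (EFin \o f) ->
  mu.-integrable HL (EFin \o (fun x => f (k * x))) /\
  \int[mu]_(x in HL) f x = k * \int[mu]_(x in HL) f (k * x).
Proof.
move=> k0 itf; have := Rintegral_scale k0 (measurable_itv _) itf.
by rewrite preimage_scale_half_line.
Qed.

Lemma Rintegral_shift_half_line (x : R) (f : R -> R) : mu.-integrable HL (EFin \o f) ->
  mu.-integrable `]x, +oo[ (EFin \o (fun z => f (z - x))) /\
  \int[mu]_(r in HL) f r = \int[mu]_(z in `]x, +oo[) f (z - x).
Proof.
move=> iF; have := Rintegral_shift (- x) (measurable_itv _) iF.
have -> // : (fun z : R => z - x) @^-1` HL = `]x, +oo[.
by apply/seteqP; split => z /=; rewrite !in_itv/= !andbT subr_gt0.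
Qed.

Lemma RintegralD_half_line (f g : R -> R) : mu.-integrable HL (EFin \o f) ->
  mu.-integrable HL (EFin \o g) ->
  \int[mu]_(r in HL) (f r + g r) = \int[mu]_(r in HL) f r + \int[mu]_(r in HL) g r.
Proof. exact: (@RintegralD _ _ _ mu HL f g (measurable_itv _)). Qed.

Lemma RintegralB_half_line (f g : R -> R) : mu.-integrable HL (EFin \o f) ->
  mu.-integrable HL (EFin \o g) ->
  \int[mu]_(r in HL) (f r - g r) = \int[mu]_(r in HL) f r - \int[mu]_(r in HL) g r.
Proof. exact: (@RintegralB _ _ _ mu HL f g (measurable_itv _)). Qed.

Lemma normr_Rintegral_le (D : set R) (f g : R -> R) : measurable D ->
  measurable_fun D f -> mu.-integrable D (EFin \o g) ->
  (forall r, D r -> `|f r| <= g r) ->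
  `|\int[mu]_(r in D) f r| <= \int[mu]_(r in D) g r.
Proof.
move=> mD mf ig fg; have itf := Rle_integrable mD mf ig fg.
rewrite (le_trans (@le_normr_Rintegral _ _ _ mu D f mD itf))//.
by apply: (@le_Rintegral _ _ _ mu D) => //; exact: (@integrable_norm _ _ _ mu D).
Qed.

Lemma normr_Rintegral_half_line_le (f g : R -> R) :
  measurable_fun HL f -> mu.-integrable HL (EFin \o g) ->
  (forall r, 0 < r -> `|f r| <= g r) ->
  `|\int[mu]_(r in HL) f r| <= \int[mu]_(r in HL) g r.
Proof.
move=> mf ig fg; apply: (normr_Rintegral_le (measurable_itv _) mf ig).
by move=> r; rewrite /= in_itv/= andbT; exact: fg.
Qed.

Lemma measurable_integrable (D : set R) (f : R -> R) :
  mu.-integrable D (EFin \o f) -> measurable_fun D f.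
Proof. by case/integrableP => /measurable_EFinP. Qed.

Lemma integrableD_half_line f g : mu.-integrable HL (EFin \o f) ->
  mu.-integrable HL (EFin \o g) -> mu.-integrable HL (EFin \o (fun r => f r + g r)).
Proof. exact: (RintegrableD (measurable_itv _)). Qed.

Lemma integrableB_half_line f g : mu.-integrable HL (EFin \o f) ->
  mu.-integrable HL (EFin \o g) -> mu.-integrable HL (EFin \o (fun r => f r - g r)).
Proof. exact: (RintegrableB (measurable_itv _)). Qed.

Lemma integrableZ_half_line k f : mu.-integrable HL (EFin \o f) ->
  mu.-integrable HL (EFin \o (fun r => k * f r)).
Proof. exact: (RintegrableZ k (measurable_itv _)). Qed.

Lemma integrable_norm_half_line f : mu.-integrable HL (EFin \o f) ->
  mu.-integrable HL (EFin \o (fun r => `|f r|)).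
Proof. exact: (@integrable_norm _ _ _ mu HL). Qed.

End HalfLineIntegrals.

Section Windows.
Context {R : realType}.
Local Notation mu := (@lebesgue_measure R).
Local Notation HL := [set` @Interval R (BRight 0%R) +oo%O].
Local Notation OI t := [set` @Interval R (BRight 0%R) (BLeft t)].

Lemma Rintegral_support (D E : set R) (f : R -> R) : measurable D -> measurable E ->
  D `<=` E -> (forall x, E x -> ~ D x -> f x = 0) ->
  (mu.-integrable D (EFin \o f) <-> mu.-integrable E (EFin \o f)) /\
  \int[mu]_(x in D) f x = \int[mu]_(x in E) f x.
Proof.
move=> mD mE DE f0.
have eqDE : (EFin \o f) \_ D = (EFin \o f) \_ E.
  apply/funext => x; rewrite !patchE; have [xD|xD] := boolP (x \in D).
    by rewrite ifT// inE; apply: DE; rewrite inE in xD.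
  have [xE|//] := boolP (x \in E); rewrite inE in xE.
  by rewrite /= f0//; move/negP : xD; rewrite inE.
have iD := @integrable_mkcond _ _ _ mu D (EFin \o f) mD.
have iE := @integrable_mkcond _ _ _ mu E (EFin \o f) mE.
split; first by split => [/iD|/iE] h; [apply/iE|apply/iD]; move: h; rewrite eqDE.
by rewrite /Rintegral integral_mkcond [in RHS]integral_mkcond eqDE.
Qed.

Lemma half_line_window (t : R) (f : R -> R) : (forall s, t <= s -> f s = 0) ->
  (mu.-integrable (OI t) (EFin \o f) <-> mu.-integrable HL (EFin \o f)) /\
  \int[mu]_(s in OI t) f s = \int[mu]_(s in HL) f s.
Proof.
move=> f0; apply: Rintegral_support.
- exact: measurable_itv.
- exact: measurable_itv.
- by move=> x /=; rewrite !in_itv/= andbT => /andP[].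
- move=> x; rewrite /= !in_itv/= andbT => x0 /negP; rewrite x0/= -leNgt; exact: f0.
Qed.

Lemma Rintegral_window_reflect (t : R) (f : R -> R) :
  mu.-integrable (OI t) (EFin \o f) ->
  mu.-integrable (OI t) (EFin \o (fun s => f (t - s))) /\
  \int[mu]_(s in OI t) f s = \int[mu]_(s in OI t) f (t - s).
Proof.
move=> itf.
have [i1 e1] := Rintegral_shift t (measurable_itv _) itf.
have m1 : measurable ((fun x : R => x + t) @^-1` OI t).
  rewrite -[X in measurable X]setTI; exact: measurable_funD.
have [i2 e2] := Rintegral_opp m1 i1.
have D : -%R @^-1` ((fun x : R => x + t) @^-1` OI t) = OI t.
  by apply/seteqP; split => x /=; rewrite !in_itv/= => /andP[x0 x1]; apply/andP; split; lra.
have F : (fun x => f (- x + t)) = (fun s => f (t - s)) by apply/funext => s; rewrite addrC.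
by rewrite e1 e2 D; move: i2; rewrite D F.
Qed.

End Windows.

Section IntervalIntegrals.
Context {R : realType}.
Local Notation mu := (@lebesgue_measure R).
Local Notation HL := [set` @Interval R (BRight 0%R) +oo%O].
Local Notation OO e t := [set` @Interval R (BRight e) (BLeft t)].
Implicit Types (e t s : R) (f F : R -> R).

(** The linear bound is what the later integration by parts against a
    rapidly decreasing kernel needs. *)
Lemma half_line_primitive (h : R -> R) (B : R) : continuous h ->
  (forall x, `|h x| <= B) -> let H u := \int[mu]_(s in `]0, u[) h s in
  (forall u : R, 0 < u -> has_deriv H u (h u)) /\
  (forall u : R, 0 < u -> `|H u| <= B * u).
Proof.
move=> ch hB H0; pose H u := \int[mu]_(s in `[0, u]) h s.
have ih u : mu.-integrable `[0, u] (EFin \o h).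
  apply: continuous_compact_integrable; first exact: segment_compact.
  exact: continuous_subspaceT.
have -> : H0 = H.
  apply/funext => u; have m (i : interval R) : [set` i] `<=` `[0, u] -> mu.-integrable [set` i] (EFin \o h).
    by move=> iu; apply: (@integrableS _ _ _ mu `[0, u]) => //; exact: measurable_itv.
  rewrite /H0 /H Rintegral_itv_obnd_cbnd; last by apply: m; exact: subset_itv_oo_cc.
  by apply: Rintegral_itv_bndo_bndc; apply: m; exact: subset_itv_co_cc.
split=> u u0.
  have [dH eH] := @continuous_FTC1_closed R h 0 u (u + 1) (ltr_pwDr ltr01 (lexx u)) (ih _) u0 (ch u).
  split; first exact: dH.
  by rewrite -derive1E.
have ic : mu.-integrable `[0, u] (EFin \o cst B).
  apply: continuous_compact_integrable; first exact: segment_compact.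
  by apply: continuous_subspaceT => s; exact: cvg_cst.
rewrite (le_trans (@normr_Rintegral_le _ `[0, u] h (cst B) _ _ ic _))//.
  by apply: measurable_integrable; exact: ih.
rewrite Rintegral_cst//= lebesgue_measure_itv/= lte_fin u0.
by rewrite sube0.
Qed.

Lemma Rintegral_FTC e t F f : e < t ->
  (forall s, e <= s <= t -> has_deriv F s (f s)) ->
  (forall s, e <= s <= t -> {for s, continuous f}) ->
  \int[mu]_(s in OO e t) f s = F t - F e.
Proof.
move=> et dF cf.
have cfw : {within `[e, t], continuous f}.
  by apply: continuous_in_subspaceT => s; rewrite inE/= in_itv/=; exact: cf.
have i0 : mu.-integrable `[e, t] (EFin \o f).
  by apply: continuous_compact_integrable => //; exact: segment_compact.
have m (i : interval R) : [set` i] `<=` `[e, t] -> mu.-integrable [set` i] (EFin \o f).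
  by move=> iu; apply: (@integrableS _ _ _ mu `[e, t]) => //; exact: measurable_itv.
rewrite Rintegral_itv_obnd_cbnd; last by apply: m; exact: subset_itv_oo_cc.
rewrite Rintegral_itv_bndo_bndc; last by apply: m; exact: subset_itv_co_cc.
rewrite /Rintegral (continuous_FTC2 et cfw (F := F)) ?EFinN//.
- split.
  + by move=> s; rewrite in_itv/= => /andP[es st]; have [] := dF s _; rewrite ?(ltW es) ?(ltW st).
  + apply: cvg_at_right_filter; apply: has_deriv_continuous (dF e _).
    by rewrite lexx ltW.
  + apply: cvg_at_left_filter; apply: has_deriv_continuous (dF t _).
    by rewrite lexx ltW.
- move=> s; rewrite in_itv/= => /andP[es st]; apply: has_deriv_derive1; apply: dF.
  by rewrite (ltW es) (ltW st).
Qed.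

(** Caputo integrals are limits of integrals over ]e, t[; once integrability
    up to 0 is known, the limit is the integral over ]0, t[. *)
Lemma Rintegral_cvg_left t f : 0 < t -> mu.-integrable (OO 0 t) (EFin \o f) ->
  \int[mu]_(s in OO e t) f s @[e --> 0^'+] --> \int[mu]_(s in OO 0 t) f s.
Proof.
move=> t0 itf; pose w e s : R := if e < s then f s else 0.
have we0 e s : s <= e -> w e s = 0 by rewrite /w ltNge => ->.
have weE e s : e < s -> w e s = f s by rewrite /w => ->.
have E e : 0 < e < 0 + 1 -> \int[mu]_(s in OO 0 t) w e s = \int[mu]_(s in OO e t) f s.
  move=> /andP[e0 _]; rewrite -(@Rintegral_support _ (OO e t) (OO 0 t) (w e) _ _ _ _).2.
  - by apply: eq_Rintegral => s; rewrite inE /= in_itv/= => /andP[es _]; exact: weE.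
  - exact: measurable_itv.
  - exact: measurable_itv.
  - by move=> s /=; rewrite !in_itv/= => /andP[es ->]; rewrite (lt_trans e0).
  - move=> s /=; rewrite !in_itv/= => /andP[_ ->]; rewrite andbT => /negP.
    by rewrite -leNgt; exact: we0.
apply: (cvg_right_eq ltr01 E).
apply: (proj2 (@Rdominated_cvg_at_right R 0 1 (OO 0 t) _ _ (fun s => `|f s|) ltr01 _ _ _ _ _)).
- exact: measurable_itv.
- move=> e _; apply: measurable_fun_if => //.
  + exact: measurable_fun_ltr.
  + by apply: measurable_funS (measurable_integrable itf) => // s [].
- move=> s; rewrite /= in_itv/= => /andP[s0 _]; apply: cvg_near_cst.
  near=> e; apply: weE; near: e; exact: nbhs_right_lt.
- exact: (@integrable_norm _ _ _ mu).
- move=> e s _ _; rewrite /w; case: ifP => // _; by rewrite normr0.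
Unshelve. all: by end_near. Qed.

End IntervalIntegrals.

Section Line.
Context {R : realType}.
Local Notation mu := (@lebesgue_measure R).
Local Notation HL := [set` @Interval R (BRight 0%R) +oo%O].
Local Notation CL := [set` @Interval R (BLeft 0%R) +oo%O].
Local Notation mR := (measurableTypeR R).
Implicit Types (F : R -> R) (a : R) (A : set R).

Lemma integrable_add_point A a F : measurable A -> mu.-integrable A (EFin \o F) ->
  mu.-integrable (A `|` [set a]) (EFin \o F).
Proof.
move=> mA iA; have ma : measurable ([set a] : set mR) by exact: measurable_set1.
have mD : measurable (A `|` [set a] : set mR) by exact: measurableU.
apply/(@negligible_integrable _ _ _ mu _ [set a]) => //.
- apply/measurable_EFinP/measurable_funU => //; split; first exact: measurable_integrable.
  exact: measurable_fun_set1.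
- exact: lebesgue_measure_set1.
- apply: (@integrableS _ _ _ mu A) => //; first exact: measurableD.
  by move=> x [[]].
Qed.

Lemma integrable_disjointU A D F : measurable A -> measurable D -> [disjoint A & D] ->
  mu.-integrable A (EFin \o F) -> mu.-integrable D (EFin \o F) ->
  mu.-integrable (A `|` D) (EFin \o F).
Proof.
move=> mA mD AD iA iD; have /integrableP[mfA fA] := iA; have /integrableP[mfD fD] := iD.
have mU : measurable_fun (A `|` D : set mR) (EFin \o F) by apply/measurable_funU.
apply/integrableP; split=> //.
have := lte_add_pinfty fA fD; rewrite -(@ge0_integral_setU _ _ _ mu)//.
exact: measurableT_comp.
Qed.

Lemma integrable_reflect F a : mu.-integrable setT (EFin \o F) ->
  mu.-integrable setT (EFin \o (fun v => F (a - v))) /\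
  \int[mu]_(x in setT) F x = \int[mu]_(v in setT) F (a - v).
Proof.
move=> iF; have [i1 e1] := Rintegral_shift a measurableT iF.
rewrite preimage_setT in i1 e1.
have [i2 e2] := Rintegral_opp measurableT i1.
rewrite preimage_setT in i2 e2.
have E : (fun v => F (- v + a)) = (fun v => F (a - v)) by apply/funext => v; rewrite addrC.
by rewrite e1 e2; move: i2; rewrite E.
Qed.

Lemma preimage_opp_half_line : -%R @^-1` [set` @Interval R -oo%O (BRight 0)] = CL.
Proof. by apply/seteqP; split => x /=; rewrite !in_itv/= andbT oppr_le0. Qed.

Lemma integrable_fold F : mu.-integrable setT (EFin \o F) ->
  [/\ mu.-integrable HL (EFin \o F), mu.-integrable HL (EFin \o (fun x => F (- x))) &
  \int[mu]_(x in setT) F x = \int[mu]_(x in HL) (F x + F (- x))].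
Proof.
move=> iF; have mHL : measurable HL by exact: measurable_itv.
pose NL := [set` @Interval R -oo%O (BRight 0%R)].
have mNL : measurable NL by exact: measurable_itv.
have i1 : mu.-integrable HL (EFin \o F) by apply: (@integrableS _ _ _ mu setT).
have i2 : mu.-integrable NL (EFin \o F) by apply: (@integrableS _ _ _ mu setT).
have [i3 e3] := Rintegral_opp mNL i2; rewrite preimage_opp_half_line in i3 e3.
have i4 : mu.-integrable HL (EFin \o (fun x => F (- x))).
  apply: (@integrableS _ _ _ mu CL); [exact: measurable_itv|exact: measurable_itv| |exact: i3].
  by move=> x /=; rewrite !in_itv/= !andbT; exact: ltW.
split=> //.
have ET : [set: R] = HL `|` NL.
  apply/seteqP; split=> // x _; rewrite /= !in_itv/= andbT; case: (ltP 0 x) => h; [by left|by right].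
have dHN : [disjoint HL & NL].
  apply/eqP/seteqP; split=> // x [/=]; rewrite !in_itv/= andbT => h1 h2.
  by move: (lt_le_trans h1 h2); rewrite ltxx.
rewrite RintegralD_half_line// ET (@Rintegral_setU _ _ _ mu)//; last by rewrite -ET.
by rewrite e3; congr (_ + _); exact/esym/(Rintegral_itv_obnd_cbnd i4).
Qed.

Lemma integrable_unfold F : mu.-integrable HL (EFin \o F) ->
  mu.-integrable HL (EFin \o (fun x => F (- x))) -> mu.-integrable setT (EFin \o F).
Proof.
move=> i1 i2; have mHL : measurable HL by exact: measurable_itv.
have [i3 _] := Rintegral_opp mHL i2.
pose NL := [set` @Interval R -oo%O (BLeft 0%R)].
have mNL : measurable NL by exact: measurable_itv.
have E3 : -%R @^-1` HL = NL.
  by apply/seteqP; split => x /=; rewrite !in_itv/= !andbT oppr_gt0.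
have E4 : (fun x => F (- - x)) = F by apply/funext => x; rewrite opprK.
rewrite E3 E4 in i3.
have i5 := integrable_add_point 0 mNL i3.
have ET : [set: R] = HL `|` (NL `|` [set 0]).
  apply/seteqP; split=> // x _; rewrite /= !in_itv/= andbT.
  by case: (ltgtP 0 x) => h; [left|right; left|right; right].
have m0 : measurable ([set 0] : set mR) by exact: measurable_set1.
rewrite ET; apply: integrable_disjointU => //; first exact: measurableU.
apply/eqP/seteqP; split=> // x [/=]; rewrite !in_itv/= andbT => h1 [h2|h2].
- by move: (lt_trans h1 h2); rewrite ltxx.
- by move: h1; rewrite h2 ltxx.
Qed.

Lemma integrable_closed_half_line a F :
  mu.-integrable [set` @Interval R (BRight a) +oo%O] (EFin \o F) ->
  mu.-integrable [set` @Interval R (BLeft a) +oo%O] (EFin \o F) /\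
  \int[mu]_(x in [set` @Interval R (BLeft a) +oo%O]) F x =
  \int[mu]_(x in [set` @Interval R (BRight a) +oo%O]) F x.
Proof.
move=> iF; split; last by rewrite -Rintegral_itv_obnd_cbnd.
apply: (@integrableS _ _ _ mu ([set` @Interval R (BRight a) +oo%O] `|` [set a])).
- by apply: measurableU; [exact: measurable_itv|exact: measurable_set1].
- exact: measurable_itv.
- move=> x /=; rewrite !in_itv/= !andbT le_eqVlt => /orP[/eqP->|]; [by right|by left].
- by apply: integrable_add_point => //; exact: measurable_itv.
Qed.

Lemma integrable_closed_window a F :
  mu.-integrable [set` @Interval R (BRight 0) (BLeft a)] (EFin \o F) ->
  mu.-integrable `[0, a] (EFin \o F) /\
  \int[mu]_(x in `[0, a]) F x = \int[mu]_(x in [set` @Interval R (BRight 0) (BLeft a)]) F x.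
Proof.
set OO := [set` @Interval R (BRight 0) (BLeft a)] => iF.
have mO : measurable OO by exact: measurable_itv.
have m0 : measurable (OO `|` [set 0] : set mR) by apply: measurableU => //; exact: measurable_set1.
have i1 : mu.-integrable (OO `|` [set 0] `|` [set a]) (EFin \o F).
  by apply: integrable_add_point => //; apply: integrable_add_point.
have i2 : mu.-integrable `[0, a] (EFin \o F).
  apply: (@integrableS _ _ _ mu (OO `|` [set 0] `|` [set a])) => //.
  - by apply: measurableU => //; exact: measurable_set1.
  - move=> x /=; rewrite in_itv/= => /andP[]; rewrite le_eqVlt => /orP[/eqP<-|x0]; first by left; right.
    rewrite le_eqVlt => /orP[/eqP->|xa]; first by right.
    by left; left; rewrite /OO /= in_itv/= x0.
split=> //; apply/esym.
have m (i : interval R) : [set` i] `<=` `[0, a] -> mu.-integrable [set` i] (EFin \o F).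
  by move=> iu; apply: (@integrableS _ _ _ mu `[0, a]) => //; exact: measurable_itv.
rewrite Rintegral_itv_obnd_cbnd; last by apply: m; exact: subset_itv_oo_cc.
by apply: Rintegral_itv_bndo_bndc; apply: m; exact: subset_itv_co_cc.
Qed.

End Line.

(** * Integrable majorants *)

Section Domination.
Context {R : realType}.
Local Notation mu := (@lebesgue_measure R).
Local Notation HL := [set` @Interval R (BRight 0%R) +oo%O].
Implicit Types (f : R -> R) (c s r : R).

Lemma powR_add (x p q : R) : 0 < x -> x `^ (p + q) = x `^ p * x `^ q.
Proof. by move=> x0; rewrite powRD// (gt_eqF x0) implybT. Qed.

Lemma powR_addr1 (x p : R) : 0 < x -> x `^ (p + 1) = x `^ p * x.
Proof. by move=> x0; rewrite powR_add// powRr1// ltW. Qed.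

(** The derivative of (r / (1 + r))^s / s, which is bounded: hence an
    integrable majorant, with singularity r^(s - 1) at 0 and decay r^(- 2) at
    infinity. *)
Definition dom s r : R := r `^ (s - 1) * (1 + r) `^ (- (s + 1)).

Lemma dom_ge0 s r : 0 <= dom s r.
Proof. by rewrite mulr_ge0 ?powR_ge0. Qed.

Lemma powR_continuous (p : R) (x : R) : 0 < x -> {for x, continuous (fun y : R => y `^ p)}.
Proof. by move=> x0; apply: has_deriv_continuous; exact: has_deriv_powR_id. Qed.

Lemma dom_continuous s r : 0 < r -> {for r, continuous (dom s)}.
Proof.
move=> r0; apply: has_deriv_continuous; apply: has_deriv_mul.
  exact: has_deriv_powR_id.
apply: (has_deriv_powR (f := fun t => 1 + t)); first by rewrite addr_gt0.
by apply: has_deriv_add; [exact: has_deriv_cst|exact: has_deriv_id].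
Qed.

Lemma integrable_dom s : 0 < s -> mu.-integrable HL (EFin \o dom s).
Proof.
move=> s0.
apply: (ge0_integrable_half_line (F := fun r => s^-1 * (r `^ s * (1 + r) `^ (- s)))
   (C := s^-1)).
- by move=> r _; exact: dom_ge0.
- move=> r r0; have r1 : 0 < 1 + r by rewrite addr_gt0.
  apply: has_deriv_eq.
    apply: has_deriv_scale; apply: has_deriv_mul.
      exact: has_deriv_powR_id.
    apply: (has_deriv_powR (f := fun t => 1 + t)); first by rewrite addr_gt0.
    by apply: has_deriv_add; [exact: has_deriv_cst|exact: has_deriv_id].
  rewrite /dom.
  have -> : (1 + r) `^ (- s) = (1 + r) `^ (- (s + 1)) * (1 + r).
    by rewrite -powR_addr1//; congr powR; ring.
  have -> : - s - 1 = - (s + 1) by ring.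
  have -> : r `^ s = r `^ (s - 1) * r.
    by rewrite -powR_addr1//; congr powR; ring.
  by field; rewrite gt_eqF.
- by move=> r r0; exact: dom_continuous.
- move=> r r0; have r1 : 0 < 1 + r by rewrite addr_gt0.
  rewrite ger0_norm; last by rewrite !mulr_ge0 ?powR_ge0// invr_ge0 ltW.
  rewrite -[leRHS]mulr1 ler_wpM2l ?invr_ge0 ?(ltW s0)//.
  rewrite powRN ler_pdivrMr ?powR_gt0// mul1r.
  by apply: ge0_ler_powR; rewrite ?nnegrE ?ltW// ltrDr.
Qed.

Lemma integrable_dominated s (C : R) f : 0 < s -> measurable_fun HL f ->
  (forall r, 0 < r -> `|f r| <= C * dom s r) -> mu.-integrable HL (EFin \o f).
Proof.
move=> s0 mf fC; apply: (@le_integrable _ _ _ mu HL _ _ (EFin \o (fun r => C * dom s r))) => //.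
- exact/measurable_EFinP.
- move=> r; rewrite /= in_itv/= andbT => r0.
  by rewrite lee_fin (le_trans (fC _ r0))// ler_norm.
- apply: (@eq_integrable _ _ _ mu HL _ (fun r => C%:E * (EFin \o dom s) r)%E) => //.
  by apply: integrableZl => //; exact: integrable_dom.
Qed.

(** With m = max (1, r) and u = m^(nu / 2), the bound ln u <= u and Young's
    inequality p ln m <= 2 (p / nu) u <= d u^2 + (p / nu)^2 / d give the claim. *)
Lemma powR_le_expR (p d nu : R) : 0 <= p -> 0 < d -> 0 < nu ->
  exists2 C : R, 0 <= C & forall r, 0 < r -> (1 + r) `^ p <= C * expR (d * r `^ nu).
Proof.
move=> p0 d0 nu0; exists (expR (p * ln 2 + (p / nu) ^+ 2 / d + d)); first exact: expR_ge0.
move=> r r0.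
rewrite -expRD.
have r1 : 0 < 1 + r by rewrite addr_gt0.
rewrite {1}/powR gt_eqF// ler_expR.
pose m := Num.max 1 r.
have m1 : 1 <= m by rewrite le_max lexx.
have m0 : 0 < m by rewrite (lt_le_trans ltr01).
(* m is comparable with 1 + r, and its powers are at least 1 *)
have h1 : ln (1 + r) <= ln 2 + ln m.
  rewrite -lnM ?posrE// ler_ln ?posrE ?mulr_gt0//.
  by rewrite mulr2n mulrDl mul1r lerD// le_max lexx ?orbT.
pose u := m `^ (nu / 2).
have h2 : nu / 2 * ln m <= u.
  rewrite -ln_powR; have u0 : 0 < u by rewrite powR_gt0.
  rewrite -/u (_ : u = 1 + (u - 1)); last by ring.
  rewrite (le_trans (le_ln1Dx _))//; first by rewrite ltrBrDl subrr.
  by rewrite gerDl lerN10 || lra.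
have u2 : u ^+ 2 = m `^ nu.
  by rewrite expr2 -powR_add//; congr powR; field.
have h3 : m `^ nu <= 1 + r `^ nu.
  rewrite /m; case: (leP 1 r) => _; first by rewrite lerDr.
  by rewrite powR1 lerDl powR_ge0.
have h4 : p * ln m <= d * u ^+ 2 + (p / nu) ^+ 2 / d.
  apply: (@le_trans _ _ (2 * (p / nu) * u)).
    have -> : p * ln m = 2 * (p / nu) * (nu / 2 * ln m) by field; rewrite gt_eqF.
    by rewrite ler_wpM2l// !mulr_ge0// invr_ge0 ltW.
  rewrite -subr_ge0.
  have -> : d * u ^+ 2 + (p / nu) ^+ 2 / d - 2 * (p / nu) * u =
     d * (u - p / nu / d) ^+ 2 by field; rewrite !gt_eqF.
  by rewrite mulr_ge0 ?sqr_ge0// ltW.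
have h5 : d * u ^+ 2 <= d + d * r `^ nu.
  by rewrite u2 -[X in X + _]mulr1 -mulrDr ler_wpM2l// ltW.
have h6 : p * ln (1 + r) <= p * ln 2 + p * ln m by rewrite -mulrDr ler_wpM2l.
lra.
Qed.

(** Whichever of a and b is positive, its exponential beats the power
    (1 + r)^(c + 2) by which dom (c + 1) r differs from r^c. *)
Lemma powR_decay (c a b nu : R) : -1 < c -> 0 <= a -> 0 <= b -> 0 < a + b -> 0 < nu ->
  exists2 C : R, 0 <= C & forall r, 0 < r ->
    r `^ c * expR (- (a * r + b * r `^ nu)) <= C * dom (c + 1) r.
Proof.
move=> c1 a0 b0 ab nu0.
have [C C0 HC] : exists2 C : R, 0 <= C & forall r, 0 < r ->
    (1 + r) `^ (c + 2) <= C * expR (a * r + b * r `^ nu).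
  have p0 : 0 <= c + 2 by lra.
  have [a1|a1] := ltP 0 a.
    have [C C0 HC] := powR_le_expR p0 a1 ltr01; exists C => // r r0.
    rewrite (le_trans (HC _ r0))// ler_wpM2l// ler_expR (powRr1 (ltW r0)) lerDl.
    by rewrite mulr_ge0 ?powR_ge0.
  have b1 : 0 < b by lra.
  have [C C0 HC] := powR_le_expR p0 b1 nu0; exists C => // r r0.
  by rewrite (le_trans (HC _ r0))// ler_wpM2l// ler_expR lerDr mulr_ge0// ltW.
exists C => // r r0; rewrite /dom mulrCA.
have -> : c + 1 - 1 = c by ring.
rewrite ler_wpM2l ?powR_ge0// expRN powRN.
have -> : c + 1 + 1 = c + 2 by ring.
by rewrite ler_pdivlMr ?powR_gt0 ?addr_gt0// mulrC ler_pdivrMr ?expR_gt0// HC.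
Qed.

Lemma integrable_powR_1D (p : R) : 0 < p ->
  mu.-integrable HL (EFin \o (fun r => (1 + r) `^ (- (1 + p)))).
Proof.
move=> p0; apply: (ge0_integrable_half_line (F := fun r => - p^-1 * (1 + r) `^ (- p)) (C := p^-1)).
- by move=> r _; exact: powR_ge0.
- move=> r r0; apply: has_deriv_eq.
    apply: has_deriv_scale; apply: (has_deriv_powR (f := fun t => 1 + t)); first by rewrite addr_gt0.
    by apply: has_deriv_add; [exact: has_deriv_cst|exact: has_deriv_id].
  rewrite add0r mulr1 opprD [- 1 - p]addrC mulrA mulrNN mulVf ?mul1r// gt_eqF//.
- move=> r r0; apply: (has_deriv_continuous (a := - (1 + p) * (1 + r) `^ (- (1 + p) - 1) * (0 + 1))).
  apply: (has_deriv_powR (f := fun t => 1 + t)); first by rewrite addr_gt0.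
  by apply: has_deriv_add; [exact: has_deriv_cst|exact: has_deriv_id].
- move=> r r0; rewrite normrM normrN !ger0_norm ?powR_ge0 ?invr_ge0 ?(ltW p0)//.
  rewrite -[leRHS]mulr1 ler_wpM2l ?invr_ge0 ?(ltW p0)//.
  rewrite powRN invf_le1 ?powR_gt0 ?addr_gt0//.
  have -> : (1 : R) = 1 `^ p by rewrite powR1.
  by apply: ge0_ler_powR; rewrite ?nnegrE ?powR1; lra.
Qed.

End Domination.

(** * Rotation of the ray of integration *)

Section Rays.
Context {R : realType}.
Local Notation mu := (@lebesgue_measure R).
Local Notation HL := [set` @Interval R (BRight 0%R) +oo%O].
Implicit Types (nu c A x phi th r a b : R).

(** The imaginary part of e^(i phi) z^c exp (- A z - x z^nu) dz / dr on the
    ray z = r e^(i th); the factor e^(i th) = dz / dr is the 1 in (c + 1) th. *)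
Definition ray nu c A x phi th r : R :=
  r `^ c * expR (- (A * cos th * r + x * cos (nu * th) * r `^ nu)) *
  sin ((c + 1) * th - A * sin th * r - x * sin (nu * th) * r `^ nu + phi).

(** The modulus of the integrand of ray, when a = A cos th and
    b = x cos (nu th). *)
Definition damp nu a b c r : R := r `^ c * expR (- (a * r + b * r `^ nu)).

Lemma damp_ge0 nu a b c r : 0 <= damp nu a b c r.
Proof. by rewrite mulr_ge0 ?powR_ge0 ?expR_ge0. Qed.

Lemma damp_continuous nu a b c r : 0 < r -> {for r, continuous (damp nu a b c)}.
Proof.
move=> r0; apply: has_deriv_continuous.
apply: has_deriv_mul; first exact: has_deriv_powR_id.
apply/has_deriv_expR/has_deriv_opp/has_deriv_add.
  exact/has_deriv_scale/has_deriv_id.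
exact/has_deriv_scale/has_deriv_powR_id.
Qed.

Lemma integrable_damp nu a b c : -1 < c -> 0 <= a -> 0 <= b -> 0 < a + b -> 0 < nu ->
  mu.-integrable HL (EFin \o damp nu a b c).
Proof.
move=> c1 a0 b0 ab nu0; have [C C0 HC] := powR_decay c1 a0 b0 ab nu0.
apply: (@integrable_dominated _ (c + 1) C); first lra.
  by apply: continuous_half_line_measurable => r; exact: damp_continuous.
by move=> r r0; rewrite ger0_norm ?damp_ge0// HC.
Qed.

Lemma ray_le nu c A x phi th a b r : 0 < r ->
  a <= A * cos th -> b <= x * cos (nu * th) ->
  `|ray nu c A x phi th r| <= damp nu a b c r.
Proof.
move=> r0 aA bx; rewrite /ray /damp normrM -[leRHS]mulr1.
apply: ler_pM => //; last exact: sin_max.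
rewrite ger0_norm; last by rewrite mulr_ge0 ?powR_ge0 ?expR_ge0.
rewrite ler_wpM2l ?powR_ge0// ler_expR lerN2 lerD// ler_wpM2r ?powR_ge0//.
exact: ltW.
Qed.

Lemma ray_continuous nu c A x phi th r : 0 < r ->
  {for r, continuous (ray nu c A x phi th)}.
Proof.
move=> r0; apply: has_deriv_continuous; apply: has_deriv_mul.
  apply: has_deriv_mul; first exact: has_deriv_powR_id.
  apply/has_deriv_expR/has_deriv_opp/has_deriv_add.
    exact/has_deriv_scale/has_deriv_id.
  exact/has_deriv_scale/has_deriv_powR_id.
apply/has_deriv_sin/has_deriv_add; last exact: has_deriv_cst.
apply: has_deriv_sub; last exact/has_deriv_scale/has_deriv_powR_id.
by apply: has_deriv_sub; [exact: has_deriv_cst|exact/has_deriv_scale/has_deriv_id].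
Qed.

Lemma ray_measurable nu c A x phi th : measurable_fun HL (ray nu c A x phi th).
Proof. by apply: continuous_half_line_measurable => r; exact: ray_continuous. Qed.

Lemma integrable_ray nu c A x phi th a b :
  -1 < c -> 0 <= a -> 0 <= b -> 0 < a + b -> 0 < nu ->
  a <= A * cos th -> b <= x * cos (nu * th) ->
  mu.-integrable HL (EFin \o ray nu c A x phi th).
Proof.
move=> c1 a0 b0 ab nu0 aA bx; apply: (Rle_integrable (g := damp nu a b c)) => //.
- exact: ray_measurable.
- exact: integrable_damp.
- by move=> r; rewrite /= in_itv/= andbT => r0; exact: ray_le.
Qed.

(** The derivative of ray in th, and also the derivative in r of
    ray_primitive: with F(z) the holomorphic integrand, both are the real
    part of d/dr (z F(z)). *)
Definition ray_dangle nu c A x phi th r : R :=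
  r `^ c * expR (- (A * cos th * r + x * cos (nu * th) * r `^ nu)) *
    ((A * sin th * r + x * nu * sin (nu * th) * r `^ nu) *
     sin ((c + 1) * th - A * sin th * r - x * sin (nu * th) * r `^ nu + phi) +
     ((c + 1) - A * cos th * r - x * nu * cos (nu * th) * r `^ nu) *
     cos ((c + 1) * th - A * sin th * r - x * sin (nu * th) * r `^ nu + phi)).

Definition ray_primitive nu c A x phi th r : R := r `^ (c + 1) *
     expR (- (A * cos th * r + x * cos (nu * th) * r `^ nu)) *
     cos ((c + 1) * th - A * sin th * r - x * sin (nu * th) * r `^ nu + phi).

Lemma has_deriv_ray_primitive nu c A x phi th r : 0 < r ->
  has_deriv (ray_primitive nu c A x phi th) r (ray_dangle nu c A x phi th r).
Proof.
move=> r0; apply: has_deriv_eq.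
  apply: has_deriv_mul.
    apply: has_deriv_mul; first exact: has_deriv_powR_id.
    apply/has_deriv_expR/has_deriv_opp/has_deriv_add.
      exact/has_deriv_scale/has_deriv_id.
    exact/has_deriv_scale/has_deriv_powR_id.
  apply/has_deriv_cos/has_deriv_add; last exact: has_deriv_cst.
  apply: has_deriv_sub; last exact/has_deriv_scale/has_deriv_powR_id.
  by apply: has_deriv_sub; [exact: has_deriv_cst|exact/has_deriv_scale/has_deriv_id].
rewrite /ray_dangle (_ : c + 1 - 1 = c); last ring.
rewrite powR_addr1//.
rewrite (_ : r `^ nu = r `^ (nu - 1) * r); last first.
  by rewrite -powR_addr1//; congr powR; ring.
ring.
Qed.

Lemma has_deriv_ray_angle nu c A x phi th r :
  has_deriv (fun th => ray nu c A x phi th r) th (ray_dangle nu c A x phi th r).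
Proof.
have dsin k : has_deriv (fun th => sin (k * th)) th (cos (k * th) * (k * 1)).
  by apply/has_deriv_sin/has_deriv_scale/has_deriv_id.
have dcos k : has_deriv (fun th => cos (k * th)) th (- sin (k * th) * (k * 1)).
  by apply/has_deriv_cos/has_deriv_scale/has_deriv_id.
apply: has_deriv_eq.
  apply: has_deriv_mul.
    apply: has_deriv_mul; first exact: has_deriv_cst.
    apply/has_deriv_expR/has_deriv_opp/has_deriv_add.
      apply: has_deriv_mul; last exact: has_deriv_cst.
      exact/has_deriv_scale/is_derive_cos.
    apply: has_deriv_mul; last exact: has_deriv_cst.
    exact/has_deriv_scale/dcos.
  apply/has_deriv_sin/has_deriv_add; last exact: has_deriv_cst.
  apply: has_deriv_sub.
    apply: has_deriv_sub; first exact/has_deriv_scale/has_deriv_id.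
    apply: has_deriv_mul; last exact: has_deriv_cst.
    exact/has_deriv_scale/is_derive_sin.
  apply: has_deriv_mul; last exact: has_deriv_cst.
  exact/has_deriv_scale/dsin.
rewrite /ray_dangle; ring.
Qed.

End Rays.

Section Rotation.
Context {R : realType}.
Local Notation mu := (@lebesgue_measure R).
Local Notation HL := [set` @Interval R (BRight 0%R) +oo%O].
Implicit Types (nu c A x phi th r a b : R).

Lemma cvg_inv_pinfty : r^-1 @[r --> +oo] --> (0 : R).
Proof.
apply/(gtr0_cvgV0 (f := id)); last exact: cvg_id.
exact: nbhs_pinfty_gt.
Qed.

Lemma damp_cvg0 nu a b c : 0 <= a -> 0 <= b -> 0 < c ->
  damp nu a b c r @[r --> 0^'+] --> 0.
Proof.
move=> a0 b0 c0; apply: (@squeeze_cvgr _ _ _ _ (cst 0) (fun r => r `^ c)).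
- near=> r; have r0 : 0 < r by near: r; exact: nbhs_right_gt.
  rewrite damp_ge0/= /damp -[leRHS]mulr1 ler_wpM2l ?powR_ge0// expR_le1 oppr_le0.
  by rewrite addr_ge0// mulr_ge0 ?powR_ge0// ltW.
- exact: cvg_cst.
- exact: powR_cvg0.
Unshelve. all: by end_near. Qed.

Lemma damp_cvg_pinfty nu a b c : 0 < c -> 0 <= a -> 0 <= b -> 0 < a + b -> 0 < nu ->
  damp nu a b c r @[r --> +oo] --> 0.
Proof.
move=> c0 a0 b0 ab nu0.
have c1 : -1 < c by lra.
have [C C0 HC] := powR_decay c1 a0 b0 ab nu0.
apply: (@squeeze_cvgr _ _ _ _ (cst 0) (fun r => C * r^-1)).
- near=> r; have r0 : 0 < r by near: r; exact: nbhs_pinfty_gt.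
  have r1 : 0 < 1 + r by rewrite addr_gt0.
  rewrite damp_ge0/= (le_trans (HC _ r0))// ler_wpM2l// /dom.
  have -> : c + 1 - 1 = c by ring.
  apply: (@le_trans _ _ ((1 + r) `^ c * (1 + r) `^ (- (c + 1 + 1)))).
    rewrite ler_wpM2r ?powR_ge0//; apply: ge0_ler_powR; rewrite ?nnegrE ?(ltW c0) ?(ltW r0) ?(ltW r1)//.
    by rewrite lerDr.
  rewrite -powR_add//.
  have -> : c - (c + 1 + 1) = - 2%:R by ring.
  rewrite powR_invn ?(ltW r1)// lef_pV2 ?posrE ?exprn_gt0// expr2.
  by rewrite mulrDl mul1r mulrDr mulr1; nra.
- exact: cvg_cst.
- rewrite -[X in _ --> X](mulr0 C); apply: cvgM; first exact: cvg_cst.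
  exact: cvg_inv_pinfty.
Unshelve. all: by end_near. Qed.

Lemma ray_primitive_le nu c A x phi th a b r : 0 < r ->
  a <= A * cos th -> b <= x * cos (nu * th) ->
  `|ray_primitive nu c A x phi th r| <= damp nu a b (c + 1) r.
Proof.
move=> r0 aA bx; rewrite /ray_primitive /damp normrM -[leRHS]mulr1.
apply: ler_pM => //; last exact: cos_max.
rewrite ger0_norm; last by rewrite mulr_ge0 ?powR_ge0 ?expR_ge0.
rewrite ler_wpM2l ?powR_ge0// ler_expR lerN2 lerD// ler_wpM2r ?powR_ge0//.
exact: ltW.
Qed.

Lemma ray_dangle_le nu c A x phi th a b r : 0 < r -> -1 < c -> 0 < nu ->
  a <= A * cos th -> b <= x * cos (nu * th) ->
  `|ray_dangle nu c A x phi th r| <= (c + 1) * damp nu a b c r +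
     (2 * `|A| * damp nu a b (c + 1) r + 2 * `|x| * nu * damp nu a b (c + nu) r).
Proof.
move=> r0 c1 nu0 aA bx.
rewrite /damp powR_addr1// powR_add//.
have rn : 0 <= r `^ nu by exact: powR_ge0.
apply: (@le_trans _ _ (r `^ c * expR (- (a * r + b * r `^ nu)) *
   ((`|A| * r + `|x| * nu * r `^ nu) * 1 +
    (c + 1 + `|A| * r + `|x| * nu * r `^ nu) * 1))); last first.
  by rewrite le_eqVlt; apply/orP; left; apply/eqP; ring.
rewrite /ray_dangle normrM; apply: ler_pM => //.
  rewrite ger0_norm; last by rewrite mulr_ge0 ?powR_ge0 ?expR_ge0.
  rewrite ler_wpM2l ?powR_ge0// ler_expR lerN2 lerD// ler_wpM2r ?powR_ge0//.
  exact: ltW.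
have H (k s y : R) : `|s| <= 1 -> 0 <= y -> `|k * s * y| <= `|k| * y.
  move=> s1 y0; rewrite !normrM (ger0_norm y0) ler_wpM2r//.
  by rewrite -[leRHS]mulr1 ler_wpM2l.
have H2 (k s y : R) : `|s| <= 1 -> 0 <= y -> `|k * nu * s * y| <= `|k| * nu * y.
  by move=> s1 y0; rewrite (le_trans (H _ _ _ s1 y0))// normrM (gtr0_norm nu0).
have r0' := ltW r0.
apply: (le_trans (ler_normD _ _)); apply: lerD; rewrite normrM.
  apply: ler_pM => //; last exact: sin_max.
  by rewrite (le_trans (ler_normD _ _))// lerD ?H ?H2// sin_max.
apply: ler_pM => //; last exact: cos_max.
rewrite (le_trans (ler_normB _ _))// lerD ?H2 ?cos_max//.
rewrite (le_trans (ler_normB _ _))// lerD ?H ?cos_max//.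
by rewrite ger0_norm//; lra.
Qed.

Lemma ray_dangle_continuous nu c A x phi th r : 0 < r ->
  {for r, continuous (ray_dangle nu c A x phi th)}.
Proof.
move=> r0; apply: has_deriv_continuous.
have dlin k l m : has_deriv (fun r => k - l * r - m * r `^ nu) r
    (0 - l * 1 - m * (nu * r `^ (nu - 1))).
  apply: has_deriv_sub; last exact/has_deriv_scale/has_deriv_powR_id.
  by apply: has_deriv_sub; [exact: has_deriv_cst|exact/has_deriv_scale/has_deriv_id].
have dlin2 l m : has_deriv (fun r => l * r + m * r `^ nu) r
    (l * 1 + m * (nu * r `^ (nu - 1))).
  apply: has_deriv_add; last exact/has_deriv_scale/has_deriv_powR_id.
  exact/has_deriv_scale/has_deriv_id.
apply: has_deriv_mul.
  apply: has_deriv_mul; first exact: has_deriv_powR_id.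
  exact/has_deriv_expR/has_deriv_opp/dlin2.
apply: has_deriv_add.
  apply: has_deriv_mul; first exact: dlin2.
  apply/has_deriv_sin/has_deriv_add; [exact: dlin|exact: has_deriv_cst].
apply: has_deriv_mul; first exact: dlin.
by apply/has_deriv_cos/has_deriv_add; [exact: dlin|exact: has_deriv_cst].
Qed.

Lemma integrable_ray_dangle_bound nu c A x a b :
  -1 < c -> 0 <= a -> 0 <= b -> 0 < a + b -> 0 < nu ->
  mu.-integrable HL (EFin \o (fun r => (c + 1) * damp nu a b c r +
     (2 * `|A| * damp nu a b (c + 1) r + 2 * `|x| * nu * damp nu a b (c + nu) r))).
Proof.
move=> c1 a0 b0 ab nu0.
apply: RintegrableD => //; first by apply: RintegrableZ => //; exact: integrable_damp.
by apply: RintegrableD => //; apply: RintegrableZ => //; apply: integrable_damp => //; lra.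
Qed.

Lemma Rintegral_ray_dangle nu c A x phi th a b :
  -1 < c -> 0 <= a -> 0 <= b -> 0 < a + b -> 0 < nu ->
  a <= A * cos th -> b <= x * cos (nu * th) ->
  mu.-integrable HL (EFin \o ray_dangle nu c A x phi th) /\
  \int[mu]_(r in HL) ray_dangle nu c A x phi th r = 0.
Proof.
move=> c1 a0 b0 ab nu0 aA bx.
have itd : mu.-integrable HL (EFin \o ray_dangle nu c A x phi th).
  apply: (Rle_integrable _ _ (integrable_ray_dangle_bound A x c1 a0 b0 ab nu0)) => //.
    by apply: continuous_half_line_measurable => r; exact: ray_dangle_continuous.
  by move=> r; rewrite /= in_itv/= andbT => r0; exact: ray_dangle_le.
split => //; rewrite -[RHS](subrr 0).
apply: (Rintegral_half_line (F := ray_primitive nu c A x phi th)) => //.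
- by move=> r r0; exact: has_deriv_ray_primitive.
- by move=> r r0; exact: ray_dangle_continuous.
- apply: norm_cvg0; apply: (@squeeze_cvgr _ _ _ _ (cst 0) (damp nu a b (c + 1))).
  + near=> r; rewrite normr_ge0/=; apply: ray_primitive_le => //.
  + exact: cvg_cst.
  + by apply: damp_cvg0 => //; lra.
- apply: norm_cvg0; apply: (@squeeze_cvgr _ _ _ _ (cst 0) (damp nu a b (c + 1))).
  + near=> r; rewrite normr_ge0/=; apply: ray_primitive_le => //.
  + exact: cvg_cst.
  + by apply: damp_cvg_pinfty => //; lra.
Unshelve. all: by end_near. Qed.

(** Cauchy's theorem in a sector: the derivative of the integral in the
    angle is the integral of the r-derivative of ray_primitive, which vanishes
    at both ends. *)
Lemma Rintegral_ray_rotation nu c A x phi th1 th2 a b :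
  -1 < c -> 0 <= a -> 0 <= b -> 0 < a + b -> 0 < nu -> th1 <= th2 ->
  (forall th, th1 <= th <= th2 -> a <= A * cos th /\ b <= x * cos (nu * th)) ->
  \int[mu]_(r in HL) ray nu c A x phi th1 r = \int[mu]_(r in HL) ray nu c A x phi th2 r.
Proof.
move=> c1 a0 b0 ab nu0 th12 H.
(* along th the angle stays in [th1, th2] for every real parameter u, and constancy on R is enough *)
pose m := (th1 + th2) / 2; pose d := (th2 - th1) / 2.
pose th u := m + d * sin u.
have d0 : 0 <= d by rewrite divr_ge0// subr_ge0.
have thI u : th1 <= th u <= th2.
  have s1 := sin_le1 u; have s2 := sin_geN1 u.
  have h1 : d * sin u <= d * 1 by exact: ler_wpM2l.
  have h2 : d * (-1) <= d * sin u by exact: ler_wpM2l.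
  by rewrite /th /m; move: h1 h2; rewrite /d; set X := (_ / 2 * sin u); lra.
have dth u : has_deriv th u (d * cos u).
  apply: has_deriv_eq; first apply/has_deriv_add; first exact: has_deriv_cst.
    exact/has_deriv_scale/is_derive_sin.
  by rewrite add0r.
have [eth1 eth2] : th1 = th (- (pi / 2)) /\ th2 = th (pi / 2).
  by rewrite /th sinN sin_pihalf /m /d; split; field.
rewrite eth1 eth2.
apply: (@is_derive_0_is_cst R (fun u => \int[mu]_(r in HL) ray nu c A x phi (th u) r)) => u.
have [aA bx] := H _ (thI u).
have [itd d00] := Rintegral_ray_dangle phi c1 a0 b0 ab nu0 aA bx.
apply: (@has_deriv_eq R _ u (\int[mu]_(r in HL) (d * cos u * ray_dangle nu c A x phi (th u) r))); last first.
  by rewrite RintegralZl// d00 mulr0.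
have gI : mu.-integrable HL (EFin \o (fun r => d * ((c + 1) * damp nu a b c r +
     (2 * `|A| * damp nu a b (c + 1) r + 2 * `|x| * nu * damp nu a b (c + nu) r)))).
  by apply: RintegrableZ => //; exact: integrable_ray_dangle_bound.
apply: (has_deriv_Rintegral (u := u - 1) (v := u + 1) (df := fun u r => d * cos u * ray_dangle nu c A x phi (th u) r) _ _ _ _ gI) => //.
- by rewrite ltrBlDr ltrDl ltr01.
- move=> w _; have [aA' bx'] := H _ (thI w).
  exact: integrable_ray aA' bx'.
- move=> w r _ _; apply: has_deriv_eq.
    by apply: (has_deriv_comp (f := fun th => ray nu c A x phi th r));
      [exact: has_deriv_ray_angle|exact: dth].
  exact: mulrC.
- move=> w r _; rewrite /= in_itv/= andbT => r0.
  have [aA' bx'] := H _ (thI w).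
  rewrite normrM; apply: ler_pM => //; last exact: ray_dangle_le.
  by rewrite normrM (ger0_norm d0) -[leRHS]mulr1 ler_wpM2l// cos_max.
Qed.

End Rotation.

Section Kernel.
Context {R : realType}.
Local Notation mu := (@lebesgue_measure R).
Local Notation HL := [set` @Interval R (BRight 0%R) +oo%O].
Implicit Types (nu c A x phi th r a b y t : R).

Lemma ray_scale nu c A x phi th k r : 0 < k -> 0 < r ->
  ray nu c A x phi th (k * r) = k `^ c * ray nu c (A * k) (x * k `^ nu) phi th r.
Proof.
move=> k0 r0; have k0' := ltW k0; have r0' := ltW r0; rewrite /ray !powRM//.
rewrite !mulrA; congr (_ * expR (- _) * sin _); last first.
  by congr (_ + _); congr (_ - _ - _); ring.
by congr (_ + _); ring.
Qed.

Lemma damp_scale nu c a b k r : 0 < k -> 0 < r ->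
  damp nu a b c (k * r) = k `^ c * damp nu (a * k) (b * k `^ nu) c r.
Proof.
move=> k0 r0; have k0' := ltW k0; have r0' := ltW r0; rewrite /damp !powRM//.
by rewrite !mulrA.
Qed.

Lemma Rintegral_ray_scale nu c A x phi th k : 0 < k ->
  mu.-integrable HL (EFin \o ray nu c A x phi th) ->
  \int[mu]_(r in HL) ray nu c A x phi th r =
  k `^ (c + 1) * \int[mu]_(r in HL) ray nu c (A * k) (x * k `^ nu) phi th r.
Proof.
move=> k0 itf; have [itk ->] := Rintegral_scale_half_line k0 itf.
have E r : 0 < r ->
    k `^ (- c) * ray nu c A x phi th (k * r) = ray nu c (A * k) (x * k `^ nu) phi th r.
  move=> r0; rewrite ray_scale// mulrA -powR_add//.
  by rewrite addNr powRr0 mul1r.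
rewrite -(eq_Rintegral_half_line E) RintegralZl// powR_addr1// mulrACA -powR_add//.
by rewrite subrr powRr0 mul1r.
Qed.

Lemma Rintegral_damp_scale nu c a b k : 0 < k ->
  mu.-integrable HL (EFin \o damp nu a b c) ->
  \int[mu]_(r in HL) damp nu a b c r =
  k `^ (c + 1) * \int[mu]_(r in HL) damp nu (a * k) (b * k `^ nu) c r.
Proof.
move=> k0 itf; have [itk ->] := Rintegral_scale_half_line k0 itf.
have E r : 0 < r ->
    k `^ (- c) * damp nu a b c (k * r) = damp nu (a * k) (b * k `^ nu) c r.
  move=> r0; rewrite damp_scale// mulrA -powR_add//.
  by rewrite addNr powRr0 mul1r.
rewrite -(eq_Rintegral_half_line E) RintegralZl// powR_addr1// mulrACA -powR_add//.
by rewrite subrr powRr0 mul1r.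
Qed.

Lemma euler_integral_damp (z : R) :
  euler_integral z = \int[mu]_(r in HL) damp 1 1 0 (z - 1) r.
Proof.
rewrite /euler_integral; apply: eq_Rintegral => r _.
by rewrite /damp mul1r mul0r addr0.
Qed.

Lemma Rintegral_damp_euler nu (c rho : R) : 0 < rho -> -1 < c ->
  \int[mu]_(r in HL) damp nu rho 0 c r = rho `^ (- (c + 1)) * euler_integral (c + 1).
Proof.
move=> rho0 c1; rewrite euler_integral_damp.
have E r : 0 < r -> damp nu rho 0 c r = damp 1 rho 0 c r.
  by move=> _; rewrite /damp !mul0r.
rewrite (eq_Rintegral_half_line E) (@Rintegral_damp_scale _ _ _ _ rho^-1) ?invr_gt0//; last first.
  by apply: integrable_damp => //; [exact: ltW|lra].
by rewrite mul0r mulfV ?gt_eqF// addrK -powR_inv1 ?(ltW rho0)// -powRrM mulN1r.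
Qed.

(** After rotation of the ray to angle 0 the integrand is that of Euler's
    integral times a constant phase. *)
Lemma euler_integral_rotation (a rho th chi : R) :
  0 < a -> 0 < rho -> 0 <= th < pi / 2 ->
  \int[mu]_(r in HL) (r `^ (a - 1) * expR (- (rho * cos th * r)) *
     cos (rho * sin th * r - chi)) = rho `^ (- a) * euler_integral a * cos (a * th - chi).
Proof.
move=> a0 rho0 /andP[th0 thpi].
pose phi := pi / 2 - (a * th - chi).
have E r : 0 < r -> r `^ (a - 1) * expR (- (rho * cos th * r)) *
     cos (rho * sin th * r - chi) = ray 1 (a - 1) rho 0 phi th r.
  move=> _; rewrite /ray !mul0r addr0 subr0; congr (_ * _).
  rewrite -cosN -sinDpihalf; congr sin.
  by rewrite /phi; ring.
rewrite (eq_Rintegral_half_line E).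
have cth0 : 0 < cos th.
  by apply: cos_gt0_pihalf; rewrite thpi andbT (lt_le_trans _ th0)// oppr_lt0 divr_gt0// pi_gt0.
rewrite -(@Rintegral_ray_rotation R 1 (a - 1) rho 0 phi 0 th (rho * cos th) 0) //.
- have E2 r : 0 < r -> ray 1 (a - 1) rho 0 phi 0 r = sin phi * damp 1 rho 0 (a - 1) r.
    by move=> _; rewrite /ray /damp !mulr0 cos0 sin0 mulr1 !mul0r mulr0 !mul0r !addr0 !subr0 add0r mulrC.
  rewrite (eq_Rintegral_half_line E2) RintegralZl//; last first.
    by apply: integrable_damp => //; [lra|exact: ltW|lra].
  rewrite Rintegral_damp_euler//; last lra.
  rewrite subrK mulrC; congr (_ * _).
  by rewrite /phi addrC -opprB opprK sinDpihalf cosN || rewrite /phi addrC sinDpihalf cosN.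
- lra.
- by rewrite mulr_ge0// ltW.
- by rewrite addr0 mulr_gt0.
- move=> u /andP[u0 uth]; rewrite mul0r; split => //.
  rewrite ler_wpM2l ?(ltW rho0)//.
  have [->//|ne] := eqVneq u th.
  rewrite ltW// ltr_cos ?in_itv/=; first by rewrite lt_neqAle ne.
  + rewrite u0/=; have := pi_gt0 R; lra.
  + rewrite th0/=; have := pi_gt0 R; lra.
Qed.

End Kernel.

(** * The Wright kernels *)

Section WrightKernel.
Context {R : realType} (nu : R) (nu0 : 0 < nu) (nu2 : 2 * nu < 1).
Local Notation mu := (@lebesgue_measure R).
Local Notation HL := [set` @Interval R (BRight 0%R) +oo%O].
Implicit Types (c A x phi th r a b y t : R).

Let kap : R := cos (nu * pi).

Lemma cos_nupi_gt0 : 0 < cos (nu * pi).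
Proof.
apply: cos_gt0_pihalf; have := pi_gt0 R => p0; apply/andP; split.
  by rewrite (@lt_trans _ _ 0)// ?oppr_lt0 ?divr_gt0// mulr_gt0.
by rewrite ltr_pdivlMr// mulrAC -[ltRHS]mul1r ltr_pM2r// mulrC.
Qed.

Lemma cos_nu_ge th : 0 <= th <= pi -> cos (nu * pi) <= cos (nu * th).
Proof.
have n0 := nu0; have n2 := nu2.
move=> /andP[th0 thpi]; have p0 := pi_gt0 R.
have h1 : nu * th <= nu * pi by rewrite ler_pM2l.
have nu1 : nu <= 1 by lra.
have h2 : nu * pi <= pi by rewrite -[leRHS]mul1r ler_wpM2r// ltW.
have h0 : 0 <= nu * th by rewrite mulr_ge0// ltW.
have [->//|ne] := eqVneq (nu * th) (nu * pi).
rewrite ltW// ltr_cos ?in_itv/= ?h0 ?(le_trans h1 h2)//.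
- by rewrite lt_neqAle ne.
- by rewrite h2 (le_trans h0 h1).
Qed.

(** The inversion integral of the Laplace transform p^(- b) exp (- y p^nu)
    runs over two complex conjugate half-contours; this is their contribution
    when they are the rays of angle th and - th. *)
Definition wkernel th b y t : R :=
  pi^-1 * \int[mu]_(r in HL) ray nu (- b) (- t) y 0 th r.

(** Along the imaginary axis the factor exp (- y p^nu) alone ensures
    convergence, so t may be any real number, but y must be positive. *)
Definition wU := wkernel (pi / 2).
(** Along the negative axis the factor exp (p t) alone ensures convergence,
    so t must be positive, but y may vanish. *)
Definition wW := wkernel pi.

Lemma pihalf_itv : 0 <= (pi / 2 : R) <= pi.
Proof. by have := pi_gt0 R => p0; apply/andP; split; lra. Qed.

Lemma integrable_rayU c phi y t : -1 < c -> 0 < y ->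
  mu.-integrable HL (EFin \o ray nu c t y phi (pi / 2)).
Proof.
move=> c1 y0; apply: (@integrable_ray _ _ _ _ _ _ _ 0 (y * kap)) => //.
- by rewrite mulr_ge0 ?(ltW y0)// ltW// cos_nupi_gt0.
- by rewrite add0r mulr_gt0// cos_nupi_gt0.
- by rewrite cos_pihalf mulr0.
- by rewrite ler_wpM2l ?(ltW y0)// cos_nu_ge// pihalf_itv.
Qed.

Lemma integrable_rayW c phi y t : -1 < c -> 0 <= y -> 0 < t ->
  mu.-integrable HL (EFin \o ray nu c (- t) y phi pi).
Proof.
move=> c1 y0 t0; apply: (@integrable_ray _ _ _ _ _ _ _ t 0) => //.
- exact: ltW.
- by rewrite addr0.
- by rewrite cospi mulrN1 opprK.
- by rewrite mulr_ge0 ?(ltW cos_nupi_gt0).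
Qed.

(** For t <= 0 the ray can be rotated to the positive axis, where the
    integrand is real. *)
Lemma wU_le0 b y t : b < 1 -> 0 < y -> t <= 0 -> wU b y t = 0.
Proof.
have n0 := nu0; have n2 := nu2.
move=> b1 y0 t0; have p0 := pi_gt0 R.
rewrite /wU /wkernel -(@Rintegral_ray_rotation R nu (- b) (- t) y 0 0 (pi / 2) 0 (y * kap))//.
- rewrite (@eq_Rintegral_half_line _ _ (fun=> 0)); last first.
    by move=> r r0; rewrite /ray !mulr0 sin0 !mulr0 !mul0r addr0 !subr0 sin0 mulr0.
  by rewrite Rintegral_cst// mul0r mulr0.
- lra.
- by rewrite mulr_ge0 ?(ltW y0)// ltW// cos_nupi_gt0.
- by rewrite add0r mulr_gt0// cos_nupi_gt0.
- lra.
- move=> th /andP[th0 thpi]; split.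
    rewrite mulr_ge0 ?oppr_ge0//; apply: cos_ge0_pihalf; rewrite thpi andbT; lra.
  by rewrite ler_wpM2l ?(ltW y0)// cos_nu_ge// th0/=; lra.
Qed.

(** Between the two angles cos th <= 0, so that rotation is allowed for t > 0. *)
Lemma wUW b y t : b < 1 -> 0 < y -> 0 < t -> wU b y t = wW b y t.
Proof.
have n0 := nu0; have n2 := nu2.
move=> b1 y0 t0; have p0 := pi_gt0 R; congr (_ * _).
apply: (@Rintegral_ray_rotation R nu (- b) (- t) y 0 _ _ 0 (y * kap)) => //.
- lra.
- by rewrite mulr_ge0 ?(ltW y0)// ltW// cos_nupi_gt0.
- by rewrite add0r mulr_gt0// cos_nupi_gt0.
- lra.
- move=> th /andP[th0 thpi]; split.
    rewrite mulNr -mulrN mulr_ge0 ?(ltW t0)// -cosDpi -cosN.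
    rewrite (_ : - (th + pi) = - (th - pi) - (pi *+ 2)); last by rewrite mulr2n; ring.
    rewrite -cosD2pi subrK cosN; apply: cos_ge0_pihalf; apply/andP; split; lra.
  by rewrite ler_wpM2l ?(ltW y0)// cos_nu_ge// thpi andbT; lra.
Qed.

Lemma has_deriv_ray_t c x phi th r t : 0 < r ->
  has_deriv (fun t => ray nu c (- t) x phi th r) t (ray nu (c + 1) (- t) x phi th r).
Proof.
move=> r0; apply: has_deriv_eq.
  apply: has_deriv_mul.
    apply: has_deriv_mul; first exact: has_deriv_cst.
    apply/has_deriv_expR/has_deriv_opp/has_deriv_add; last exact: has_deriv_cst.
    apply: has_deriv_mul; last exact: has_deriv_cst.
    apply: has_deriv_mul; last exact: has_deriv_cst.
    exact/has_deriv_opp/has_deriv_id.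
  apply/has_deriv_sin/has_deriv_add; last exact: has_deriv_cst.
  apply: has_deriv_sub; last exact: has_deriv_cst.
  apply: has_deriv_sub; first exact: has_deriv_cst.
  apply: has_deriv_mul; last exact: has_deriv_cst.
  apply: has_deriv_mul; last exact: has_deriv_cst.
  exact/has_deriv_opp/has_deriv_id.
rewrite /ray powR_addr1//.
rewrite (_ : (c + 1 + 1) * th - _ - _ + _ = ((c + 1) * th - - t * sin th * r - x * sin (nu * th) * r `^ nu + phi) + th); last ring.
rewrite [sin (_ + th)]sinD; ring.
Qed.

Lemma has_deriv_ray_x c A phi th r x : 0 < r ->
  has_deriv (fun x => ray nu c A x phi th r) x (- ray nu (c + nu) A x phi th r).
Proof.
move=> r0; apply: has_deriv_eq.
  apply: has_deriv_mul.
    apply: has_deriv_mul; first exact: has_deriv_cst.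
    apply/has_deriv_expR/has_deriv_opp/has_deriv_add; first exact: has_deriv_cst.
    apply: has_deriv_mul; last exact: has_deriv_cst.
    apply: has_deriv_mul; last exact: has_deriv_cst.
    exact: has_deriv_id.
  apply/has_deriv_sin/has_deriv_add; last exact: has_deriv_cst.
  apply: has_deriv_sub; first exact: has_deriv_cst.
  apply: has_deriv_mul; last exact: has_deriv_cst.
  apply: has_deriv_mul; last exact: has_deriv_cst.
  exact: has_deriv_id.
rewrite /ray powR_add//.
rewrite (_ : (c + nu + 1) * th - _ - _ + _ = ((c + 1) * th - A * sin th * r - x * sin (nu * th) * r `^ nu + phi) + nu * th); last ring.
rewrite [sin (_ + nu * th)]sinD; ring.
Qed.

Lemma rayU_le c phi y y1 t r : 0 < r -> 0 < y1 <= y ->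
  `|ray nu c t y phi (pi / 2) r| <= damp nu 0 (y1 * kap) c r.
Proof.
move=> r0 /andP[y1_gt0 y1y]; apply: ray_le => //; first by rewrite cos_pihalf mulr0.
have y0 : 0 < y by exact: lt_le_trans y1y.
apply: ler_pM => //; rewrite ?(ltW y1_gt0) ?(ltW cos_nupi_gt0)//.
by rewrite cos_nu_ge// pihalf_itv.
Qed.

Lemma integrable_dampU c y : -1 < c -> 0 < y ->
  mu.-integrable HL (EFin \o damp nu 0 (y * kap) c).
Proof.
move=> c1 y0; have yk : 0 < y * kap by rewrite mulr_gt0// cos_nupi_gt0.
by apply: integrable_damp; rewrite ?add0r ?(ltW yk).
Qed.

(** Differentiation of exp (p t) multiplies the integrand by p. *)
Lemma has_deriv_wU_t b y t : b < 1 -> 0 < y ->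
  has_deriv (wU b y) t (wU (b - 1) y t).
Proof.
have n0 := nu0; have n2 := nu2.
move=> b1 y0; apply: has_deriv_scale; rewrite opprB.
rewrite (_ : 1 - b = - b + 1); last by rewrite addrC.
apply: (@has_deriv_Rintegral _ HL (fun t r => ray nu (- b) (- t) y 0 (pi / 2) r)
  (fun t r => ray nu (- b + 1) (- t) y 0 (pi / 2) r) (damp nu 0 (y * kap) (- b + 1)) t (t - 1) (t + 1)) => //.
- by apply/andP; split; lra.
- by move=> s _; apply: integrable_rayU => //; lra.
- by move=> s r _; rewrite /= in_itv/= andbT => r0; exact: has_deriv_ray_t.
- by apply: integrable_dampU => //; lra.
- by move=> s r _; rewrite /= in_itv/= andbT => r0; apply: rayU_le => //; rewrite y0 lexx.
Qed.

(** Differentiation of exp (- y p^nu) multiplies the integrand by - p^nu. *)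
Lemma has_deriv_wU_y b y t : b < 1 -> 0 < y ->
  has_deriv (fun y => wU b y t) y (- wU (b - nu) y t).
Proof.
have n0 := nu0; have n2 := nu2.
move=> b1 y0; rewrite /wU /wkernel -mulrN; apply: has_deriv_scale; rewrite opprB.
rewrite (_ : nu - b = - b + nu); last by rewrite addrC.
have c1 : -1 < - b + nu by lra.
have y2 : 0 < y / 2 by rewrite divr_gt0.
rewrite (_ : - (\int[mu]_(r in _) _) = \int[mu]_(r in HL) (- ray nu (- b + nu) (- t) y 0 (pi / 2) r)); last first.
  by under [RHS]eq_Rintegral do rewrite -mulN1r; rewrite RintegralZl ?mulN1r//; exact: integrable_rayU.
apply: (@has_deriv_Rintegral _ HL (fun y r => ray nu (- b) (- t) y 0 (pi / 2) r)
  (fun y r => - ray nu (- b + nu) (- t) y 0 (pi / 2) r) (damp nu 0 (y / 2 * kap) (- b + nu)) y (y / 2) (y + 1)) => //.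
- by apply/andP; split; lra.
- by move=> s /andP[s0 _]; apply: integrable_rayU => //; lra.
- by move=> s r _; rewrite /= in_itv/= andbT => r0; exact: has_deriv_ray_x.
- exact: integrable_dampU.
- move=> s r /andP[s0 _]; rewrite /= in_itv/= andbT => r0; rewrite normrN; apply: rayU_le => //.
  by rewrite y2/= ltW.
Qed.

Lemma wU_scale b y t k : b < 1 -> 0 < y -> 0 < k ->
  wU b y t = k `^ (1 - b) * wU b (y * k `^ nu) (t * k).
Proof.
have n0 := nu0; have n2 := nu2.
move=> b1 y0 k0; rewrite /wU /wkernel (@Rintegral_ray_scale _ _ _ _ _ _ _ k)//; last first.
  by apply: integrable_rayU => //; lra.
by rewrite mulrCA mulNr addrC.
Qed.

Lemma wW_le b : b < 1 -> exists2 C : R, 0 <= C &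
  forall y t, 0 <= y -> 0 < t -> `|wW b y t| <= C * t `^ (b - 1).
Proof.
have n0 := nu0; have n2 := nu2.
move=> b1; have p0 := pi_gt0 R.
exists (pi^-1 * euler_integral (- b + 1)).
  by rewrite mulr_ge0 ?invr_ge0 ?(ltW p0)// Rintegral_ge0// => r _; rewrite mulr_ge0 ?powR_ge0 ?expR_ge0.
move=> y t y0 t0; rewrite /wW /wkernel normrM gtr0_norm ?invr_gt0// -mulrA.
rewrite ler_wpM2l ?invr_ge0 ?(ltW p0)//.
have c1 : -1 < - b by lra.
have itR := integrable_rayW 0 c1 y0 t0.
rewrite (le_trans (le_normr_Rintegral _ itR))//.
rewrite mulrC (_ : b - 1 = - (- b + 1)); last by ring.
rewrite -(Rintegral_damp_euler nu)//.
apply: le_Rintegral => //.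
- exact: integrable_norm.
- by apply: integrable_damp => //; [exact: ltW|rewrite addr0].
- move=> r; rewrite /= in_itv/= andbT => r0; apply: ray_le => //.
    by rewrite cospi mulrN1 opprK.
  by rewrite mulr_ge0 ?(ltW cos_nupi_gt0).
Qed.

(** For y = 1 the integrand is bounded independently of t; the power of y
    comes from self-similarity. *)
Lemma wU_le b : b < 1 -> exists2 C : R, 0 <= C &
  forall y t, 0 < y -> `|wU b y t| <= C * y `^ (- ((1 - b) / nu)).
Proof.
have n0 := nu0; have n2 := nu2.
move=> b1; have p0 := pi_gt0 R; have c1 : -1 < - b by lra.
exists (pi^-1 * \int[mu]_(r in HL) damp nu 0 (1 * kap) (- b) r).
  by rewrite mulr_ge0 ?invr_ge0 ?(ltW p0)// Rintegral_ge0// => r _; exact: damp_ge0.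
have H t : `|wU b 1 t| <= pi^-1 * \int[mu]_(r in HL) damp nu 0 (1 * kap) (- b) r.
  rewrite /wU /wkernel normrM gtr0_norm ?invr_gt0//.
  rewrite ler_wpM2l ?invr_ge0 ?(ltW p0)//.
  have itR := integrable_rayU 0 (- t) c1 ltr01.
  rewrite (le_trans (le_normr_Rintegral _ itR))//.
  apply: le_Rintegral => //.
  - exact: integrable_norm.
  - exact: integrable_dampU.
  - by move=> r; rewrite /= in_itv/= andbT => r0; apply: rayU_le => //; rewrite ltr01 lexx.
move=> y t y0.
(* the time scale that reduces y to 1 *)
have k0 : 0 < y `^ (- nu^-1) by rewrite powR_gt0.
have yk : y * (y `^ (- nu^-1)) `^ nu = 1.
  by rewrite -powRrM mulNr mulVf ?gt_eqF// powR_inv1 ?(ltW y0)// mulfV ?gt_eqF.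
rewrite (wU_scale _ b1 y0 k0) yk.
rewrite normrM ger0_norm ?powR_ge0// -powRrM mulrC.
rewrite (_ : - nu^-1 * (1 - b) = - ((1 - b) / nu)); last by ring.
by rewrite ler_wpM2r ?powR_ge0.
Qed.

(** The kernel vanishes at t = 0, so the mean value theorem gains a factor t
    at the price of lowering b by 1. *)
Lemma wU_le_t b : b < 1 -> exists2 C : R, 0 <= C &
  forall y t, 0 < y -> 0 <= t -> `|wU b y t| <= C * t * y `^ (- ((2 - b) / nu)).
Proof.
have n0 := nu0; have n2 := nu2.
move=> b1; have [|C C0 HC] := @wU_le (b - 1); first lra.
exists C => // y t y0; rewrite le_eqVlt => /predU1P[<-|t0].
  by rewrite wU_le0// normr0 mulr0 mul0r.
have d (s : R) : s \in `]0, t[%R -> is_derive s 1 (wU b y) (wU (b - 1) y s).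
  by move=> _; exact: has_deriv_wU_t.
have cU : {within `[0, t], continuous (wU b y)}.
  apply: continuous_subspaceT => s; apply: has_deriv_continuous.
  exact: has_deriv_wU_t.
have [s _] := MVT t0 d cU; rewrite (wU_le0 b1 y0 (lexx 0)) !subr0 => ->.
rewrite normrM (gtr0_norm t0) mulrAC ler_wpM2r ?(ltW t0)//.
by rewrite (_ : 2 - b = 1 - (b - 1))//; [exact: HC|ring].
Qed.

(** The function t^(b - 1) / Gamma(b), with 1 / Gamma(b) in the form which
    Euler's reflection formula gives to it and which makes sense for all b < 1. *)
Lemma wW_0 b t : b < 1 -> 0 < t ->
  wW b 0 t = pi^-1 * sin (pi * b) * (euler_integral (1 - b) * t `^ (b - 1)).
Proof.
have n0 := nu0; have n2 := nu2.
move=> b1 t0; rewrite /wW /wkernel -mulrA; congr (_ * _).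
rewrite (@eq_Rintegral_half_line _ _ (fun r => sin (pi * b) * damp nu t 0 (- b) r)); last first.
  move=> r r0; rewrite /ray /damp cospi sinpi !mulr0 !mul0r !subr0 !addr0 mulrN1 opprK mulrC.
  congr (_ * _); rewrite mulrDl mul1r -[RHS]opprK -sinDpi.
  rewrite (_ : - b * pi + pi = - (pi * b + pi) + pi *+ 2); last by rewrite mulr2n; ring.
  by rewrite sinD2pi sinN.
rewrite RintegralZl//; last by apply: integrable_damp => //; [lra|exact: ltW|rewrite addr0].
rewrite Rintegral_damp_euler//; last lra.
rewrite (_ : - b + 1 = 1 - b); last ring.
rewrite (_ : - (1 - b) = b - 1); last ring.
by rewrite [_ * euler_integral _]mulrC.
Qed.

Lemma wW_cvg0 b t : b < 1 -> 0 < t -> wW b y t @[y --> 0^'+] --> wW b 0 t.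
Proof.
have n0 := nu0; have n2 := nu2.
move=> b1 t0; apply: cvgM; first exact: cvg_cst.
apply: (proj2 (@Rdominated_cvg_at_right R 0 1 HL (fun y r => ray nu (- b) (- t) y 0 pi r)
  (fun r => ray nu (- b) (- t) 0 0 pi r) (damp nu t 0 (- b)) ltr01 _ _ _ _ _)) => //.
- by move=> y _; exact: ray_measurable.
- move=> r; rewrite /= in_itv/= andbT => r0; apply: cvg_at_right_filter.
  exact: (has_deriv_continuous (has_deriv_ray_x _ _ _ _ _ r0)).
- by apply: integrable_damp => //; [lra|exact: ltW|rewrite addr0].
- move=> y r /andP[y0 _]; rewrite /= in_itv/= andbT => r0; apply: ray_le => //.
    by rewrite cospi mulrN1 opprK.
  by rewrite mulr_ge0 ?(ltW cos_nupi_gt0) ?(ltW y0).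
Qed.

End WrightKernel.

(** * Convolution of the kernels with powers *)

Section Convolution.
Context {R : realType} (nu : R) (nu0 : 0 < nu) (nu2 : 2 * nu < 1).
Local Notation mu := (@lebesgue_measure R).
Local Notation HL := [set` @Interval R (BRight 0%R) +oo%O].
Local Notation mR := (measurableTypeR R).
Local Notation kap := (cos (nu * pi)).
Local Notation U := (wU nu).
Implicit Types (a b y t s r eps : R).

Lemma wU_continuous b y t : b < 1 -> 0 < y -> {for t, continuous (U b y)}.
Proof. by move=> b1 y0; apply: has_deriv_continuous; exact: (has_deriv_wU_t nu0 nu2). Qed.

Lemma wU_bounded b y : b < 1 -> 0 < y -> exists2 C : R, 0 <= C & forall t, `|U b y t| <= C.
Proof.
move=> b1 y0; have [C C0 HC] := wU_le nu0 nu2 b1.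
exists (C * y `^ (- ((1 - b) / nu))); first by rewrite mulr_ge0 ?powR_ge0.
by move=> t; exact: HC.
Qed.

Lemma powR_window_dom (a T C : R) (f : R -> R) : 0 < a -> 0 <= C -> 0 <= T ->
  (forall s, 0 < s -> `|f s| <= C) -> (forall s, T < s -> f s = 0) ->
  forall s, 0 < s -> `|s `^ (a - 1) * f s| <= C * (1 + T) `^ (a + 1) * dom a s.
Proof.
move=> a0 C0 T0 fC fT s s0; have [Ts|sT] := ltP T s.
  by rewrite fT// mulr0 normr0 mulr_ge0 ?dom_ge0// mulr_ge0// powR_ge0.
rewrite normrM ger0_norm ?powR_ge0// mulrC -mulrA; apply: ler_pM; rewrite ?powR_ge0 ?fC//.
rewrite /dom mulrCA -[leLHS]mulr1 ler_wpM2l ?powR_ge0//.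
rewrite powRN ler_pdivlMr ?powR_gt0 ?addr_gt0// mul1r.
by apply: ge0_ler_powR; rewrite ?nnegrE; lra.
Qed.

(** By causality the integrand vanishes for s > t. *)
Lemma conv_window a b y t : 0 < a -> b < 1 -> 0 < y ->
  exists C : R, forall s, 0 < s -> `|s `^ (a - 1) * U b y (t - s)| <= C * dom a s.
Proof.
move=> a0 b1 y0; have [C C0 HC] := wU_bounded b1 y0.
eexists; apply: (@powR_window_dom a `|t| C) => // s ts.
by apply: wU_le0 => //; rewrite subr_le0 (le_trans (ler_norm _))// ltW.
Qed.

Lemma conv_continuous a b y t s : 0 < s -> b < 1 -> 0 < y ->
  {for s, continuous (fun s => s `^ (a - 1) * U b y (t - s))}.
Proof.
move=> s0 b1 y0; apply: has_deriv_continuous; apply: has_deriv_mul.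
  exact: has_deriv_powR_id.
apply: (has_deriv_comp (f := U b y)); first exact: (has_deriv_wU_t nu0 nu2).
by apply: has_deriv_sub; [exact: has_deriv_cst|exact: has_deriv_id].
Qed.

Lemma integrable_conv a b y t : 0 < a -> b < 1 -> 0 < y ->
  mu.-integrable HL (EFin \o (fun s => s `^ (a - 1) * U b y (t - s))).
Proof.
move=> a0 b1 y0; have [C HC] := conv_window t a0 b1 y0.
apply: (integrable_dominated a0 _ HC).
by apply: continuous_half_line_measurable => s s0; exact: conv_continuous.
Qed.

Lemma integrable_damped_conv a b y t eps : 0 < a -> b < 1 -> 0 < y -> 0 < eps ->
  mu.-integrable HL (EFin \o (fun s => expR (- (eps * s)) * (s `^ (a - 1) * U b y (t - s)))).
Proof.
move=> a0 b1 y0 e0.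
apply: (le_integrable_half_line (g := fun s => `|s `^ (a - 1) * U b y (t - s)|)).
- apply: measurable_funM.
    apply: measurableT_comp; first by [].
    by apply: measurableT_comp; [by []|exact: measurable_funM].
  by apply: continuous_half_line_measurable => s s0; exact: conv_continuous.
- by apply: integrable_norm; exact: integrable_conv.
- move=> s s0; rewrite normrM -[leRHS]mul1r ler_wpM2r//.
  by rewrite ger0_norm ?expR_ge0// expR_le1 oppr_le0 mulr_ge0// ltW.
Qed.

(** The kernel integrand on the imaginary axis is conv_modulus times the sine of
    this phase. *)
Let conv_phase b y t r : R := (- b + 1) * (pi / 2) + t * r - y * sin (nu * (pi / 2)) * r `^ nu.

Let conv_modulus b y r : R := r `^ (- b) * expR (- (y * cos (nu * (pi / 2)) * r `^ nu)).

Let rayE b y t s r : ray nu (- b) (- (t - s)) y 0 (pi / 2) r =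
  conv_modulus b y r * cos (r * s - (conv_phase b y t r - pi / 2)).
Proof.
rewrite /ray /conv_modulus cos_pihalf sin_pihalf mulr0 mul0r add0r; congr (_ * _).
rewrite -cosBpihalf -cosN; congr cos; rewrite /conv_phase; ring.
Qed.

Let measurable_rayU2 a b y t eps :
  measurable_fun (HL `*` HL : set (mR * mR)) (fun z : mR * mR =>
    damp nu eps 0 (a - 1) z.1 * ray nu (- b) (- (t - z.1)) y 0 (pi / 2) z.2).
Proof.
apply: measurable_funTS.
have mp1 p : measurable_fun setT (fun z : mR * mR => z.1 `^ p).
  by apply: (measurableT_comp (measurable_powR p)); exact: measurable_fst.
have mp2 p : measurable_fun setT (fun z : mR * mR => z.2 `^ p).
  by apply: (measurableT_comp (measurable_powR p)); exact: measurable_snd.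
have m1 : measurable_fun setT (fun z : mR * mR => z.1 : R) by exact: measurable_fst.
have m2 : measurable_fun setT (fun z : mR * mR => z.2 : R) by exact: measurable_snd.
have mc k (g : mR * mR -> R) : measurable_fun setT g -> measurable_fun setT (fun z => k * g z).
  by move=> mg; apply: measurable_funM.
rewrite /damp.
under eq_fun do rewrite rayE /conv_modulus /conv_phase.
apply: measurable_funM; apply: measurable_funM => //.
- apply: measurableT_comp; first by [].
  apply: measurableT_comp; first by [].
  by apply: measurable_funD; apply: mc.
- apply: measurable_funM => //.
  apply: measurableT_comp; first by [].
  by apply: measurableT_comp; [by []|exact: mc].
- apply: (measurableT_comp (f := cos)).
    by apply: continuous_measurable_fun; exact: continuous_cos.
  apply: measurable_funB; first exact: measurable_funM.
  apply: measurable_funB => //; apply: measurable_funB; last exact: mc.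
  by apply: measurable_funD => //; exact: mc.
Qed.

(** Damping by exp (- eps s) makes the double integral absolutely convergent.
    After the exchange of the integrals the inner one is Euler's integral of
    s^(a - 1) exp (- (eps + i r) s) up to conjugation, where eps + i r has
    modulus r / cos phi and argument pi / 2 - phi for tan phi = eps / r. *)
Let damped_convolution a b y t eps : 0 < a -> b < 1 -> 0 < y -> 0 < eps ->
  \int[mu]_(s in HL) (expR (- (eps * s)) * (s `^ (a - 1) * U b y (t - s))) =
  pi^-1 * \int[mu]_(r in HL) (conv_modulus b y r * ((r / cos (atan (eps / r))) `^ (- a) *
    euler_integral a * cos (a * (pi / 2 - atan (eps / r)) - (conv_phase b y t r - pi / 2)))).
Proof.
move=> a0 b1 y0 e0; have p0 := pi_gt0 R.
have n0 := nu0; have n2 := nu2.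
have c1 : -1 < - b by lra.
have ig : mu.-integrable HL (EFin \o damp nu eps 0 (a - 1)).
  by apply: integrable_damp => //; [lra|exact: ltW|rewrite addr0].
have ih := integrable_dampU nu0 nu2 c1 y0.
have bound s r : HL s -> HL r ->
   `|damp nu eps 0 (a - 1) s * ray nu (- b) (- (t - s)) y 0 (pi / 2) r| <=
    damp nu eps 0 (a - 1) s * damp nu 0 (y * kap) (- b) r.
  rewrite /= !in_itv/= !andbT => s0 r0; rewrite normrM (ger0_norm (damp_ge0 _ _ _ _ _)).
  by rewrite ler_wpM2l ?damp_ge0//; apply: (rayU_le nu0 nu2); rewrite ?y0 ?lexx.
have mf := measurable_rayU2 a b y t eps.
have [_ fub] := Rfubini (measurable_itv _) (measurable_itv _) mf ig ih bound.
transitivity (pi^-1 * \int[mu]_(s in HL) \int[mu]_(r in HL)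
    (damp nu eps 0 (a - 1) s * ray nu (- b) (- (t - s)) y 0 (pi / 2) r)).
  clear fub bound mf ig ih.
  rewrite (_ : \int[mu]_(s in HL) \int[mu]_(r in HL) _ =
    \int[mu]_(s in HL) (pi * (expR (- (eps * s)) * (s `^ (a - 1) * U b y (t - s))))); last first.
    apply: eq_Rintegral_half_line => s s0; rewrite RintegralZ_half_line; last exact: (integrable_rayU nu0 nu2).
    rewrite /damp mul0r addr0 /wU /wkernel.
    move: (expR _) (s `^ _) (Rintegral _ _ _) => e p I.
    rewrite (_ : pi * (e * (p * (pi^-1 * I))) = (pi * pi^-1) * (p * e * I)); last ring.
    by rewrite mulfV ?mul1r// gt_eqF.
  rewrite RintegralZ_half_line; last exact: integrable_damped_conv.
  by rewrite mulrA mulVf ?mul1r// gt_eqF.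
congr (_ * _); rewrite fub; clear fub bound mf; apply: eq_Rintegral_half_line => r r0.
set phi := atan (eps / r).
have er0 : 0 < eps / r by rewrite divr_gt0.
have phi0 : 0 < phi by rewrite -(@atan0 R); exact: lt_atan.
have phi2 : phi < pi / 2 by exact: atan_ltpi2.
have cphi : 0 < cos phi by apply: cos_gt0_pihalf; apply/andP; split; lra.
have rho0 : 0 < r / cos phi by rewrite divr_gt0.
have th01 : 0 <= pi / 2 - phi < pi / 2 by apply/andP; split; lra.
have := euler_integral_rotation (conv_phase b y t r - pi / 2) a0 rho0 th01.
have e1 : cos (pi / 2 - phi) = sin phi by rewrite cosB cos_pihalf sin_pihalf mul0r mul1r add0r.
have e2 : sin (pi / 2 - phi) = cos phi by rewrite sinB cos_pihalf sin_pihalf mul0r mul1r subr0.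
rewrite e1 e2 mulfVK ?gt_eqF//.
have -> : r / cos phi * sin phi = eps.
  have tp : sin phi / cos phi = eps / r by rewrite -[LHS]/(tan phi) atanK.
  rewrite -mulrA [_ * sin phi]mulrC tp mulrCA mulfV ?mulr1// gt_eqF//.
move=> <-.
rewrite (_ : \int[mu]_(s in HL) _ = \int[mu]_(s in HL) (conv_modulus b y r *
   (s `^ (a - 1) * expR (- (eps * s)) * cos (r * s - (conv_phase b y t r - pi / 2))))); last first.
  apply: eq_Rintegral_half_line => s s0; rewrite rayE /damp mul0r addr0 [RHS]mulrCA.
  by [].
rewrite RintegralZ_half_line; first by [].
apply: (le_integrable_half_line (g := damp nu eps 0 (a - 1))).
- apply: continuous_half_line_measurable => s s0; apply: has_deriv_continuous.
  apply: has_deriv_mul; first apply: has_deriv_mul; first exact: has_deriv_powR_id.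
    exact/has_deriv_expR/has_deriv_opp/has_deriv_scale/has_deriv_id.
  apply/has_deriv_cos/has_deriv_sub; last exact: has_deriv_cst.
  exact/has_deriv_scale/has_deriv_id.
- exact: ig.
- move=> s s0; rewrite normrM -[leRHS]mulr1.
  rewrite /damp mul0r addr0; apply: ler_pM => //; last exact: cos_max.
  by rewrite ger0_norm// mulr_ge0 ?powR_ge0 ?expR_ge0.
Qed.

(** In the damped formula let eps tend to 0: phi tends to 0, and
    Gamma(a) (i r)^(- a) multiplies the kernel integrand, which raises b by a. *)
Lemma wU_convolution a b y t : 0 < a -> a + b < 1 -> 0 < y ->
  \int[mu]_(s in HL) (s `^ (a - 1) * U b y (t - s)) = euler_integral a * U (a + b) y t.
Proof.
move=> a0 ab1 y0; have b1 : b < 1 by lra.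
have p0 := pi_gt0 R; have n0 := nu0; have n2 := nu2.
have c1 : -1 < - (a + b) by lra.
have limL : \int[mu]_(s in HL) (expR (- (eps * s)) * (s `^ (a - 1) * U b y (t - s)))
    @[eps --> 0^'+] --> \int[mu]_(s in HL) (s `^ (a - 1) * U b y (t - s)).
  apply: (proj2 (@Rdominated_cvg_at_right R 0 1 HL _ _
     (fun s => `|s `^ (a - 1) * U b y (t - s)|) ltr01 _ _ _ _ _)).
  - exact: measurable_itv.
  - move=> e /andP[e0 _].
    have /integrableP[/measurable_EFinP //] := integrable_damped_conv t a0 b1 y0 e0.
  - move=> s _; rewrite -[X in _ --> X]mul1r; apply: cvgM; last exact: cvg_cst.
    have : expR (- (e * s)) @[e --> 0^'+] --> expR (- (0 * s)).
      apply: cvg_at_right_filter.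
      apply: (has_deriv_continuous (f := fun e => expR (- (e * s)))).
      apply/has_deriv_expR/has_deriv_opp/has_deriv_mul; first exact: has_deriv_id.
      exact: has_deriv_cst.
    by rewrite mul0r oppr0 expR0.
  - by apply: integrable_norm; exact: integrable_conv.
  - move=> e s /andP[e0 _]; rewrite /= in_itv/= andbT => s0.
    rewrite normrM -[leRHS]mul1r ler_wpM2r// ger0_norm ?expR_ge0//.
    by rewrite expR_le1 oppr_le0 mulr_ge0// ltW.
pose phi eps r : R := atan (eps * r `^ (-1)).
pose fE eps r := conv_modulus b y r * (r `^ (- a) * cos (phi eps r) `^ a *
    euler_integral a * cos (a * (pi / 2 - phi eps r) - (conv_phase b y t r - pi / 2))).
pose f0 r := euler_integral a * ray nu (- (a + b)) (- t) y 0 (pi / 2) r.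
have E0 : 0 <= euler_integral a.
  by rewrite Rintegral_ge0// => s _; rewrite mulr_ge0 ?powR_ge0 ?expR_ge0.
have phiP eps r : 0 < eps -> 0 < r -> 0 < phi eps r < pi / 2.
  move=> e0 r0; rewrite /phi atan_ltpi2 andbT -[ltLHS](@atan0 R); apply: lt_atan.
  by rewrite mulr_gt0// powR_gt0.
have cphi eps r : 0 < eps -> 0 < r -> 0 < cos (phi eps r).
  move=> e0 r0; have /andP[h1 h2] := phiP _ _ e0 r0.
  by apply: cos_gt0_pihalf; rewrite h2 andbT; lra.
have limR : \int[mu]_(r in HL) fE eps r @[eps --> 0^'+] --> \int[mu]_(r in HL) f0 r.
  apply: (proj2 (@Rdominated_cvg_at_right R 0 1 HL _ _
     (fun r => euler_integral a * damp nu 0 (y * kap) (- (a + b)) r) ltr01 _ _ _ _ _)).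
  - exact: measurable_itv.
  - move=> e /andP[e0 _]; apply: measurable_funTS.
    have mcos : measurable_fun setT (@cos R).
      by apply: continuous_measurable_fun; exact: continuous_cos.
    have matan : measurable_fun setT (@atan R).
      by apply: continuous_measurable_fun => x; exact: continuous_atan.
    have mphi : measurable_fun setT (phi e).
      by apply: measurableT_comp => //; exact: measurable_funM.
    apply: measurable_funM.
      apply: measurable_funM => //; apply: measurableT_comp => //.
      by apply: measurableT_comp => //; exact: measurable_funM.
    apply: measurable_funM.
      apply: measurable_funM => //; apply: measurable_funM => //.
      by apply: (measurableT_comp (measurable_powR a)); exact: measurableT_comp.
    apply: measurableT_comp => //; apply: measurable_funB.
      by apply: measurable_funM => //; exact: measurable_funB.
    apply: measurable_funB => //; apply: measurable_funB; last exact: measurable_funM.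
    by apply: measurable_funD => //; exact: measurable_funM.
  - move=> r; rewrite /= in_itv/= andbT => r0.
    have cphi0 : phi e r @[e --> 0^'+] --> 0.
      rewrite -[X in _ --> X](@atan0 R) -[X in _ --> atan X](mul0r (r `^ (-1))).
      apply: cvg_at_right_filter; apply: continuous_comp; last exact: continuous_atan.
      by apply: cvgM; [exact: cvg_id|exact: cvg_cst].
    have ccos (h : R -> R) l : h e @[e --> 0^'+] --> l -> cos (h e) @[e --> 0^'+] --> cos l.
      by move=> hl; apply: continuous_cvg => //; exact: continuous_cos.
    have -> : f0 r = conv_modulus b y r * (r `^ (- a) * 1 `^ a *
        euler_integral a * cos (a * (pi / 2 - 0) - (conv_phase b y t r - pi / 2))).
      have := rayE (a + b) y t 0 r; rewrite subr0 /f0 => ->.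
      rewrite /conv_modulus opprD powR_add// powR1.
      rewrite (_ : r * 0 - _ = a * (pi / 2 - 0) - (conv_phase b y t r - pi / 2)); last by rewrite /conv_phase; ring.
      by move: (cos _) (expR _) (_ `^ _) (_ `^ _) (euler_integral a) => v1 v2 v3 v4 v5; ring.
    apply: cvgM; first exact: cvg_cst.
    apply: cvgM.
      apply: cvgM; last exact: cvg_cst.
      apply: cvgM; first exact: cvg_cst.
      apply: (@continuous_cvg _ _ _ (0 : R)^'+ _ _ (fun x : R => x `^ a)).
        exact: powR_continuous.
      by rewrite -[X in _ --> X](@cos0 R); exact: ccos.
    apply: ccos; apply: cvgB; last exact: cvg_cst.
    apply: cvgM; first exact: cvg_cst.
    by apply: cvgB => //; exact: cvg_cst.
  - apply: RintegrableZ; first exact: measurable_itv.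
    exact: (integrable_dampU nu0 nu2).
  - move=> e r /andP[e0 _]; rewrite /= in_itv/= andbT => r0.
    have D0 : 0 <= conv_modulus b y r by rewrite mulr_ge0 ?powR_ge0 ?expR_ge0.
    rewrite /fE normrM (ger0_norm D0).
    rewrite (_ : damp nu 0 (y * kap) (- (a + b)) r = r `^ (- a) *
       (r `^ (- b) * expR (- (y * kap * r `^ nu)))); last first.
      by rewrite /damp opprD powR_add// mul0r add0r mulrA.
    have hD : conv_modulus b y r <= r `^ (- b) * expR (- (y * kap * r `^ nu)).
      rewrite ler_wpM2l ?powR_ge0// ler_expR lerN2 ler_wpM2r ?powR_ge0//.
      by rewrite ler_wpM2l ?(ltW y0)//; apply: (cos_nu_ge nu0 nu2); exact: pihalf_itv.
    rewrite mulrC [leRHS]mulrA; apply: ler_pM => //.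
    rewrite normrM -[leRHS]mulr1; apply: ler_pM => //; last exact: cos_max.
    rewrite normrM (ger0_norm E0) mulrC ler_wpM2l// normrM -[leRHS]mulr1.
    rewrite (ger0_norm (powR_ge0 r _)) ler_wpM2l ?powR_ge0// ger0_norm ?powR_ge0//.
    have -> : (1 : R) = 1 `^ a by rewrite powR1.
    apply: ge0_ler_powR; rewrite ?nnegrE ?(ltW a0)//.
    exact/ltW/cphi.
have Ed : {near 0^'+, (fun eps => \int[mu]_(s in HL) (expR (- (eps * s)) * (s `^ (a - 1) * U b y (t - s)))) =1
    (fun eps => pi^-1 * \int[mu]_(r in HL) fE eps r)}.
  near=> e; have e0 : 0 < e by near: e; exact: nbhs_right_gt.
  rewrite damped_convolution//; congr (_ * _); apply: eq_Rintegral_half_line => r r0.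
  have r0' := ltW r0.
  rewrite /fE (_ : e / r = e * r `^ (-1)); last by rewrite powR_inv1.
  rewrite -/(phi e r); congr (_ * (_ * _ * _)).
  have c0 := cphi _ _ e0 r0.
  rewrite powRM ?invr_ge0 ?(ltW c0)//; congr (_ * _).
  by rewrite -powR_inv1 ?(ltW c0)// -powRrM mulrNN mul1r.
have lim1 : pi^-1 * \int[mu]_(r in HL) fE e r @[e --> 0^'+] -->
    \int[mu]_(s in HL) (s `^ (a - 1) * U b y (t - s)).
  exact: cvg_trans (near_eq_cvg Ed) limL.
have lim2 : pi^-1 * \int[mu]_(r in HL) fE e r @[e --> 0^'+] -->
    pi^-1 * \int[mu]_(r in HL) f0 r.
  by apply: cvgM; [exact: cvg_cst|exact: limR].
have -> := @cvg_unique _ (@Rhausdorff R) _ _ _ _ lim1 lim2.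
rewrite RintegralZ_half_line; last by apply: (integrable_rayU nu0 nu2).
by rewrite mulrCA.
Unshelve. all: by end_near. Qed.

End Convolution.

(** * The one-sided stable density *)

Section StableDensity.
Context {R : realType} (nu : R) (nu0 : 0 < nu) (nu2 : 2 * nu < 1).
Local Notation mu := (@lebesgue_measure R).
Local Notation HL := [set` @Interval R (BRight 0%R) +oo%O].
Local Notation kap := (cos (nu * pi)).
Local Notation U := (wU nu).
Local Notation W := (wW nu).
Implicit Types (a b y t s r : R).

(** F is e^(- t r) times the imaginary part of exp (- y r^nu e^(- i pi nu));
    it vanishes at both ends of the half-line, and the two terms of its
    derivative are the two sides. *)
Lemma wW0E y t : 0 <= y -> 0 < t -> t * W 0 y t = nu * y * W (1 - nu) y t.
Proof.
move=> y0 t0; have n0 := nu0; have n2 := nu2; have p0 := pi_gt0 R.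
have k0 := ltW (cos_nupi_gt0 nu0 nu2).
pose F r := expR (- (t * r + y * kap * r `^ nu)) * sin (y * sin (nu * pi) * r `^ nu).
pose f r := nu * y * ray nu (- (1 - nu)) (- t) y 0 pi r - t * ray nu (- 0) (- t) y 0 pi r.
have it1 : mu.-integrable HL (EFin \o ray nu (- (1 - nu)) (- t) y 0 pi).
  by apply: (integrable_rayW nu0 nu2) => //; lra.
have it0 : mu.-integrable HL (EFin \o ray nu (- 0) (- t) y 0 pi).
  by apply: (integrable_rayW nu0 nu2) => //; lra.
have Fle r : 0 < r -> `|F r| <= damp nu t 0 (- 0 + 0) r.
  move=> r0; rewrite /F /damp oppr0 addr0 powRr0 mul1r normrM -[leRHS]mulr1.
  apply: ler_pM => //; last exact: sin_max.
  by rewrite ger0_norm ?expR_ge0// ler_expR lerN2 mul0r lerD2l mulr_ge0 ?powR_ge0// mulr_ge0.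
have dF r : 0 < r -> has_deriv F r (f r).
  move=> r0; apply: has_deriv_eq.
    apply: has_deriv_mul.
      apply/has_deriv_expR/has_deriv_opp/has_deriv_add.
        exact/has_deriv_scale/has_deriv_id.
      exact/has_deriv_scale/has_deriv_powR_id.
    exact/has_deriv_sin/has_deriv_scale/has_deriv_powR_id.
  rewrite /f /ray oppr0 opprB powRr0 cospi sinpi !mulr0 !mul0r !subr0 !addr0 subrK add0r mul1r mul1r.
  rewrite !mulrN1 !opprK [sin (nu * pi - _)]sinB [sin (pi - _)]sinB sinpi cospi.
  by ring.
have c0 : 0 < (1 : R) by [].
have I0 : \int[mu]_(r in HL) f r = 0 - 0.
  apply: (Rintegral_half_line dF).

  - move=> r r0; have ca b : {for r, continuous (ray nu b (- t) y 0 pi)}.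
      exact: ray_continuous.
    by apply: cvgB; (apply: cvgM; [exact: cvg_cst|exact: ca]).
  - apply: RintegrableB; first exact: measurable_itv.
      by apply: RintegrableZ; first exact: measurable_itv.
    by apply: RintegrableZ; first exact: measurable_itv.
  - rewrite -[X in _ --> X](mulr0 (expR (- (t * 0 + y * kap * 0)))).
    have rnu : r `^ nu @[r --> 0^'+] --> (0 : R) by exact: powR_cvg0.
    have rid : r @[r --> 0^'+] --> (0 : R) by apply: cvg_at_right_filter; exact: cvg_id.
    apply: cvgM.
      apply: (@continuous_cvg _ _ _ (0 : R)^'+ _ _ expR); first exact: continuous_expR.
      by apply: cvgN; apply: cvgD; apply: cvgM => //; exact: cvg_cst.
    have : sin (y * sin (nu * pi) * r `^ nu) @[r --> 0^'+] --> sin (y * sin (nu * pi) * 0).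
      apply: (@continuous_cvg _ _ _ (0 : R)^'+ _ _ sin); first exact: continuous_sin.
      by apply: cvgM => //; exact: cvg_cst.
    by rewrite mulr0 sin0.
  - apply: norm_cvg0; apply: (@squeeze_cvgr _ _ _ _ (cst 0) (damp nu t 0 1)).
    + near=> r; have r1 : 1 <= r by near: r; exact: nbhs_pinfty_ge.
      have r0 : 0 < r by lra.
      rewrite normr_ge0/= (le_trans (Fle _ r0))// /damp oppr0 addr0 powRr0 mul1r.
      by rewrite powRr1 ?(ltW r0)// -[leLHS]mul1r ler_wpM2r ?expR_ge0.
    + exact: cvg_cst.
    + by apply: damp_cvg_pinfty; rewrite ?addr0 ?(ltW t0).
have E : \int[mu]_(r in HL) f r = nu * y * \int[mu]_(r in HL) ray nu (- (1 - nu)) (- t) y 0 pi r -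
    t * \int[mu]_(r in HL) ray nu (- 0) (- t) y 0 pi r.
  have mHL : measurable HL by exact: measurable_itv.
  rewrite RintegralB; [|exact: mHL|exact: RintegrableZ|exact: RintegrableZ].
  by rewrite RintegralZ_half_line; [rewrite RintegralZ_half_line|].
move: I0; rewrite E subr0 /wW /wkernel => /eqP; rewrite subr_eq0 => /eqP E'.
by rewrite mulrCA -E' mulrCA.
Unshelve. all: by end_near. Qed.

Lemma wU0_le : exists2 C : R, 0 <= C & forall y t, 0 < y -> 0 < t ->
  `|U 0 y t| <= C * y * t `^ (- (1 + nu)).
Proof.
have n0 := nu0; have n2 := nu2.
have [|C C0 HC] := @wW_le _ nu nu0 nu2 (1 - nu); first lra.
exists (nu * C); first by rewrite mulr_ge0// ltW.
move=> y t y0 t0; rewrite (wUW nu0 nu2)//.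
have -> : W 0 y t = t^-1 * (nu * y * W (1 - nu) y t).
  by rewrite -wW0E ?(ltW y0)// mulKf ?gt_eqF.
have -> : nu * C * y * t `^ (- (1 + nu)) = t^-1 * (nu * y * (C * t `^ (- nu))).
  rewrite opprD powR_add// powR_inv1 ?(ltW t0)//.
  by move: (t^-1) (t `^ _) => u v; ring.
rewrite normrM (gtr0_norm (_ : 0 < t^-1)) ?invr_gt0// ler_wpM2l ?invr_ge0 ?(ltW t0)//.
rewrite normrM (gtr0_norm (_ : 0 < nu * y)) ?mulr_gt0// ler_wpM2l ?mulr_ge0 ?(ltW y0) ?(ltW nu0)//.
by have := HC y t (ltW y0) t0; rewrite (_ : 1 - nu - 1 = - nu)//; ring.
Qed.

Lemma integrable_wU0 y : 0 < y -> mu.-integrable HL (EFin \o U 0 y).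
Proof.
move=> y0; have n0 := nu0.
have [C C0 HC] := wU0_le; have [C' C'0 HC'] := wU_bounded nu0 nu2 (@ltr01 R) y0.
(* bounded for t <= 1, and O(t^(- (1 + nu))) for t > 1 *)
pose K := (C * y + C') * 2 `^ (1 + nu).
apply: (le_integrable_half_line (g := fun t => K * (1 + t) `^ (- (1 + nu)))).
- apply: continuous_half_line_measurable => t t0; exact: (wU_continuous nu0 nu2).
- by apply: RintegrableZ; [exact: measurable_itv|exact: integrable_powR_1D].
move=> t t0; rewrite /K.
have Cy0 : 0 <= C * y by rewrite mulr_ge0// ltW.
have [t1|t1] := leP t 1.
  rewrite (le_trans (HC' t))// -mulrA -[leLHS]mulr1; apply: ler_pM => //; first lra.
  rewrite powRN ler_pdivlMr ?powR_gt0 ?addr_gt0// mul1r.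
  by apply: ge0_ler_powR; rewrite ?nnegrE; lra.
rewrite (le_trans (HC _ _ y0 t0))// -[leRHS]mulrA; apply: ler_pM; rewrite ?powR_ge0 ?lerDl//.
rewrite !powRN ler_pdivlMr ?powR_gt0 ?addr_gt0// mulrC ler_pdivrMr ?powR_gt0//.
by rewrite -powRM ?(ltW t0)//; apply: ge0_ler_powR; rewrite ?nnegrE; lra.
Qed.

Lemma wU_unit b y t : b < 1 -> 0 < y ->
  U b y t = (y `^ (- nu^-1)) `^ (1 - b) * U b 1 (t * y `^ (- nu^-1)).
Proof.
move=> b1 y0; have k0 : 0 < y `^ (- nu^-1) by rewrite powR_gt0.
have yk : y * (y `^ (- nu^-1)) `^ nu = 1.
  by rewrite -powRrM mulNr mulVf ?gt_eqF// powR_inv1 ?(ltW y0)// mulfV ?gt_eqF.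
by rewrite (wU_scale nu0 nu2 _ b1 y0 k0) yk.
Qed.

(** Equal to 1 (stable_mass1), but the value is only obtained after the
    reflection formula has been expressed through it. *)
Definition stable_mass : R := \int[mu]_(t in HL) U 0 1 t.

(** U 0 y is the dilation of U 0 1 by y^(1 / nu), so that it concentrates at
    0 with constant mass.  Away from 0 it is O(y), which disposes of the part
    of phi that is not bounded. *)
Lemma stable_approx_identity (phi : R -> R) (phi0 B d : R) : 0 < d -> 0 <= B ->
  mu.-integrable HL (EFin \o phi) ->
  (forall s, 0 < s < d -> `|phi s| <= B) ->
  phi s @[s --> 0^'+] --> phi0 ->
  \int[mu]_(s in HL) (U 0 y s * phi s) @[y --> 0^'+] --> stable_mass * phi0.
Proof.
move=> d0 B0 iphi phiB phi_cvg; have n0 := nu0; have n2 := nu2.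
have /integrableP[/measurable_EFinP mphi _] := iphi.
have mHL : measurable HL by exact: measurable_itv.
(* split phi at d into a bounded part and a part supported away from 0 *)
pose phi1 := phi \_ `]-oo, d[.
pose phi2 s := phi s - phi1 s.
have phi1E s : s < d -> phi1 s = phi s.
  by move=> sd; rewrite /phi1 patchE mem_set//= in_itv.
have phi1E0 s : d <= s -> phi1 s = 0.
  by move=> ds; rewrite /phi1 patchE memNset//= in_itv/= ltNge ds.
have mphi1 : measurable_fun HL phi1.
  apply/(measurable_restrict phi) => //.
  by apply: measurable_funS mphi => // x [].
have phi1B s : 0 < s -> `|phi1 s| <= B.
  move=> s0; have [sd|ds] := ltP s d; first by rewrite phi1E// phiB// s0.
  by rewrite phi1E0// normr0.
have iphi1 : mu.-integrable HL (EFin \o phi1).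
  apply: (le_integrable_half_line (g := fun s => `|phi s|)) => //.
    by apply: integrable_norm.
  move=> s s0; have [sd|ds] := ltP s d; first by rewrite phi1E.
  by rewrite phi1E0// normr0.
have iphi2 : mu.-integrable HL (EFin \o phi2) by exact: RintegrableB.
have mU y : 0 < y -> measurable_fun HL (U 0 y).
  by move=> y0; apply: continuous_half_line_measurable => t _; exact: (wU_continuous nu0 nu2).
have iU1 y : 0 < y -> mu.-integrable HL (EFin \o (fun s => U 0 y s * phi1 s)).
  move=> y0; apply: (le_integrable_half_line (g := fun s => B * `|U 0 y s|)).
  - by apply: measurable_funM => //; exact: mU.
  - by apply: RintegrableZ => //; apply: integrable_norm => //; exact: integrable_wU0.
  - by move=> s s0; rewrite normrM mulrC ler_wpM2r// phi1B.
have [C C0 HC] := wU0_le.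
pose K := C * d `^ (- (1 + nu)).
have U2B y s : 0 < y -> 0 < s -> `|U 0 y s * phi2 s| <= y * K * `|phi2 s|.
  move=> y0 s0; have [sd|ds] := ltP s d.
    by rewrite /phi2 phi1E// subrr mulr0 normr0 mulr0.
  rewrite normrM ler_wpM2r// (le_trans (HC _ _ y0 s0))// /K mulrCA mulrA.
  rewrite ler_wpM2l ?mulr_ge0 ?(ltW y0)// !powRN lef_pV2 ?posrE ?powR_gt0//.
  by apply: ge0_ler_powR; rewrite ?nnegrE; lra.
have iU2 y : 0 < y -> mu.-integrable HL (EFin \o (fun s => U 0 y s * phi2 s)).
  move=> y0; apply: (le_integrable_half_line (g := fun s => y * K * `|phi2 s|)).
  - apply: measurable_funM; first exact: mU.
    by apply: measurable_funB.
  - by apply: RintegrableZ => //; apply: integrable_norm.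
  - by move=> s s0; exact: U2B.
have lim1 : \int[mu]_(s in HL) (U 0 y s * phi1 s) @[y --> 0^'+] --> stable_mass * phi0.
  pose q y : R := y `^ (nu^-1).
  have q0 y : 0 < y -> 0 < q y by move=> y0; rewrite powR_gt0.
  have E : {near 0^'+, (fun y => \int[mu]_(s in HL) (U 0 1 s * phi1 (q y * s))) =1
       (fun y => \int[mu]_(s in HL) (U 0 y s * phi1 s))}.
    near=> y; have y0 : 0 < y by near: y; exact: nbhs_right_gt.
    have [iS ->] := Rintegral_scale_half_line (q0 _ y0) (iU1 _ y0).
    rewrite -RintegralZ_half_line//.
    apply: eq_Rintegral_half_line => s s0.
    have k0 : 0 < y `^ (- nu^-1) by rewrite powR_gt0.
    rewrite (wU_unit (q y * s) ltr01 y0) subr0 powRr1 ?(ltW k0)// /q powRN.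
    have qn : y `^ nu^-1 != 0 by rewrite gt_eqF// powR_gt0.
    by rewrite [_ * s * _]mulrAC mulfV// mul1r !mulrA mulfV// mul1r.
  apply: cvg_trans (near_eq_cvg E) _.
  rewrite /stable_mass mulrC -RintegralZ_half_line; last exact: integrable_wU0.
  apply: (proj2 (@Rdominated_cvg_at_right R 0 1 HL _ _
     (fun s => B * `|U 0 1 s|) ltr01 _ _ _ _ _)).
  - exact: mHL.
  - move=> y /andP[y0 _]; apply: measurable_funM; first exact: mU.
    have := Rintegral_scale_half_line (q0 _ y0) iphi1.
    by move=> [/integrableP[/measurable_EFinP]].
  - move=> s; rewrite /= in_itv/= andbT => s0; rewrite mulrC; apply: cvgM; first exact: cvg_cst.
    apply/cvgrPdist_lt => e e0.
    have /cvgrPdist_lt/(_ _ e0) := phi_cvg; rewrite near_withinE => -[/= dl dl0 Hdl].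
    have d1 : 0 < Num.min d dl by rewrite lt_min d0.
    have nuV : 0 < nu^-1 by rewrite invr_gt0.
    have qs : q y * s @[y --> 0^'+] --> 0 * s.
      by apply: cvgM; [exact: powR_cvg0|exact: cvg_cst].
    rewrite mul0r in qs.
    near=> y; have y0 : 0 < y by near: y; exact: nbhs_right_gt.
    have qs0 : 0 < q y * s by rewrite mulr_gt0// q0.
    have : q y * s < Num.min d dl by near: y; exact: (cvgr_lt 0).
    rewrite lt_min => /andP[h1 h2]; rewrite phi1E//; apply: Hdl => //=.
    by rewrite sub0r normrN gtr0_norm.
  - by apply: RintegrableZ => //; apply: integrable_norm => //; exact: integrable_wU0.
  - move=> y s /andP[y0 _]; rewrite /= in_itv/= andbT => s0.
    by rewrite normrM mulrC ler_wpM2r// phi1B// mulr_gt0// q0.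
have lim2 : \int[mu]_(s in HL) (U 0 y s * phi2 s) @[y --> 0^'+] --> (0 : R).
  pose M := \int[mu]_(s in HL) `|phi2 s|.
  have iN : mu.-integrable HL (EFin \o (fun s => `|phi2 s|)) by exact: integrable_norm.
  apply: norm_cvg0; apply: (@squeeze_cvgr _ _ _ _ (cst 0) (fun y => y * (K * M))).
  - near=> y; have y0 : 0 < y by near: y; exact: nbhs_right_gt.
    rewrite normr_ge0/= mulrA -RintegralZ_half_line//.
    apply: normr_Rintegral_half_line_le.
    + by apply: measurable_integrable; exact: iU2.
    + exact: RintegrableZ.
    + by move=> s s0; exact: U2B.
  - exact: cvg_cst.
  - rewrite -[X in _ --> X](mul0r (K * M)); apply: cvgM; last exact: cvg_cst.
    by apply: cvg_at_right_filter; exact: cvg_id.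
rewrite -[stable_mass * phi0]addr0.
apply: (cvg_right_eq ltr01 _ (cvgD lim1 lim2)) => y /andP[y0 _].
rewrite -[LHS]/(\int[mu]_(s in HL) (U 0 y s * phi1 s) + \int[mu]_(s in HL) (U 0 y s * phi2 s)).
rewrite -RintegralD_half_line; [|exact: iU1|exact: iU2].
by apply: eq_Rintegral_half_line => s s0; rewrite /phi2; ring.
Unshelve. all: by end_near. Qed.

End StableDensity.

(** * Euler's integral and the masses of the kernels *)

Section EulerIntegral.
Context {R : realType}.
Local Notation mu := (@lebesgue_measure R).
Local Notation HL := [set` @Interval R (BRight 0%R) +oo%O].
Local Notation OI t := [set` @Interval R (BRight 0%R) (BLeft t)].
Implicit Types (a z e : R).

Lemma integrable_euler z : 0 < z -> mu.-integrable HL (EFin \o damp 1 1 0 (z - 1)).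
Proof. by move=> z0; apply: integrable_damp; lra. Qed.

Lemma euler_integralS z : 0 < z -> euler_integral (z + 1) = z * euler_integral z.
Proof.
move=> z0; have i0 := integrable_euler z0.
have i1 : mu.-integrable HL (EFin \o damp 1 1 0 (z + 1 - 1)) by apply: integrable_euler; lra.
rewrite !euler_integral_damp -RintegralZ_half_line//.
apply/esym/eqP; rewrite -subr_eq0 -RintegralB_half_line//; last exact: integrableZ_half_line.
apply/eqP; apply: (eq_trans (y := (0 : R) - 0)); last exact: subr0.
apply: (@Rintegral_half_line _ _ (damp 1 1 0 z)).
- move=> s s0; apply: has_deriv_eq.
    apply: has_deriv_mul; first exact: has_deriv_powR_id.
    apply/has_deriv_expR/has_deriv_opp/has_deriv_add.
      exact/has_deriv_scale/has_deriv_id.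
    exact/has_deriv_scale/has_deriv_powR_id.
  by rewrite /damp addrK !mul1r !mul0r addr0; ring.
- move=> s s0; apply: cvgB; last exact: damp_continuous.
  by apply: cvgM; [exact: cvg_cst|exact: damp_continuous].
- by apply: integrableB_half_line => //; exact: integrableZ_half_line.
- by apply: damp_cvg0.
- by apply: damp_cvg_pinfty; lra.
Qed.

Lemma euler_integral1 : euler_integral 1 = 1 :> R.
Proof.
have i1 : mu.-integrable HL (EFin \o damp 1 1 0 (1 - 1 : R)) by apply: integrable_euler; lra.
rewrite euler_integral_damp [RHS](_ : 1 = 0 - (- 1)); last by rewrite sub0r opprK.
apply: (@Rintegral_half_line _ _ (fun s => - expR (- s))) => //.
- move=> s s0; apply: has_deriv_eq; first exact/has_deriv_opp/has_deriv_expR/has_deriv_opp/has_deriv_id.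
  by rewrite /damp subrr powRr0 mul1r mul0r addr0 mulrN1 opprK mul1r.
- by move=> s s0; exact: damp_continuous.
- apply: cvgN.
  have : expR (- s) @[s --> 0^'+] --> expR (- 0 : R).
    apply: cvg_at_right_filter; apply: (has_deriv_continuous (f := fun s => expR (- s))).
    exact/has_deriv_expR/has_deriv_opp/has_deriv_id.
  by rewrite oppr0 expR0.
- rewrite -[X in _ --> X]oppr0; apply: cvgN.
  have h : damp 1 1 0 1 s @[s --> +oo] --> (0 : R) by apply: damp_cvg_pinfty; lra.
  apply: norm_cvg0; apply: (@squeeze_cvgr _ _ _ _ (cst 0) (damp 1 1 0 1)).
  + near=> s; have s1 : 1 <= s by near: s; exact: nbhs_pinfty_ge.
    rewrite normr_ge0/= ger0_norm ?expR_ge0// /damp mul1r mul0r addr0 powRr1 ?(le_trans _ s1)//.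
    by rewrite -[leLHS]mul1r ler_wpM2r ?expR_ge0.
  + exact: cvg_cst.
  + exact: h.
Unshelve. all: by end_near. Qed.

(** On [1/2, 3/2] the powers s^(z - 1) are bounded by s^(- 1/2) + s. *)
Lemma euler_integral_cvg1 (k : R) : `|k| <= 1 ->
  euler_integral (1 + k * e) @[e --> 0^'+] --> (1 : R).
Proof.
move=> k1; rewrite -{2}euler_integral1.
have c12 : 0 < (2^-1 : R) by lra.
have E (z : R) : euler_integral z = \int[mu]_(r in HL) damp 1 1 0 (z - 1) r.
  exact: euler_integral_damp.
rewrite E; under eq_fun do rewrite E.
apply: (proj2 (@Rdominated_cvg_at_right R 0 2^-1 HL (fun e => damp 1 1 0 (1 + k * e - 1))
   (damp 1 1 0 (1 - 1)) (fun s => damp 1 1 0 (2^-1 - 1) s + damp 1 1 0 (2 - 1) s) c12 _ _ _ _ _)).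
- exact: measurable_itv.
- by move=> e _; apply: continuous_half_line_measurable => s; exact: damp_continuous.
- move=> s; rewrite /= in_itv/= andbT => s0; apply: cvgM; last exact: cvg_cst.
  have -> : 1 - 1 = 1 + k * 0 - 1 :> R by rewrite mulr0 addr0.
  rewrite (_ : (fun e => s `^ (1 + k * e - 1)) = (fun e => expR ((1 + k * e - 1) * ln s))); last first.
    by apply/funext => e; rewrite /powR gt_eqF.
  rewrite (_ : s `^ _ = expR ((1 + k * 0 - 1) * ln s)); last by rewrite /powR gt_eqF.
  apply: cvg_at_right_filter.
  apply: (has_deriv_continuous (f := fun e => expR ((1 + k * e - 1) * ln s))).
  apply: has_deriv_expR; apply: has_deriv_mul; last exact: has_deriv_cst.
  apply: has_deriv_sub; last exact: has_deriv_cst.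
  apply: has_deriv_add; first exact: has_deriv_cst.
  exact/has_deriv_scale/has_deriv_id.
- by apply: integrableD_half_line; apply: integrable_euler; lra.
- move=> e s /andP[e0]; rewrite add0r => e1; rewrite /= in_itv/= andbT => s0.
  rewrite ger0_norm ?damp_ge0// /damp -mulrDl ler_wpM2r ?expR_ge0//.
  have [ke1 ke2] : - 2^-1 <= k * e /\ k * e <= 2^-1.
    apply/andP; rewrite -ler_norml normrM -[leRHS]mul1r ler_pM// gtr0_norm// ltW//.
  have [s1|s1] := leP 1 s.
    by rewrite -[leLHS]add0r lerD ?powR_ge0//; apply: ler_powR => //; lra.
  rewrite -[leLHS]addr0 lerD ?powR_ge0//; apply: ger_powR; lra.
Qed.

End EulerIntegral.

Section Reflection.
Context {R : realType} (nu : R) (nu0 : 0 < nu) (nu2 : 2 * nu < 1).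
Local Notation mu := (@lebesgue_measure R).
Local Notation HL := [set` @Interval R (BRight 0%R) +oo%O].
Local Notation OI t := [set` @Interval R (BRight 0%R) (BLeft t)].
Local Notation U := (wU nu).
Local Notation W := (wW nu).
Implicit Types (a b y t s r e : R).

Lemma integrable_powR_window a t : 0 < a -> 0 < t ->
  mu.-integrable (OI t) (EFin \o (fun s => s `^ (a - 1))).
Proof.
move=> a0 t0.
pose w s : R := if s < t then 1 else 0.
have mw : measurable_fun HL w by apply: measurable_fun_if => //; exact: measurable_fun_ltr.
have w1 s : 0 < s -> `|w s| <= 1 by rewrite /w; case: ifP; rewrite ?normr1 ?normr0.
have wt s : t < s -> w s = 0 by rewrite /w; case: ltgtP.
have h : mu.-integrable HL (EFin \o (fun s => s `^ (a - 1) * w s)).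
  apply: (integrable_dominated a0 _ (powR_window_dom a0 ler01 (ltW t0) w1 wt)).
  apply: measurable_funM => //; apply: continuous_half_line_measurable => s s0.
  exact: powR_continuous.
have w0 s : t <= s -> s `^ (a - 1) * w s = 0 by rewrite /w leNgt => /negbTE ->; rewrite mulr0.
have := (half_line_window w0).1.2 h; apply: (@eq_integrable _ _ _ mu).
  exact: measurable_itv.
by move=> s; rewrite inE /= in_itv/= => /andP[_ st]; rewrite /w st mulr1.
Qed.

Lemma wU_convolution_window a b y t : 0 < a -> a + b < 1 -> 0 < y ->
  \int[mu]_(s in OI t) ((t - s) `^ (a - 1) * U b y s) = euler_integral a * U (a + b) y t /\
  mu.-integrable (OI t) (EFin \o (fun s => (t - s) `^ (a - 1) * U b y s)).
Proof.
move=> a0 ab1 y0; have b1 : b < 1 by lra.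
have z s : t <= s -> s `^ (a - 1) * U b y (t - s) = 0.
  by move=> ts; rewrite (wU_le0 nu0 nu2)// ?mulr0// subr_le0.
have iw := (half_line_window z).1.2 (integrable_conv nu0 nu2 t a0 b1 y0).
have [ir er] := Rintegral_window_reflect iw.
have E : (fun s => (t - s) `^ (a - 1) * U b y (t - (t - s))) =
    (fun s => (t - s) `^ (a - 1) * U b y s).
  by apply/funext => s; rewrite subKr.
rewrite E in ir; split; last exact: ir.
have c := wU_convolution nu0 nu2 t a0 ab1 y0; have e := (half_line_window z).2.
exact: (eq_trans (congr1 (Rintegral mu (OI t)) (esym E)) (eq_trans (esym er) (eq_trans e c))).
Qed.

(** Test U 0 y against phi(s) = (1 - s)^(a - 1) and let y tend to 0.  The
    left side comes from the approximate identity; the right side because the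
    integral is the convolution Gamma(a) U a y 1, with known limit at y = 0. *)
Lemma stable_mass_reflection a : 0 < a < 1 ->
  stable_mass nu = euler_integral a * (pi^-1 * sin (pi * a) * euler_integral (1 - a)).
Proof.
move=> /andP[a0 a1].
pose phi s := if s < 1 then (1 - s) `^ (a - 1) else 0.
have phi0 s : 1 <= s -> phi s = 0 by rewrite /phi leNgt => /negbTE ->.
have iphi : mu.-integrable HL (EFin \o phi).
  apply/(half_line_window phi0).1.
  have := (Rintegral_window_reflect (integrable_powR_window a0 ltr01)).1.
  apply: (@eq_integrable _ _ _ mu); first exact: measurable_itv.
  by move=> s; rewrite inE /= in_itv/= => /andP[_ st]; rewrite /phi st.
have h2 : 0 < (2^-1 : R) by lra.
have phiB s : 0 < s < 2^-1 -> `|phi s| <= 2^-1 `^ (a - 1).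
  move=> /andP[s0 s2]; rewrite /phi ifT; last lra.
  rewrite ger0_norm ?powR_ge0// -[a - 1]opprB !powRN lef_pV2 ?posrE ?powR_gt0//; [|lra..].
  by apply: ge0_ler_powR; rewrite ?nnegrE; lra.
have phi_cvg : phi s @[s --> 0^'+] --> (1 : R).
  have h : (1 - s) `^ (a - 1) @[s --> 0^'+] --> (1 - 0 : R) `^ (a - 1).
    apply: cvg_at_right_filter; apply: (has_deriv_continuous (f := fun s => (1 - s) `^ (a - 1))).
    apply: (has_deriv_powR (f := fun s => 1 - s)); first lra.
    by apply: has_deriv_sub; [exact: has_deriv_cst|exact: has_deriv_id].
  rewrite subr0 powR1 in h; apply: (cvg_right_eq h2 _ h) => s /andP[s0 s1].
  by rewrite /phi ifT//; lra.
have L1 := stable_approx_identity nu0 nu2 h2 (powR_ge0 _ _) iphi phiB phi_cvg.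
rewrite mulr1 in L1.
have L2 : \int[mu]_(s in HL) (U 0 y s * phi s) @[y --> 0^'+] -->
    euler_integral a * (pi^-1 * sin (pi * a) * euler_integral (1 - a)).
  have -> : pi^-1 * sin (pi * a) * euler_integral (1 - a) = W a 0 1.
    by rewrite wW_0// powR1 mulr1.
  have h : euler_integral a * W a y 1 @[y --> 0^'+] --> euler_integral a * W a 0 1.
    by apply: cvgM; [exact: cvg_cst|exact: wW_cvg0].
  apply: (cvg_right_eq ltr01 _ h) => y /andP[y0 _].
  have a01 : a + 0 < 1 by lra.
  have c := (wU_convolution_window 1 a0 a01 y0).1.
  rewrite addr0 in c; rewrite -(wUW nu0 nu2)// -c.
  have z s : 1 <= s -> U 0 y s * phi s = 0 by move=> s1; rewrite phi0 ?mulr0.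
  rewrite -(half_line_window z).2; apply: eq_Rintegral => s.
  by rewrite inE /= in_itv/= => /andP[_ st]; rewrite /phi st mulrC.
exact: (@cvg_unique _ (@Rhausdorff R) _ _ _ _ L1 L2).
Qed.

(** The mass does not depend on a = 1 - e.  As e tends to 0,
    Gamma(e) sin (pi e) / pi = Gamma(1 + e) (sin (pi e) / (pi e)) tends to 1. *)
Lemma stable_mass1 : stable_mass nu = 1.
Proof.
have p0 := pi_gt0 R.
have h : (fun=> stable_mass nu) e @[e --> (0 : R)^'+] --> (1 : R).
  have c1 : euler_integral (1 + -1 * e) @[e --> 0^'+] --> (1 : R).
    by apply: euler_integral_cvg1; rewrite normrN1.
  have c2 : euler_integral (1 + 1 * e) @[e --> 0^'+] --> (1 : R).
    by apply: euler_integral_cvg1; rewrite normr1.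
  have c3 : (pi : R)^-1 * ((sin (pi * (0 + e)) - sin (pi * 0)) / e) @[e --> (0 : R)^'+] --> (pi : R)^-1 * (cos (pi * 0) * (pi * 1)).
    apply: cvgM; first exact: cvg_cst.
    apply: (has_deriv_cvg_right (f := fun e => sin (pi * e))).
    exact/has_deriv_sin/has_deriv_scale/has_deriv_id.
  rewrite mulr0 cos0 mul1r mulr1 mulVf ?gt_eqF// in c3.
  pose q e := (pi : R)^-1 * ((sin (pi * (0 + e)) - sin 0) / e).
  have c : euler_integral (1 + -1 * e) * euler_integral (1 + 1 * e) * q e @[e --> (0 : R)^'+] --> (1 * 1 * 1 : R).
    exact: (cvgM (cvgM c1 c2) c3).
  rewrite !mulr1 in c.
  apply: (cvg_right_eq ltr01 _ c) => e /andP[e0]; rewrite add0r => e1.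
  have e01 : 0 < 1 - e < 1 by rewrite subr_gt0 e1 ltrBlDr ltrDl.
  rewrite (stable_mass_reflection e01) /q.
  rewrite mulN1r mul1r subKr [1 + e]addrC euler_integralS// add0r sin0 subr0.
  have -> : sin (pi * (1 - e)) = sin (pi * e).
    by rewrite mulrBr mulr1 sinB sinpi cospi mul0r sub0r mulN1r opprK.
  have ne : e != 0 by rewrite gt_eqF.
  clear -ne; move: (euler_integral (1 - e)) (euler_integral e) (sin (pi * e)) ((pi : R)^-1) => A B C D.
  by field.
exact: (@cvg_unique _ (@Rhausdorff R) _ _ _ _ (cvg_cst _) h).
Qed.

End Reflection.

Section Mass.
Context {R : realType} (nu : R) (nu0 : 0 < nu) (nu2 : 2 * nu < 1).
Local Notation mu := (@lebesgue_measure R).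
Local Notation HL := [set` @Interval R (BRight 0%R) +oo%O].
Local Notation U := (wU nu).
Local Notation W := (wW nu).
Implicit Types (a b y t s r e : R).

(** Small y are covered by the bound at the angle pi, large y by wU_le_t,
    since (2 - b) / nu >= 3 for b <= 1 - nu and 2 nu < 1. *)
Lemma wU_decay b t1 t2 : b <= 1 - nu -> 0 < t1 -> exists2 C : R, 0 <= C &
  forall y t, 0 < y -> t1 <= t <= t2 -> `|U b y t| <= C * (1 + y) `^ (- (1 + 2)).
Proof.
move=> bnu t10; have n0 := nu0; have n2 := nu2; have b1 : b < 1 by lra.
have [C C0 HC] := wW_le nu0 nu2 b1; have [C' C'0 HC'] := wU_le_t nu0 nu2 b1.
pose K := C * t1 `^ (b - 1) * 2 `^ (1 + 2) + C' * `|t2| * 2 `^ (1 + 2).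
have K1 : 0 <= C * t1 `^ (b - 1) by rewrite mulr_ge0 ?powR_ge0.
have K2 : 0 <= C' * `|t2| by rewrite mulr_ge0.
have p2 : 0 <= (2 : R) `^ (1 + 2) by exact: powR_ge0.
exists K; first by rewrite /K addr_ge0// mulr_ge0.
move=> y t y0 /andP[t1t tt2]; have t0 : 0 < t by lra.
have y10 : 0 < 1 + y by lra.
rewrite powRN ler_pdivlMr ?powR_gt0//.
have [y1|y1] := leP y 1.
  rewrite -[leLHS]addr0; apply: lerD; last by rewrite mulr_ge0.
  apply: ler_pM; rewrite ?powR_ge0//.
    rewrite (wUW nu0 nu2)// (le_trans (HC _ _ (ltW y0) t0))// ler_wpM2l//.
    rewrite -[b - 1]opprB !powRN lef_pV2 ?posrE ?powR_gt0//.
    by apply: ge0_ler_powR; rewrite ?nnegrE; lra.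
  by apply: ge0_ler_powR; rewrite ?nnegrE; lra.
rewrite -[leLHS]add0r; apply: lerD; first by rewrite mulr_ge0.
have h := HC' y t y0 (ltW t0).
have e3 : 3 <= (2 - b) / nu by rewrite ler_pdivlMr//; lra.
have h2 : y `^ (- ((2 - b) / nu)) * (1 + y) `^ (1 + 2) <= 2 `^ (1 + 2).
  rewrite powRN mulrC ler_pdivrMr ?powR_gt0//.
  apply: (@le_trans _ _ ((2 * y) `^ (1 + 2))).
    by apply: ge0_ler_powR; rewrite ?nnegrE; lra.
  rewrite powRM ?(ltW y0)// ler_wpM2l//; apply: ler_powR; lra.
rewrite (le_trans (ler_wpM2r (powR_ge0 _ _) h))//.
rewrite -[leLHS]mulrA; apply: ler_pM => //.
- by rewrite mulr_ge0// ltW.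
- by rewrite mulr_ge0 ?powR_ge0.
- by rewrite ler_wpM2l// (le_trans tt2)// ler_norm.
Qed.

Lemma wU_y_continuous b y t : b < 1 -> 0 < y -> {for y, continuous (U b ^~ t)}.
Proof. by move=> b1 y0; apply: has_deriv_continuous; exact: (has_deriv_wU_y nu0 nu2). Qed.

Lemma integrable_wU_y b t : b <= 1 - nu -> 0 < t -> mu.-integrable HL (EFin \o (U b ^~ t)).
Proof.
move=> b1 t0; have n0 := nu0; have [C C0 HC] := wU_decay t b1 t0.
apply: (le_integrable_half_line (g := fun y => C * (1 + y) `^ (- (1 + 2)))).
- by apply: continuous_half_line_measurable => y; apply: wU_y_continuous; lra.
- by apply/integrableZ_half_line/integrable_powR_1D.
- by move=> y y0; apply: HC => //; rewrite lexx.
Qed.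

(** By t W_0 = nu y W_(1 - nu) and self-similarity, the measure
    U (1 - nu) y t dy is the image of U 0 1 s ds under s = t y^(- 1 / nu). *)
Lemma wU_mass t : 0 < t -> \int[mu]_(y in HL) U (1 - nu) y t = 1.
Proof.
move=> t0; have n0 := nu0; have n2 := nu2; have p01 := @ltr01 R.
have [B B0 HB] := wU_bounded nu0 nu2 p01 p01.
have cU : continuous (U 0 1) by move=> s; exact: (wU_continuous nu0 nu2).
have [dPhi PhiB] := half_line_primitive cU HB.
set Phi := fun u => _ in dPhi PhiB.
(* the change of variable; - Phi (k y) is a primitive of the kernel in y *)
pose k y := t * y `^ (- nu^-1).
have k0 y : 0 < y -> 0 < k y by move=> y0; rewrite mulr_gt0// powR_gt0.
have iN := integrable_wU_y (lexx (1 - nu)) t0.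
rewrite [RHS](_ : 1 = 0 - (- 1)); last by rewrite sub0r opprK.
apply: (@Rintegral_half_line _ _ (fun y => - Phi (k y))).
- move=> y y0; apply: has_deriv_eq.
    apply/has_deriv_opp/has_deriv_comp; first exact/dPhi/k0.
    exact/has_deriv_scale/has_deriv_powR_id.
  have e1 := wW0E nu0 nu2 (ltW y0) t0.
  rewrite -(wUW nu0 nu2)// -(wUW nu0 nu2)// in e1; last lra.
  have -> : U (1 - nu) y t = t * U 0 y t / (nu * y).
    by rewrite e1 mulrAC mulfV ?mul1r// gt_eqF// mulr_gt0.
  rewrite (wU_unit nu0 nu2 t p01 y0) subr0 powRr1 ?powR_ge0// powR_add// powR_inv1 ?(ltW y0)//.
  have ny : y != 0 by rewrite gt_eqF.
  have nn : nu != 0 by rewrite gt_eqF.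
  rewrite -/(k y); move: (U 0 1 (k y)) (y `^ (- nu^-1)) => A D.
  by clear -ny nn; field; rewrite ny nn.
- by move=> y y0; apply: wU_y_continuous => //; lra.
- exact: iN.
- apply: cvgN.
  pose w y s : R := if s < k y then 1 else 0.
  have E y : 0 < y < 0 + 1 -> \int[mu]_(s in HL) (w y s * U 0 1 s) = Phi (k y).
    move=> /andP[y0 _]; apply/esym.
    have wk s : k y <= s -> w y s * U 0 1 s = 0.
      by rewrite /w leNgt => /negbTE ->; rewrite mul0r.
    rewrite -(half_line_window wk).2 /Phi; apply: eq_Rintegral => s.
    by rewrite inE /= in_itv/= => /andP[_ sk]; rewrite /w sk mul1r.
  apply: (cvg_right_eq p01 E).
  rewrite -[X in _ --> X](stable_mass1 nu0 nu2).
  apply: (proj2 (@Rdominated_cvg_at_right R 0 1 HL _ _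
     (fun s => `|U 0 1 s|) ltr01 _ _ _ _ _)).
  + exact: measurable_itv.
  + move=> y /andP[y0 _]; apply: measurable_funM.
      by apply: measurable_fun_if => //; exact: measurable_fun_ltr.
    by apply: continuous_half_line_measurable => s _; exact: cU.
  + move=> s; rewrite /= in_itv/= andbT => s0; apply: cvg_near_cst.
    have d0 : 0 < (t / s) `^ nu by rewrite powR_gt0// divr_gt0.
    near=> y; have y0 : 0 < y by near: y; exact: nbhs_right_gt.
    have yd : y < (t / s) `^ nu by near: y; exact: nbhs_right_lt.
    have h : y `^ nu^-1 < t / s.
      have ts0 : 0 < t / s by rewrite divr_gt0.
      have <- : ((t / s) `^ nu) `^ nu^-1 = t / s.
        by rewrite -powRrM mulfV ?gt_eqF// powRr1// ltW.
      by apply: gt0_ltr_powR; rewrite ?invr_gt0// nnegrE ?powR_ge0// ltW.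
    by rewrite /w /k powRN ltr_pdivlMr ?powR_gt0// [s * _]mulrC -ltr_pdivlMr// h mul1r.
  + by apply: integrable_norm_half_line; exact: integrable_wU0.
  + move=> y s _ _; rewrite normrM -[leRHS]mul1r ler_wpM2r// /w.
    by case: ifP; rewrite ?normr1 ?normr0.
- rewrite -oppr0; apply: cvgN; apply: norm_cvg0.
  apply: (@squeeze_cvgr _ _ _ _ (cst 0) (fun y => B * t * y^-1)).
  + near=> y; have y1 : 1 <= y by near: y; exact: nbhs_pinfty_ge.
    have y0 : 0 < y by exact: lt_le_trans y1.
    rewrite normr_ge0/= (le_trans (PhiB _ (k0 _ y0)))// -mulrA ler_wpM2l// ler_wpM2l ?(ltW t0)//.
    rewrite -(powR_inv1 (ltW y0)); apply: ler_powR => //.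
    by rewrite lerN2 -[leLHS]invr1 lef_pV2 ?posrE//; lra.
  + exact: cvg_cst.
  + rewrite -(mulr0 (B * t)); apply: cvgM; [exact: cvg_cst|exact: cvg_inv_pinfty].
Unshelve. all: by end_near. Qed.

End Mass.

(** * The Mainardi function as a kernel *)

Section Trigonometric.
Context {R : realType}.
Implicit Types (a phi q s Q : R) (n k : nat).

Definition trig_term a phi q k : R := q ^+ k / k`!%:R * sin (a + phi *+ k).

(** The imaginary part of e^(i a) exp (q e^(i phi)), whose power series in q
    has the terms trig_term. *)
Definition trig_sum a phi q : R := expR (q * cos phi) * sin (a + q * sin phi).

Lemma has_deriv_trig_sum a phi q : has_deriv (trig_sum a phi) q (trig_sum (a + phi) phi q).
Proof.
apply: has_deriv_eq.
  apply: has_deriv_mul.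
    apply/has_deriv_expR/has_deriv_mul; [exact: has_deriv_id|exact: has_deriv_cst].
  apply/has_deriv_sin/has_deriv_add; first exact: has_deriv_cst.
  apply: has_deriv_mul; [exact: has_deriv_id|exact: has_deriv_cst].
rewrite /trig_sum (_ : a + phi + q * sin phi = (a + q * sin phi) + phi); last ring.
by rewrite [sin (_ + phi)]sinD; ring.
Qed.

Lemma has_deriv_trig_partial a phi q n :
  has_deriv (fun q => \sum_(k < n.+1) trig_term a phi q k) q
    (\sum_(k < n) trig_term (a + phi) phi q k).
Proof.
elim: n => [|n IHn].
  rewrite big_ord0; under eq_fun do rewrite big_ord1 /trig_term expr0; exact: has_deriv_cst.
rewrite big_ord_recr/=; under eq_fun do rewrite big_ord_recr/=.
apply: has_deriv_add; first exact: IHn.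
have -> : trig_term (a + phi) phi q n =
    (n.+1%:R * q ^+ n) * (n.+1`!%:R^-1 * sin (a + phi *+ n.+1)).
  rewrite /trig_term (mulrS phi n) addrA factS natrM invfM !mulrA; congr (_ * _).
  by rewrite [n.+1%:R * _]mulrC mulfK ?pnatr_eq0.
under eq_fun do rewrite /trig_term -mulrA.
apply: has_deriv_eq; first apply: has_deriv_mul; [|exact: has_deriv_cst|].
  exact: has_deriv_exprn.
by rewrite mulr0 addr0.
Qed.

Lemma trig_sum_at0 a phi n : trig_sum a phi 0 = \sum_(k < n.+1) trig_term a phi 0 k.
Proof.
rewrite big_ord_recl big1 /trig_sum /trig_term; last first.
  by move=> i _; rewrite /= expr0n /= !mul0r.
by rewrite /= !mul0r expR0 mulr0n !addr0 expr0 fact0 divr1.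
Qed.

(** Differentiation in q turns the remainder of order n + 1 into the one of
    order n with a replaced by a + phi. *)
Lemma trig_remainder_le_ge0 a phi Q n : 0 <= Q ->
  `|trig_sum a phi Q - \sum_(k < n) trig_term a phi Q k| <= expR Q * (Q ^+ n / n`!%:R).
Proof.
move=> Q0.
suff H b s : 0 <= s <= Q ->
    `|trig_sum b phi s - \sum_(k < n) trig_term b phi s k| <= expR Q * (s ^+ n / n`!%:R).
  by apply: H; rewrite Q0 lexx.
elim: n b s => [|n IHn] b s /andP[s0 sQ].
  rewrite big_ord0 subr0 expr0 fact0 divr1 mulr1 /trig_sum normrM ger0_norm ?expR_ge0//.
  rewrite -[leRHS]mulr1; apply: ler_pM => //; last exact: sin_max.
  rewrite ler_expR (le_trans (ler_norm _))// normrM ger0_norm// -[leRHS]mulr1.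
  by apply: ler_pM => //; exact: cos_max.
have [s00|sp] := eqVneq s 0.
  rewrite s00 -trig_sum_at0 subrr normr0.
  by rewrite mulr_ge0 ?expR_ge0// mulr_ge0 ?invr_ge0 ?exprn_ge0 ?ler0n.
have sgt0 : 0 < s by rewrite lt_neqAle eq_sym sp.
pose f u := trig_sum b phi u - \sum_(k < n.+1) trig_term b phi u k.
pose g u := expR Q * (u ^+ n.+1 / n.+1`!%:R).
apply: (@has_deriv_le _ f (fun u => trig_sum (b + phi) phi u - \sum_(k < n) trig_term (b + phi) phi u k)
   g (fun u => expR Q * (u ^+ n / n`!%:R)) s) => //.
- move=> u; apply: has_deriv_sub; [exact: has_deriv_trig_sum|exact: has_deriv_trig_partial].
- move=> u; apply: has_deriv_scale; apply: has_deriv_eq.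
    apply: has_deriv_mul; last exact: has_deriv_cst.
    exact: has_deriv_exprn.
  by rewrite mulr0 addr0 factS natrM invfM mulrA [n.+1%:R * _]mulrC mulfK ?pnatr_eq0.
- by rewrite /f -trig_sum_at0 subrr.
- by rewrite /g expr0n mul0r mulr0.
- by move=> u /andP[u0 us]; apply: IHn; rewrite (ltW u0) (le_trans (ltW us)).
Qed.

(** A negative q is a positive one with phi replaced by phi + pi. *)
Lemma trig_remainder_le a phi q n :
  `|trig_sum a phi q - \sum_(k < n) trig_term a phi q k| <= expR `|q| * (`|q| ^+ n / n`!%:R).
Proof.
have [q0|q0] := leP 0 q; first by rewrite (ger0_norm q0); exact: trig_remainder_le_ge0.
rewrite (ltr0_norm q0); have := @trig_remainder_le_ge0 a (phi + pi) (- q) n.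
rewrite oppr_ge0 => /(_ (ltW q0)); congr (`| _ - _ | <= _).
  by rewrite /trig_sum cosDpi sinDpi !mulrNN.
apply: eq_bigr => k _; rewrite /trig_term mulrnDl.
have sinDk x (m : nat) : sin (a + (x + pi *+ m)) = (-1) ^+ m * sin (a + x).
  elim: m => [|m IHm]; first by rewrite mulr0n addr0 expr0 mul1r.
  rewrite (_ : a + _ = a + (x + pi *+ m) + pi); last by rewrite mulrSr !addrA.
  by rewrite sinDpi IHm exprS mulN1r mulNr.
rewrite sinDk (exprNn q); have : (-1) ^+ k * (-1) ^+ k = 1 :> R by rewrite -exprMn mulrNN mulr1 expr1n.
move: ((-1) ^+ k) (q ^+ k) (sin _) (k`!%:R^-1) => e A B C ee.
by rewrite -[RHS]mul1r -ee; ring.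
Qed.

Lemma trig_series_cvg a phi q :
  \sum_(k < n) trig_term a phi q k @[n --> \oo] --> trig_sum a phi q.
Proof.
have h : expR `|q| * (`|q| ^+ n / n`!%:R) @[n --> \oo] --> expR `|q| * 0.
  by apply: cvgM; [exact: cvg_cst|exact: cvg_exp_coeff].
rewrite mulr0 in h.
apply/cvgrPdist_le => e e0; have /cvgrPdist_le/(_ _ e0) := h; apply: filterS => n.
rewrite sub0r normrN => hn; apply: le_trans hn.
by rewrite [leRHS]ger0_norm ?trig_remainder_le// (le_trans _ (trig_remainder_le a phi q n)).
Qed.

Lemma trig_partial_le a phi q n : `|\sum_(k < n) trig_term a phi q k| <= expR `|q|.
Proof.
apply: (le_trans (ler_norm_sum _ _ _)).
have -> : expR `|q| = limn (series (exp_coeff `|q|)) by [].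
apply: (@le_trans _ _ (series (exp_coeff `|q|) n)).
  rewrite /series /= big_mkord; apply: ler_sum => k _; rewrite /exp_coeff /trig_term.
  rewrite normrM -[leRHS]mulr1; apply: ler_pM => //; last exact: sin_max.
  by rewrite normrM normrX normfV (ger0_norm (ler0n _ _)).
apply: nondecreasing_cvgn_le; last exact: is_cvg_series_exp_coeff.
apply: nondecreasing_series => k _ _; exact: exp_coeff_ge0.
Qed.

End Trigonometric.

Section GammaReflection.
Context {R : realType}.
Implicit Types (a z s : R) (n : nat).

(** The two evaluations of the stable mass agree. *)
Lemma euler_reflection a : 0 < a < 1 ->
  euler_integral a * euler_integral (1 - a) * (sin (pi * a) / pi) = 1.
Proof.
(* any index below 1/2 can be used *)
move=> a01; have n0 : 0 < (4^-1 : R) by rewrite invr_gt0.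
have n2 : 2 * (4^-1 : R) < 1 by lra.
rewrite -[RHS](stable_mass1 n0 n2) (stable_mass_reflection n0 n2 a01).
by move: (euler_integral _) (euler_integral _) (sin _) (pi^-1) => A B C D; ring.
Qed.

Lemma euler_integral_neq0 z : 0 < z -> euler_integral z != 0.
Proof.
have H a : 0 < a < 1 -> euler_integral a != 0.
  move=> /euler_reflection h; apply/eqP => a0; move: h; rewrite a0 !mul0r.
  by move/esym/eqP; rewrite oner_eq0.
have K n z' : 0 < z' <= n.+1%:R -> euler_integral z' != 0.
  elim: n z' => [|n IHn] z' /andP[z0 zn].
    have [->|z1] := eqVneq z' 1; first by rewrite euler_integral1 oner_eq0.
    by apply: H; rewrite z0 lt_neqAle z1.
  have [z1|z1] := leP z' 1; first by apply: (IHn z'); rewrite z0 (le_trans z1)// ler1n.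
  rewrite -(subrK 1 z') euler_integralS ?subr_gt0// mulf_neq0//.
    by rewrite gt_eqF// subr_gt0.
  by apply: IHn; rewrite subr_gt0 z1 lerBlDr natr1.
move=> z0; apply: (K (Num.bound z)); rewrite z0/= (le_trans (ltW (archi_boundP (ltW z0))))//.
by rewrite ler_nat.
Qed.

Lemma euler_integralDn z n : 0 < z ->
  euler_integral (z + n%:R) = \prod_(i < n) (z + i%:R) * euler_integral z.
Proof.
move=> z0; elim: n => [|n IHn]; first by rewrite big_ord0 mul1r addr0.
rewrite big_ord_recr/= -natr1 addrA euler_integralS; last by rewrite ltr_wpDr.
by rewrite IHn mulrA; congr (_ * _); rewrite mulrC.
Qed.

(** Passing from z to z + 1 removes the factor z from the product, in
    accordance with Gamma(1 - z) = - z Gamma(- z) and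
    sin (pi (z + 1)) = - sin (pi z).  If z is a pole, the product and the sine
    vanish together. *)
Lemma Gamma_continuation z n : z < 1 -> 0 < z + n%:R ->
  \prod_(i < n) (z + i%:R) / euler_integral (z + n%:R) =
  euler_integral (1 - z) * (sin (pi * z) / pi).
Proof.
have pos z' n' : 0 < z' < 1 -> \prod_(i < n') (z' + i%:R) / euler_integral (z' + n'%:R) =
    euler_integral (1 - z') * (sin (pi * z') / pi).
  move=> z01; have /andP[z0 z1] := z01; have e0 := euler_integral_neq0 z0.
  have p0 : \prod_(i < n') (z' + i%:R) != 0.
    by apply/prodf_neq0 => i _; rewrite gt_eqF// ltr_wpDr.
  rewrite (euler_integralDn n' z0); apply: (mulfI e0).
  have h := euler_reflection z01; rewrite [RHS]mulrA h.
  by move: (\prod_(i < n') _) (euler_integral z') p0 e0 => P E P0 E0; field; rewrite P0 E0.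
elim: n z => [|n IHn] z z1 zn.
  by apply: pos; rewrite z1 andbT; rewrite addr0 in zn.
have [z0|z0|z0] := ltgtP z 0; last first.
- by rewrite z0 big_ord_recl addr0 !mul0r mulr0 sin0 mul0r mulr0.
- by apply: pos; rewrite z0.
rewrite big_ord_recl addr0 -[X in _ + X]natr1 [n%:R + 1]addrC addrA.
under eq_bigr => i _ do rewrite lift0 -natr1 [_ + 1]addrC addrA.
rewrite -mulrA IHn; first last.
- by move: zn; rewrite -natr1 [n%:R + 1]addrC addrA.
- by rewrite gtrDr.
rewrite mulrDr mulr1 sinDpi (_ : 1 - (z + 1) = - z); last ring.
rewrite (_ : 1 - z = - z + 1) ?euler_integralS ?oppr_gt0//; last ring.
by ring.
Qed.

Lemma invGamma_reflection s : 0 < s ->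
  (Gamma (1 - s))^-1 = euler_integral s * (sin (pi * s) / pi).
Proof.
move=> s0; have E : sin (pi * (1 - s)) = sin (pi * s).
  by rewrite mulrBr mulr1 sinB sinpi cospi mul0r sub0r mulN1r opprK.
have s1 : 1 - s < 1 by rewrite ltrBlDr ltrDl.
have G n := @Gamma_continuation (1 - s) n s1.
rewrite /Gamma; case: ifPn => h.
  by have := G 0%N; rewrite big_ord0 addr0 mul1r => /(_ h) ->; rewrite E subKr.
rewrite invf_div G ?E ?subKr//; have := unstable.ltrNbound (1 - s); lra.
Qed.

End GammaReflection.

Section Mainardi.
Context {R : realType} (nu : R) (nu0 : 0 < nu) (nu2 : 2 * nu < 1).
Local Notation mu := (@lebesgue_measure R).
Local Notation HL := [set` @Interval R (BRight 0%R) +oo%O].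
Local Notation W := (wW nu).
Implicit Types (q r z : R) (n k : nat).

(** The coefficients 1 / Gamma(1 - nu (k + 1)) are treated by the reflection
    formula, which covers the poles. *)
Lemma mainardi_termE z k : mainardi_term nu z k =
  (- z) ^+ k / k`!%:R * (euler_integral (nu + nu * k%:R) * (sin (pi * (nu + nu * k%:R)) / pi)).
Proof.
have n0 := nu0; rewrite /mainardi_term invfM -[RHS]mulrA; congr (_ * (_ * _)).
rewrite (_ : - nu * k%:R + 1 - nu = 1 - (nu + nu * k%:R)); last ring.
by apply: invGamma_reflection; rewrite ltr_wpDr// mulr_ge0 ?ler0n// ltW.
Qed.

(** The sum over k of the integrands that represent the terms of the series. *)
Definition euler_mainardi z r : R :=
  damp nu 1 0 (nu - 1) r * trig_sum (pi * nu) (pi * nu) (- z * r `^ nu).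

Definition mainardi_dominator z r : R := damp nu 1 0 (nu - 1) r * expR (`|z| * r `^ nu).

(** As nu < 1, the exponent |z| r^nu is at most r / 2 plus a constant. *)
Lemma integrable_mainardi_dominator z :
  mu.-integrable HL (EFin \o mainardi_dominator z).
Proof.
have n0 := nu0; have n2 := nu2; have n1 : -1 < nu - 1 by lra.
(* beyond S the exponent is at most r / 2 *)
pose S := (2 * `|z| + 1) `^ ((1 - nu)^-1).
have z1 : 0 < 2 * `|z| + 1 by rewrite ltr_wpDl// mulr_ge0.
have S0 : 0 < S by rewrite powR_gt0.
have H r : 0 < r -> `|z| * r `^ nu <= `|z| * S `^ nu + 2^-1 * r.
  move=> r0; have [rS|Sr] := leP r S.
    rewrite -[leLHS]addr0 lerD//; last by rewrite mulr_ge0// ltW.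
    by rewrite ler_wpM2l//; apply: ge0_ler_powR; rewrite ?nnegrE ?(ltW r0) ?(ltW S0) ?(ltW n0).
  rewrite -[leLHS]add0r lerD//; first by rewrite mulr_ge0 ?powR_ge0.
  have -> : r `^ nu = r * (r `^ (1 - nu))^-1.
    by rewrite -powRN opprB powR_add// powR_inv1 ?(ltW r0)// mulrCA mulfV ?mulr1// gt_eqF.
  have h : 2 * `|z| + 1 <= r `^ (1 - nu).
    have n1V : (1 - nu)^-1 * (1 - nu) = 1 by rewrite mulVf// gt_eqF//; lra.
    have -> : 2 * `|z| + 1 = S `^ (1 - nu) by rewrite /S -powRrM n1V powRr1// ltW.
    by apply: ge0_ler_powR; rewrite ?nnegrE ?powR_ge0 ?(ltW r0) ?(ltW Sr)//; lra.
  rewrite mulrCA mulrC ler_wpM2r ?(ltW r0)// ler_pdivrMr; last by rewrite (lt_le_trans z1).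
  by rewrite mulrC ler_pdivlMr//; lra.
apply: (le_integrable_half_line (g := fun r => expR (`|z| * S `^ nu) * damp nu 2^-1 0 (nu - 1) r)).
- apply: continuous_half_line_measurable => r r0; apply: cvgM; first exact: damp_continuous.
  apply: (has_deriv_continuous (f := fun r => expR (`|z| * r `^ nu))).
  exact/has_deriv_expR/has_deriv_scale/has_deriv_powR_id.
- by apply: integrableZ_half_line; apply: integrable_damp => //; lra.
move=> r r0; rewrite /mainardi_dominator ger0_norm; last by rewrite mulr_ge0 ?damp_ge0 ?expR_ge0.
rewrite /damp !mul0r !addr0 mul1r mulrCA -mulrA ler_wpM2l ?powR_ge0// -!expRD ler_expR.
by have := H r r0; lra.
Qed.

Lemma mainardi_partial z n :
  let P r := damp nu 1 0 (nu - 1) r * \sum_(k < n) trig_term (pi * nu) (pi * nu) (- z * r `^ nu) k in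
  mu.-integrable HL (EFin \o P) /\
  series (mainardi_term nu z) n = pi^-1 * \int[mu]_(r in HL) P r.
Proof.
have n0 := nu0; rewrite /series /= big_mkord.
elim: n => [|n [IHi IHn]].
  have Z : (fun r : R => damp nu 1 0 (nu - 1) r *
      \sum_(k < 0) trig_term (pi * nu) (pi * nu) (- z * r `^ nu) k) = cst 0.
    by apply/funext => r; rewrite big_ord0 mulr0.
  rewrite Z big_ord0; split; first exact: integrable0.
  by rewrite Rintegral_cst ?mul0r ?mulr0//; exact: measurable_itv.
pose Q r := (- z) ^+ n / n`!%:R * sin (pi * (nu + nu * n%:R)) *
  damp 1 1 0 (nu + nu * n%:R - 1) r.
have nn0 : 0 < nu + nu * n%:R by rewrite ltr_wpDr// mulr_ge0 ?ler0n// ltW.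
have iQ : mu.-integrable HL (EFin \o Q) by apply/integrableZ_half_line/integrable_euler.
have E r : 0 < r -> damp nu 1 0 (nu - 1) r * \sum_(k < n) trig_term (pi * nu) (pi * nu) (- z * r `^ nu) k + Q r =
  damp nu 1 0 (nu - 1) r * \sum_(k < n.+1) trig_term (pi * nu) (pi * nu) (- z * r `^ nu) k.
  move=> r0; rewrite big_ord_recr/= mulrDr; congr (_ + _).
  rewrite /Q /trig_term /damp !mul0r !addr0 exprMn -(powR_mulrn n (powR_ge0 r nu)) -powRrM.
  rewrite (_ : nu + nu * n%:R - 1 = (nu - 1) + nu * n%:R); last ring.
  rewrite powR_add// -(mulr_natr (pi * nu) n) (_ : pi * (nu + nu * n%:R) = pi * nu + pi * nu * n%:R); last ring.
  by move: (sin _) (expR _) (_ `^ _) (_ `^ _) (_ ^+ _) (_^-1) => *; ring.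
have iS := integrableD_half_line IHi iQ.
split.
  apply: (@eq_integrable _ _ _ mu HL _ _ _ _ iS) => //.
  by move=> r; rewrite inE /= in_itv/= andbT => r0; rewrite E.
rewrite big_ord_recr/= IHn -(eq_Rintegral_half_line E) RintegralD_half_line// mulrDr; congr (_ + _).
rewrite mainardi_termE /Q RintegralZ_half_line ?integrable_euler// -euler_integral_damp.
by move: (sin _) (euler_integral _) (_ ^+ _) (_`!%:R^-1) (pi^-1) => *; ring.
Qed.

(** The trigonometric series is summed under Euler's integral. *)
Lemma mainardi_cvg z : series (mainardi_term nu z) n @[n --> \oo] -->
  pi^-1 * \int[mu]_(r in HL) euler_mainardi z r.
Proof.
under eq_fun do rewrite (mainardi_partial z _).2.
apply: cvgM; first exact: cvg_cst.
apply: (proj2 (@Rdominated_cvg _ HL _ _ (mainardi_dominator z) _ _ _ _ _)).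
- exact: measurable_itv.
- by move=> n; apply: measurable_integrable; exact: (mainardi_partial z n).1.
- by move=> r _; apply: cvgM; [exact: cvg_cst|exact: trig_series_cvg].
- exact: integrable_mainardi_dominator.
- move=> n r; rewrite /= in_itv/= andbT => r0; rewrite normrM ger0_norm ?damp_ge0//.
  rewrite ler_wpM2l ?damp_ge0// (le_trans (trig_partial_le _ _ _ _))//.
  by rewrite normrM normrN (ger0_norm (powR_ge0 _ _)).
Qed.

Lemma mainardiE z : 0 <= z -> mainardi nu z = W (1 - nu) z 1.
Proof.
move=> z0; rewrite /mainardi (cvg_lim _ (@mainardi_cvg z))//.
congr (_ * _); apply: eq_Rintegral_half_line => r r0.
rewrite /euler_mainardi /trig_sum /damp /ray cospi sinpi mul0r addr0 mulrN1 opprK !mulr0 !mul0r subr0 addr0.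
rewrite (_ : - (1 - nu) = nu - 1); last ring.
rewrite subrK -mulrA [expR _ * (_ * _)]mulrA -expRD mulrA; congr (_ * expR _ * sin _); rewrite [nu * pi]mulrC; ring.
Qed.

End Mainardi.

(** * The potential of the initial values *)

Section InitialPotential.
Context {R : realType} (nu : R) (nu0 : 0 < nu) (nu2 : 2 * nu < 1).
Local Notation mu := (@lebesgue_measure R).
Local Notation HL := [set` @Interval R (BRight 0%R) +oo%O].
Local Notation U := (wU nu).
Local Notation W := (wW nu).
Context (k : R -> R) (B : R) (ck : continuous k) (kB : forall x, `|k x| <= B).
Implicit Types (a b x y t s r e : R).

Let B_ge0 : 0 <= B.
Proof. exact: le_trans (kB 0). Qed.

(** For b = 1 - nu, half the sum of the potentials at x and - x is the part of
    the solution due to the initial values, if lambda = 1 and k is the even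
    extension of f. *)
Definition potential b x t : R := \int[mu]_(y in HL) (U b y t * k (x - y)).
Local Notation A := potential.

Lemma shift_continuous x : continuous (fun y => k (x - y)).
Proof.
move=> y; apply: continuous_comp; last exact: ck.
by apply: cvgB; [exact: cvg_cst|exact: cvg_id].
Qed.

Lemma potential_integrand_continuous b x y t : b < 1 -> 0 < y ->
  {for y, continuous (fun y => U b y t * k (x - y))}.
Proof.
by move=> b1 y0; apply: cvgM; [exact: (wU_y_continuous nu0 nu2)|exact: shift_continuous].
Qed.

Lemma potential_dominated b t1 t2 : b <= 1 - nu -> 0 < t1 ->
  exists2 C : R, 0 <= C & forall x y t, 0 < y -> t1 <= t <= t2 ->
    `|U b y t * k (x - y)| <= C * (1 + y) `^ (- (1 + 2)).
Proof.
move=> b1 t10; have [C C0 HC] := wU_decay nu0 nu2 t2 b1 t10.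
exists (C * B); first by rewrite mulr_ge0.
by move=> x y t y0 tt; rewrite normrM mulrAC; apply: ler_pM => //; exact: HC.
Qed.

Lemma integrable_potential b x t : b <= 1 - nu -> 0 < t ->
  mu.-integrable HL (EFin \o (fun y => U b y t * k (x - y))).
Proof.
move=> b1 t0; have n0 := nu0; have [C C0 HC] := potential_dominated t b1 t0.
apply: (le_integrable_half_line (g := fun y => C * (1 + y) `^ (- (1 + 2)))).
- by apply: continuous_half_line_measurable => y; apply: potential_integrand_continuous; lra.
- by apply/integrableZ_half_line/integrable_powR_1D.
- by move=> y y0; apply: HC => //; rewrite lexx.
Qed.

Lemma has_deriv_potential_t b x t : b <= 1 - nu -> 0 < t ->
  has_deriv (A b x) t (A (b - 1) x t).
Proof.
move=> b1 t0; have n0 := nu0; have b2 : b - 1 <= 1 - nu by lra.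
have t20 : 0 < t / 2 by lra.
have [C C0 HC] := potential_dominated (2 * t) b2 t20.
apply: (@has_deriv_Rintegral _ HL (fun t y => U b y t * k (x - y))
  (fun t y => U (b - 1) y t * k (x - y)) (fun y => C * (1 + y) `^ (- (1 + 2))) t (t / 2) (2 * t)).
- exact: measurable_itv.
- by apply/andP; split; lra.
- by move=> s /andP[s0 _]; apply: integrable_potential => //; lra.
- move=> s y _; rewrite /= in_itv/= andbT => y0.
  apply: has_deriv_eq.
    apply: has_deriv_mul; last exact: has_deriv_cst.
    by apply: (has_deriv_wU_t nu0 nu2) => //; lra.
  by rewrite mulr0 addr0.
- by apply/integrableZ_half_line/integrable_powR_1D.
- move=> s y /andP[s0 s1]; rewrite /= in_itv/= andbT => y0.
  by apply: HC => //; apply/andP; split; lra.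
Qed.

(** As k is merely continuous, it is written as the derivative of F; an
    integration by parts transfers the derivative to the kernel, and the
    resulting integral of F can be differentiated.  The boundary term at y = 0
    is the local term. *)
Lemma has_deriv_potential_x b x t : b <= 1 - nu -> 0 < t ->
  has_deriv (A b ^~ t) x (W b 0 t * k x - A (b - nu) x t).
Proof.
move=> bn t0; have n0 := nu0; have n2 := nu2; have b1 : b < 1 by lra.
have bnn : b - nu <= 1 - nu by lra.
(* a primitive of k on ]-oo, c[ suffices, since only points near x matter *)
pose c := x + 1.
have ck' : continuous (fun s => k (c - s)) by exact: shift_continuous.
have kB' s : `|k (c - s)| <= B by exact: kB.
have [dG GB] := half_line_primitive ck' kB'.
set G := fun u : R => \int[mu]_(s in `]0, u[) k (c - s) in dG GB.
pose F z := - G (c - z).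
have dF z : z < c -> has_deriv F z (k z).
  move=> zc; apply: has_deriv_eq.
    apply/has_deriv_opp/has_deriv_comp; first by apply: dG; rewrite subr_gt0.
    by apply: has_deriv_sub; [exact: has_deriv_cst|exact: has_deriv_id].
  by rewrite sub0r mulrN1 opprK subKr.
have FB z : z < c -> `|F z| <= B * (c - z).
  by move=> zc; rewrite normrN GB// subr_gt0.
have dFy z y : z < c -> 0 < y -> has_deriv (fun y => F (z - y)) y (- k (z - y)).
  move=> zc y0; apply: has_deriv_eq.
    apply: has_deriv_comp; first by apply: dF; lra.
    by apply: has_deriv_sub; [exact: has_deriv_cst|exact: has_deriv_id].
  by rewrite sub0r mulrN1.
have [C C0 HC] := wU_decay nu0 nu2 t bn t0.
have [C' C'0 HC'] := wU_decay nu0 nu2 t bnn t0.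
have tt : t <= t <= t by rewrite lexx.
have F1 z y : z < c -> 0 < y -> `|F (z - y)| <= B * (c - z + 1) * (1 + y).
  move=> zc y0; have zy : z - y < c by lra.
  apply: (le_trans (FB _ zy)); rewrite -mulrA ler_wpM2l//; have : 0 <= (c - z) * y by rewrite mulr_ge0//; lra.
  lra.
have p12 y : 0 < y -> (1 + y) `^ (- (1 + 2)) * (1 + y) = (1 + y) `^ (- (1 + 1)).
  by move=> y0; rewrite -powR_addr1 ?addr_gt0//; congr (_ `^ _); ring.
have UF b' D z y : (forall y' t', 0 < y' -> t <= t' <= t -> `|U b' y' t'| <= D * (1 + y') `^ (- (1 + 2))) -> 0 <= D ->
    z < c -> 0 < y -> `|U b' y t * F (z - y)| <= D * (B * (c - z + 1)) * (1 + y) `^ (- (1 + 1)).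
  move=> HD D0 zc y0; rewrite normrM -p12// mulrACA; apply: ler_pM => //; first exact: HD.
  exact: F1.
have cUF b' z y : b' < 1 -> z < c -> 0 < y -> {for y, continuous (fun y => U b' y t * F (z - y))}.
  move=> b'1 zc y0; apply: cvgM; first exact: (wU_y_continuous nu0 nu2).
  exact: has_deriv_continuous (dFy _ _ zc y0).
have iUF z : z < c -> mu.-integrable HL (EFin \o (fun y => U (b - nu) y t * F (z - y))).
  move=> zc; apply: (le_integrable_half_line (g := fun y => C' * (B * (c - z + 1)) * (1 + y) `^ (- (1 + 1)))).
  - by apply: continuous_half_line_measurable => y y0; apply: cUF => //; lra.
  - by apply/integrableZ_half_line/integrable_powR_1D.
  - by move=> y y0; exact: UF.
have parts z : z < c -> A b z t = W b 0 t * F z - \int[mu]_(y in HL) (U (b - nu) y t * F (z - y)).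
  move=> zc; apply/eqP; rewrite eq_sym subr_eq -RintegralD_half_line//; last exact: iUF.
    apply/eqP/esym; apply: (eq_trans (y := 0 - - (W b 0 t * F z))); last by rewrite sub0r opprK.
    apply: (@Rintegral_half_line _ _ (fun y => - (U b y t * F (z - y)))).
    - move=> y y0; apply: has_deriv_eq.
        apply/has_deriv_opp/has_deriv_mul; last exact: dFy.
        exact: (has_deriv_wU_y nu0 nu2).
      rewrite -[LHS]/(- (- U (b - nu) y t * F (z - y) + U b y t * - k (z - y))).
      move: (U (b - nu) y t) (U b y t) (k (z - y)) (F (z - y)) => p q r s.
      by clear; ring.
    - move=> y y0; apply: cvgD; first exact: potential_integrand_continuous.
      by apply: cUF => //; lra.
    - by apply: integrableD_half_line; [exact: integrable_potential|exact: iUF].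
    - apply: cvgN; apply: cvgM.
        apply: (cvg_right_eq ltr01 _ (wW_cvg0 nu0 nu2 b1 t0)) => y /andP[y0 _].
        by rewrite (wUW nu0 nu2).
      have h : F (z - y) @[y --> 0^'+] --> F (z - 0).
        apply: cvg_at_right_filter; apply: (has_deriv_continuous (f := fun y => F (z - y))).
        apply: has_deriv_comp; first by apply: dF; lra.
        by apply: has_deriv_sub; [exact: has_deriv_cst|exact: has_deriv_id].
      by rewrite subr0 in h.
    - rewrite -oppr0; apply: cvgN; apply: norm_cvg0.
      pose D := C * (B * (c - z + 1)).
      have D0 : 0 <= D by rewrite mulr_ge0// mulr_ge0//; lra.
      apply: (@squeeze_cvgr _ _ _ _ (cst 0) (fun y => D * y^-1)).
      + near=> y; have y1 : 1 <= y by near: y; exact: nbhs_pinfty_ge.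
        have y0 : 0 < y by exact: lt_le_trans y1.
        rewrite normr_ge0/= (le_trans (UF _ _ _ _ HC C0 zc y0))// ler_wpM2l//.
        rewrite -(powR_inv1 (ltW y0)) !powRN lef_pV2 ?posrE ?powR_gt0 ?addr_gt0//.
        rewrite powRr1 ?(ltW y0)//; apply: (@le_trans _ _ (1 + y)); first lra.
        by rewrite -[leLHS]powRr1 ?ler_powR//; lra.
      + exact: cvg_cst.
      + rewrite -(mulr0 D); apply: cvgM; [exact: cvg_cst|exact: cvg_inv_pinfty].
  exact: integrable_potential.
have near_parts : \forall z \near x, A b z t = W b 0 t * F z - \int[mu]_(y in HL) (U (b - nu) y t * F (z - y)).
  near=> z; apply: parts; near: z; apply: lt_nbhsl; rewrite /c; lra.
apply: (has_deriv_near near_parts); apply: has_deriv_sub.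
  by apply/has_deriv_scale/dF; rewrite /c; lra.
apply: (@has_deriv_Rintegral _ HL (fun z y => U (b - nu) y t * F (z - y))
  (fun z y => U (b - nu) y t * k (z - y)) (fun y => C' * B * (1 + y) `^ (- (1 + 2))) x (x - 1) c).
- exact: measurable_itv.
- by rewrite /c; apply/andP; split; lra.
- by move=> z /andP[_ zc]; exact: iUF.
- move=> z y /andP[_ zc]; rewrite /= in_itv/= andbT => y0; apply: has_deriv_eq.
    apply/has_deriv_scale/has_deriv_comp; first by apply: dF; lra.
    by apply: has_deriv_sub; [exact: has_deriv_id|exact: has_deriv_cst].
  by rewrite subr0 mulr1.
- by apply/integrableZ_half_line/integrable_powR_1D.
- move=> z y _; rewrite /= in_itv/= andbT => y0.
  by rewrite normrM mulrAC; apply: ler_pM => //; exact: HC'.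
Unshelve. all: by end_near. Qed.

(** Self-similarity turns the kernel into a fixed density of mass 1 and the
    argument of k into x - t^nu y. *)
Lemma potential_cvg0 x : A (1 - nu) x t @[t --> 0^'+] --> k x.
Proof.
have n0 := nu0; have n2 := nu2; have b1 : 1 - nu < 1 by lra.
have i1 := integrable_wU_y nu0 nu2 (lexx (1 - nu)) ltr01.
(* rescale y by t^nu *)
have E t : 0 < t < 0 + 1 -> \int[mu]_(y in HL) (U (1 - nu) y 1 * k (x - t `^ nu * y)) = A (1 - nu) x t.
  move=> /andP[t0 _]; have tn : 0 < t `^ nu by rewrite powR_gt0.
  have tV : 0 < t^-1 by rewrite invr_gt0.
  rewrite /potential; have [iS ->] := Rintegral_scale_half_line tn (integrable_potential x (lexx (1 - nu)) t0).
  rewrite -RintegralZ_half_line//; apply: eq_Rintegral_half_line => y y0.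
  rewrite (wU_scale nu0 nu2 t b1 (mulr_gt0 tn y0) tV) mulfV ?gt_eqF// subKr.
  have e1 : t `^ nu * t^-1 `^ nu = 1.
    by rewrite -powRM ?(ltW t0) ?(ltW tV)// mulfV ?powR1// gt_eqF.
  by rewrite [t `^ nu * y * _]mulrAC e1 mul1r !mulrA e1 mul1r.
apply: (cvg_right_eq ltr01 E).
have m1 := wU_mass nu0 nu2 ltr01.
have -> : k x = \int[mu]_(y in HL) (U (1 - nu) y 1 * k x).
  under eq_Rintegral do rewrite mulrC.
  by rewrite RintegralZ_half_line// m1 mulr1.
apply: (proj2 (@Rdominated_cvg_at_right R 0 1 HL _ _
     (fun y => B * `|U (1 - nu) y 1|) ltr01 _ _ _ _ _)).
- exact: measurable_itv.
- move=> t /andP[t0 _]; apply: continuous_half_line_measurable => y y0.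
  apply: cvgM; first exact: (wU_y_continuous nu0 nu2).
  apply: (continuous_comp (f := fun y => x - t `^ nu * y)); last exact: ck.
  by apply: cvgB; [exact: cvg_cst|apply: cvgM; [exact: cvg_cst|exact: cvg_id]].
- move=> y _; apply: cvgM; first exact: cvg_cst.
  have h : x - t `^ nu * y @[t --> 0^'+] --> x - 0 * y.
    apply: cvgB; first exact: cvg_cst.
    by apply: cvgM; [exact: powR_cvg0|exact: cvg_cst].
  rewrite mul0r subr0 in h.
  by apply: (@continuous_cvg _ _ _ (0 : R)^'+ _ _ k); [exact: ck|exact: h].
- by apply/integrableZ_half_line/integrable_norm_half_line.
- move=> t y _ _; rewrite normrM mulrC; apply: ler_pM => //; exact: kB.
Qed.

End InitialPotential.

Section KernelMeasurability.
Context {R : realType} (nu : R) (nu0 : 0 < nu) (nu2 : 2 * nu < 1).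
Local Notation mu := (@lebesgue_measure R).
Local Notation HL := [set` @Interval R (BRight 0%R) +oo%O].
Local Notation mR := (measurableTypeR R).
Local Notation U := (wU nu).
Implicit Types (a b y t s : R).

Lemma wU_time_unit b y t : b < 1 -> 0 < y -> 0 < t ->
  U b y t = t `^ (b - 1) * U b (y * t `^ (- nu)) 1.
Proof.
move=> b1 y0 t0; have tV : 0 < t^-1 by rewrite invr_gt0.
have tt : t * t^-1 = 1 by rewrite mulfV// gt_eqF.
have e (p : R) : t^-1 `^ p = t `^ (- p) by rewrite -(powR_inv1 (ltW t0)) -powRrM mulN1r.
by apply: (eq_trans (wU_scale nu0 nu2 t b1 y0 tV)); rewrite !e tt opprB.
Qed.

(** By self-similarity the kernel is a power times a continuous function of
    one variable. *)
Lemma measurable_wU d (S : measurableType d) (D : set S) (p q : S -> mR) b : b < 1 ->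
  measurable D -> measurable_fun D p -> measurable_fun D q ->
  (forall z, D z -> 0 < p z) -> (forall z, D z -> 0 < q z) ->
  measurable_fun D (fun z => U b (p z) (q z)).
Proof.
move=> b1 mD mp mq p0 q0.
have mqX (c : R) : measurable_fun D (fun z => q z `^ c).
  exact: (measurableT_comp (measurable_powR c) mq).
pose f (z : S) : mR := q z `^ (b - 1) * U b (p z * q z `^ (- nu)) 1.
have mf : measurable_fun D f.
  apply: measurable_funM; first exact: mqX.
  apply: (measurable_comp (F := HL) (f := U b ^~ 1) (g := fun z => p z * q z `^ (- nu))).
  - exact: measurable_itv.
  - by move=> _ [z Dz <-]; rewrite /= in_itv/= andbT mulr_gt0 ?p0// powR_gt0 ?q0.
  - by apply: continuous_half_line_measurable => y y0; exact: (wU_y_continuous nu0 nu2).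
  - by apply: measurable_funM.
apply: eq_measurable_fun mf => z; rewrite inE => Dz.
by rewrite [RHS]wU_time_unit ?p0 ?q0.
Qed.

(** A majorant that is a product of functions of t and y.  Compared with the
    scaling power t^(b - 1) it gains t^(nu / 2), from the singularity
    y^(- 1/2) of dom. *)
Lemma wU_decay_self b t0 : b <= 1 - nu -> 0 < t0 -> exists2 C : R, 0 <= C &
  forall y t, 0 < y -> 0 < t <= t0 -> `|U b y t| <= C * t `^ (b - 1 + nu / 2) * dom 2^-1 y.
Proof.
move=> bn t00; have n0 := nu0; have n2 := nu2; have b1 : b < 1 by lra.
have [C C0 HC] := wU_decay nu0 nu2 1 bn ltr01.
pose c := Num.min 1 (t0 `^ (- nu)).
have c0 : 0 < c by rewrite lt_min ltr01 powR_gt0.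
have hp : 0 <= (2^-1 + 1 : R) by lra.
exists (C * c `^ (- (2^-1 + 1))); first by rewrite mulr_ge0 ?powR_ge0.
move=> y t y0 /andP[t_0 tt0]; rewrite wU_time_unit// normrM ger0_norm ?powR_ge0//.
pose z := y * t `^ (- nu); have tn : 0 < t `^ (- nu) by rewrite powR_gt0.
have z0 : 0 < z by rewrite mulr_gt0.
(* give up all decay in z except the one of dom *)
have h1 : (1 + z) `^ (- (1 + 2)) <= z `^ (2^-1 - 1) * (1 + z) `^ (- (2^-1 + 1)).
  have -> : (1 + z) `^ (- (1 + 2)) = (1 + z) `^ (- (2 - 2^-1)) * (1 + z) `^ (- (2^-1 + 1)).
    by rewrite -powR_add ?addr_gt0//; congr (_ `^ _); ring.
  rewrite ler_wpM2r ?powR_ge0// -[2^-1 - 1]opprB !powRN lef_pV2 ?posrE ?powR_gt0 ?addr_gt0//.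
  apply: (@le_trans _ _ ((1 + z) `^ (1 - 2^-1))).
    by apply: ge0_ler_powR; rewrite ?nnegrE; lra.
  by apply: ler_powR; lra.
have h2 : c * (1 + y) <= 1 + z.
  rewrite mulrDr mulr1 lerD//; first by rewrite ge_min lexx.
  rewrite /z mulrC ler_wpM2l ?(ltW y0)// ge_min; apply/orP; right.
  by rewrite !powRN lef_pV2 ?posrE ?powR_gt0//; apply: ge0_ler_powR; rewrite ?nnegrE; lra.
have h3 : (1 + z) `^ (- (2^-1 + 1)) <= c `^ (- (2^-1 + 1)) * (1 + y) `^ (- (2^-1 + 1)).
  rewrite -powRM ?(ltW c0) ?addr_ge0 ?(ltW y0)//.
  rewrite !powRN lef_pV2 ?posrE ?powR_gt0 ?mulr_gt0 ?addr_gt0//.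
  by apply: ge0_ler_powR; rewrite ?nnegrE ?mulr_ge0 ?addr_ge0 ?(ltW z0) ?(ltW c0) ?(ltW y0).
have h4 : z `^ (2^-1 - 1) = y `^ (2^-1 - 1) * t `^ (nu / 2).
  rewrite powRM ?(ltW y0) ?(ltW tn)// -powRrM; congr (_ * _ `^ _); lra.
apply: (@le_trans _ _ (t `^ (b - 1) * (C * (z `^ (2^-1 - 1) * (c `^ (- (2^-1 + 1)) * (1 + y) `^ (- (2^-1 + 1))))))).
  rewrite ler_wpM2l ?powR_ge0//.
  apply: (le_trans (HC z 1 z0 _)); first by rewrite lexx.
  rewrite ler_wpM2l// (le_trans h1)// ler_wpM2l ?powR_ge0//.
rewrite h4 /dom (powR_add (b - 1) (nu / 2) t_0) le_eqVlt; apply/orP; left; apply/eqP.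
move: (t `^ (b - 1)) (t `^ (nu / 2)) (y `^ (2^-1 - 1)) (c `^ _) ((1 + y) `^ _) => p q u v w.
by clear; ring.
Qed.

End KernelMeasurability.

Section PotentialCaputo.
Context {R : realType} (nu : R) (nu0 : 0 < nu) (nu2 : 2 * nu < 1).
Local Notation mu := (@lebesgue_measure R).
Local Notation HL := [set` @Interval R (BRight 0%R) +oo%O].
Local Notation OO e t := [set` @Interval R (BRight e) (BLeft t)].
Local Notation mR := (measurableTypeR R).
Local Notation U := (wU nu).
Local Notation W := (wW nu).
Context (k : R -> R) (B : R) (ck : continuous k) (kB : forall x, `|k x| <= B).
Local Notation A := (potential nu k).
Implicit Types (a b x y t s r e : R).

(** Subtracting from the weight its value at s = 0 gains a factor s, needed
    because the time derivative of the potential is of order 1 / s. *)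
Lemma caputo_weight_le t s : 0 < s < t ->
  0 <= (t - s) `^ (- (2 * nu)) - t `^ (- (2 * nu)) <= (t - s) `^ (- (2 * nu)) * (s / t).
Proof.
move=> /andP[s0 st]; have n0 := nu0; have n2 := nu2.
have ts0 : 0 < t - s by lra.
have t0 : 0 < t by lra.
apply/andP; split.
  rewrite subr_ge0 !powRN lef_pV2 ?posrE ?powR_gt0//.
  by apply: ge0_ler_powR; rewrite ?nnegrE; lra.
have h : (t - s) `^ (- (2 * nu)) * ((t - s) / t) <= t `^ (- (2 * nu)).
  rewrite mulrA ler_pdivrMr// -!powR_addr1//.
  by apply: ge0_ler_powR; rewrite ?nnegrE; lra.
move: h; rewrite mulrBl mulfV ?gt_eqF// mulrBr mulr1; lra.
Qed.

(** The two endpoint singularities are separated at t / 2. *)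
Lemma integrable_beta t : 0 < t ->
  mu.-integrable (OO 0 t) (EFin \o (fun s => (t - s) `^ (- (2 * nu)) * s `^ (- nu / 2))).
Proof.
move=> t0; have n0 := nu0; have n2 := nu2; have t20 : 0 < t / 2 by lra.
have mO : measurable (OO 0 t) by exact: measurable_itv.
have i1 : mu.-integrable (OO 0 t) (EFin \o (fun s => s `^ (1 - nu / 2 - 1))).
  by apply: integrable_powR_window => //; lra.
have i2 : mu.-integrable (OO 0 t) (EFin \o (fun s => (t - s) `^ (1 - 2 * nu - 1))).
  have a0 : 0 < 1 - 2 * nu by lra.
  exact: (Rintegral_window_reflect (integrable_powR_window a0 t0)).1.
apply: (@Rle_integrable _ _ _ (fun s => (t / 2) `^ (- (2 * nu)) * s `^ (1 - nu / 2 - 1) +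
   (t / 2) `^ (- nu / 2) * (t - s) `^ (1 - 2 * nu - 1)) mO).
- apply: measurable_funM; apply: measurable_funTS.
    by apply: (measurableT_comp (measurable_powR _)); exact: measurable_funB.
  exact: measurable_powR.
- by apply: RintegrableD => //; apply: RintegrableZ.
move=> s; rewrite /= in_itv/= => /andP[s0 st].
rewrite ger0_norm ?mulr_ge0 ?powR_ge0//.
rewrite (_ : 1 - nu / 2 - 1 = - nu / 2); last lra.
rewrite (_ : 1 - 2 * nu - 1 = - (2 * nu)); last lra.
have dec (p u v : R) : 0 <= p -> 0 < u -> u <= v -> v `^ (- p) <= u `^ (- p).
  move=> p0 u0 uv; rewrite !powRN lef_pV2 ?posrE ?powR_gt0//; last exact: lt_le_trans uv.
  by apply: ge0_ler_powR; rewrite ?nnegrE// ltW// (lt_le_trans u0).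
have [s2|s2] := leP s (t / 2).
  rewrite -[leLHS]addr0 lerD ?mulr_ge0 ?powR_ge0//.
  by rewrite ler_wpM2r ?powR_ge0//; apply: dec; lra.
rewrite -[leLHS]add0r lerD ?mulr_ge0 ?powR_ge0//.
rewrite mulrC ler_wpM2r ?powR_ge0//.
rewrite (_ : - nu / 2 = - (nu / 2)); last lra.
by apply: dec; lra.
Qed.

(** With the corrected weight the exchange of the integrals is legitimate;
    the inner integrals are convolutions with s^(- 2 nu) and with 1. *)
Lemma potential_window_swap x t : 0 < t ->
  mu.-integrable (OO 0 t) (EFin \o (fun s =>
    ((t - s) `^ (- (2 * nu)) - t `^ (- (2 * nu))) * A (- nu) x s)) /\
  \int[mu]_(s in OO 0 t) (((t - s) `^ (- (2 * nu)) - t `^ (- (2 * nu))) * A (- nu) x s) =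
  euler_integral (1 - 2 * nu) * A (1 - 3 * nu) x t - t `^ (- (2 * nu)) * A (1 - nu) x t.
Proof.
move=> t0; have n0 := nu0; have n2 := nu2.
have mO : measurable (OO 0 t) by exact: measurable_itv.
have mHL : measurable HL by exact: measurable_itv.
have bn : - nu <= 1 - nu by lra.
have b1 : - nu < 1 by lra.
have b3 : 1 - 3 * nu <= 1 - nu by lra.
have a0 : 0 < 1 - 2 * nu by lra.
have ab1 : 1 - 2 * nu + - nu < 1 by lra.
have ab2 : 1 + - nu < 1 by lra.
have ea : 1 - 2 * nu - 1 = - (2 * nu) by ring.
have eab : 1 - 2 * nu + - nu = 1 - 3 * nu by ring.
have [C C0 HC] := wU_decay_self nu0 nu2 bn t0.
pose K s := (t - s) `^ (- (2 * nu)) - t `^ (- (2 * nu)).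
have B0 : 0 <= B by exact: le_trans (kB 0).
have h12 : 0 < (2^-1 : R) by lra.
have inner s : 0 < s -> \int[mu]_(y in HL) (K s * (U (- nu) y s * k (x - y))) = K s * A (- nu) x s.
  by move=> s0; rewrite RintegralZ_half_line//; exact: (integrable_potential nu0 nu2 ck kB).
have mK : measurable_fun setT K.
  apply: measurable_funB => //.
  by apply: (measurableT_comp (measurable_powR _)); exact: measurable_funB.
have mF : measurable_fun (OO 0 t `*` HL : set (mR * mR))
    (fun z : mR * mR => K z.1 * (U (- nu) z.2 z.1 * k (x - z.2))).
  apply: measurable_funM.
    by apply: measurable_funTS; apply: (measurableT_comp mK); exact: measurable_fst.
  apply: measurable_funM; last first.
    apply: measurable_funTS; apply: (measurableT_comp (f := fun y => k (x - y))).
      by apply: continuous_measurable_fun; exact: shift_continuous.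
    exact: measurable_snd.
  apply: (@measurable_wU R nu nu0 nu2 _ (mR * mR)%type (OO 0 t `*` HL) snd fst _ b1).
  - by apply: measurableX.
  - by apply: measurable_funTS; exact: measurable_snd.
  - by apply: measurable_funTS; exact: measurable_fst.
  - by move=> z [_]; rewrite /= in_itv/= andbT.
  - by move=> z [/=]; rewrite in_itv/= => /andP[].
have ig : mu.-integrable (OO 0 t) (EFin \o (fun s => C * B * t^-1 * ((t - s) `^ (- (2 * nu)) * s `^ (- nu / 2)))).
  by apply: RintegrableZ => //; exact: integrable_beta.
have bnd s y : OO 0 t s -> HL y -> `|K s * (U (- nu) y s * k (x - y))| <=
    C * B * t^-1 * ((t - s) `^ (- (2 * nu)) * s `^ (- nu / 2)) * dom 2^-1 y.
  rewrite /= !in_itv/= andbT => st y0; have /andP[s0 s1] := st.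
  have /andP[K0 K1] := caputo_weight_le st.
  have hU : `|U (- nu) y s| <= C * s `^ (- nu - 1 + nu / 2) * dom 2^-1 y.
    by apply: HC => //; rewrite s0 ltW.
  have e1 : s `^ (- nu - 1 + nu / 2) * s = s `^ (- nu / 2).
    by rewrite -powR_addr1//; congr (_ `^ _); lra.
  rewrite normrM (ger0_norm K0) normrM.
  apply: (@le_trans _ _ ((t - s) `^ (- (2 * nu)) * (s / t) * (C * s `^ (- nu - 1 + nu / 2) * dom 2^-1 y * B))).
    by apply: ler_pM => //; apply: ler_pM => //; exact: kB.
  rewrite -e1 le_eqVlt; apply/orP; left; apply/eqP.
  move: (_ `^ _) (s `^ _) (dom _ _) (t^-1) => p q r u; clear; ring.
have [iF eF] := Rfubini mO mHL mF ig (integrable_dom h12) bnd.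
have EK s : OO 0 t s -> \int[mu]_(y in HL) (K s * (U (- nu) y s * k (x - y))) = K s * A (- nu) x s.
  by rewrite /= in_itv/= => /andP[s0 _]; exact: inner.
split.
  by apply: (@eq_integrable _ _ _ mu) iF => // s; rewrite inE => /EK /= ->.
transitivity (\int[mu]_(s in OO 0 t) (\int[mu]_(y in HL) (K s * (U (- nu) y s * k (x - y))))).
  by apply: eq_Rintegral => s; rewrite inE => /EK ->.
rewrite eF.
have i1 : mu.-integrable HL (EFin \o (fun y => U (1 - 3 * nu) y t * k (x - y))).
  exact: (integrable_potential nu0 nu2 ck kB).
have i2 : mu.-integrable HL (EFin \o (fun y => U (1 - nu) y t * k (x - y))).
  exact: (integrable_potential nu0 nu2 ck kB).
transitivity (\int[mu]_(y in HL) (euler_integral (1 - 2 * nu) * (U (1 - 3 * nu) y t * k (x - y)) -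
    t `^ (- (2 * nu)) * (U (1 - nu) y t * k (x - y)))); last first.
  rewrite RintegralB_half_line; [|exact: integrableZ_half_line|exact: integrableZ_half_line].
  by rewrite !RintegralZ_half_line.
apply: eq_Rintegral_half_line => y y0.
have [c1 j1] := wU_convolution_window nu0 nu2 t a0 ab1 y0.
have [c2 j2] := wU_convolution_window nu0 nu2 t ltr01 ab2 y0.
transitivity (\int[mu]_(s in OO 0 t) (k (x - y) * ((t - s) `^ (1 - 2 * nu - 1) * U (- nu) y s) -
   k (x - y) * t `^ (- (2 * nu)) * ((t - s) `^ (1 - 1) * U (- nu) y s))).
  apply: eq_Rintegral => s _; rewrite subrr powRr0 /K ea.
  by move: (U _ _ _) (k _) (_ `^ _) (_ `^ _) => *; ring.
rewrite (@RintegralB _ _ _ mu _ _ _ mO (RintegrableZ _ mO j1) (RintegrableZ _ mO j2)).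
rewrite (@RintegralZl _ _ _ mu _ _ _ mO j1) (@RintegralZl _ _ _ mu _ _ _ mO j2) c1 c2.
rewrite euler_integral1 eab.
by move: (U _ _ _) (U _ _ _) (k _) (_ `^ _) (euler_integral _) => *; ring.
Qed.

(** The full weight is the corrected one plus t^(- 2 nu).  The latter
    integrates to the increment of the potential over [e, t], and this is where
    the initial value k x enters. *)
Lemma caputo_potential x t : 0 < t ->
  (forall e, 0 < e < t -> mu.-integrable (OO e t)
    (EFin \o (fun s => (t - s) `^ (- (2 * nu)) * A (- nu) x s))) /\
  \int[mu]_(s in OO e t) ((t - s) `^ (- (2 * nu)) * A (- nu) x s) @[e --> 0^'+] -->
  euler_integral (1 - 2 * nu) * A (1 - 3 * nu) x t - t `^ (- (2 * nu)) * k x.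
Proof.
move=> t0; have n0 := nu0; have n2 := nu2; have bn : - nu <= 1 - nu by lra.
have e3 (p q r v : R) : p - q * v = p - q * r + q * (r - v) by ring.
have [iJ eJ] := potential_window_swap x t0.
have dA s : 0 < s -> has_deriv (A (1 - nu) x) s (A (- nu) x s).
  move=> s0; apply: has_deriv_eq; first exact: (has_deriv_potential_t nu0 nu2 ck kB _ (lexx _) s0).
  by congr (A _ x s); ring.
have cA s : 0 < s -> {for s, continuous (A (- nu) x)}.
  move=> s0; apply: has_deriv_continuous; exact: (has_deriv_potential_t nu0 nu2 ck kB _ bn s0).
have iA e : 0 < e < t -> mu.-integrable (OO e t) (EFin \o A (- nu) x).
  move=> /andP[e0 et]; apply: (@integrableS _ _ _ mu `[e, t]); [exact: measurable_itv|exact: measurable_itv| |].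
    exact: subset_itv_oo_cc.
  apply: continuous_compact_integrable; first exact: segment_compact.
  apply: continuous_in_subspaceT => s; rewrite inE/= in_itv/= => /andP[es _].
  by apply: cA; exact: lt_le_trans es.
have iJe e : 0 < e < t -> mu.-integrable (OO e t) (EFin \o (fun s =>
    ((t - s) `^ (- (2 * nu)) - t `^ (- (2 * nu))) * A (- nu) x s)).
  move=> /andP[e0 et]; apply: (@integrableS _ _ _ mu (OO 0 t)); [exact: measurable_itv|exact: measurable_itv| |exact: iJ].
  by move=> s /=; rewrite !in_itv/= => /andP[es ->]; rewrite (lt_trans e0).
have E s : (t - s) `^ (- (2 * nu)) * A (- nu) x s =
    ((t - s) `^ (- (2 * nu)) - t `^ (- (2 * nu))) * A (- nu) x s + t `^ (- (2 * nu)) * A (- nu) x s.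
  by ring.
split.
  move=> e et; have mO : measurable (OO e t) by exact: measurable_itv.
  have := RintegrableD mO (iJe _ et) (RintegrableZ (t `^ (- (2 * nu))) mO (iA _ et)).
  by apply: (@eq_integrable _ _ _ mu) => // s _; rewrite /= E.
have lim : \int[mu]_(s in OO e t) (((t - s) `^ (- (2 * nu)) - t `^ (- (2 * nu))) * A (- nu) x s) +
    t `^ (- (2 * nu)) * (A (1 - nu) x t - A (1 - nu) x e) @[e --> 0^'+] -->
    (euler_integral (1 - 2 * nu) * A (1 - 3 * nu) x t - t `^ (- (2 * nu)) * A (1 - nu) x t) +
    t `^ (- (2 * nu)) * (A (1 - nu) x t - k x).
  apply: cvgD; first by rewrite -eJ; exact: Rintegral_cvg_left.
  apply: cvgM; first exact: cvg_cst.
  by apply: cvgB; [exact: cvg_cst|exact: (potential_cvg0 nu0 nu2 ck kB)].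
rewrite (e3 _ _ (A (1 - nu) x t)).
apply: (cvg_right_eq t0 _ lim) => e; rewrite add0r => et; have /andP[e0 et'] := et.
have mO : measurable (OO e t) by exact: measurable_itv.
under [RHS]eq_Rintegral do rewrite E.
rewrite (@RintegralD _ _ _ mu _ _ _ mO (iJe _ et) (RintegrableZ _ mO (iA _ et))); congr (_ + _).
rewrite (@RintegralZl _ _ _ mu _ _ _ mO (iA _ et)); congr (_ * _).
by apply/esym/(Rintegral_FTC et') => s /andP[es _]; [apply: dA|apply: cA]; exact: lt_le_trans es.
Qed.

End PotentialCaputo.

(** * The potential of the boundary flux *)

Section BoundaryPotential.
Context {R : realType} (nu : R) (nu0 : 0 < nu) (nu2 : 2 * nu < 1).
Local Notation mu := (@lebesgue_measure R).
Local Notation HL := [set` @Interval R (BRight 0%R) +oo%O].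
Local Notation OO e t := [set` @Interval R (BRight e) (BLeft t)].
Local Notation mR := (measurableTypeR R).
Local Notation U := (wU nu).
Context (g : R -> R) (G S : R).
Context (mg : measurable_fun (OO 0 S) g) (gG : forall s, 0 < s < S -> `|g s| <= G).
Implicit Types (a b x y t s r e : R).

(** By causality the integral over ]0, t[ may be taken over a fixed interval
    ]0, S[ with S >= t, which makes the differentiation in t free of boundary
    terms. *)
Definition boundary_potential b y t : R := \int[mu]_(s in OO 0 S) (U b y (t - s) * g s).
Local Notation V := boundary_potential.

Lemma integrable_window (D : R) (f : R -> R) : measurable_fun (OO 0 S) f ->
  (forall s, 0 < s < S -> `|f s| <= D) -> mu.-integrable (OO 0 S) (EFin \o f).
Proof.
move=> mf fD; apply: (@Rle_integrable _ _ _ (cst D) (measurable_itv _) mf).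
  apply: (@integrableS _ _ _ mu `[0, S]); [exact: measurable_itv|exact: measurable_itv| |].
    exact: subset_itv_oo_cc.
  apply: continuous_compact_integrable; first exact: segment_compact.
  by apply: continuous_subspaceT => s; exact: cvg_cst.
by move=> s; rewrite /= in_itv/=; exact: fD.
Qed.

Lemma integrable_cst_window (D : R) : mu.-integrable (OO 0 S) (EFin \o (fun=> D)).
Proof. by apply: (@integrable_window `|D|). Qed.

Lemma measurable_boundary_integrand b y t : b < 1 -> 0 < y ->
  measurable_fun (OO 0 S) (fun s => U b y (t - s) * g s).
Proof.
move=> b1 y0; apply: measurable_funM => //; apply: measurable_funTS.
apply: (measurableT_comp (f := U b y)); last exact: measurable_funB.
by apply: continuous_measurable_fun => s; exact: (wU_continuous nu0 nu2).
Qed.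

Lemma boundary_integrand_le b y t (C : R) s : `|U b y (t - s)| <= C -> 0 < s < S ->
  `|U b y (t - s) * g s| <= C * G.
Proof. by move=> UC s0S; rewrite normrM; apply: ler_pM => //; exact: gG. Qed.

Lemma integrable_boundary_integrand b y t : b < 1 -> 0 < y ->
  mu.-integrable (OO 0 S) (EFin \o (fun s => U b y (t - s) * g s)).
Proof.
move=> b1 y0; have [C C0 HC] := wU_bounded nu0 nu2 b1 y0.
apply: (@integrable_window (C * G)); first exact: measurable_boundary_integrand.
by move=> s; apply: boundary_integrand_le; exact: HC.
Qed.

Lemma has_deriv_boundary_potential_t b y t : b < 1 -> 0 < y ->
  has_deriv (V b y) t (V (b - 1) y t).
Proof.
move=> b1 y0; have b2 : b - 1 < 1 by lra.
have [C C0 HC] := wU_bounded nu0 nu2 b2 y0.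
apply: (@has_deriv_Rintegral _ _ (fun t s => U b y (t - s) * g s)
  (fun t s => U (b - 1) y (t - s) * g s) (fun=> C * G) t (t - 1) (t + 1)).
- exact: measurable_itv.
- by rewrite ltrBlDr ltrDl ltr01.
- by move=> r _; exact: integrable_boundary_integrand.
- move=> r s _ _; apply: has_deriv_eq.
    apply: has_deriv_mul; last exact: has_deriv_cst.
    apply: (has_deriv_comp (f := U b y)); first exact: (has_deriv_wU_t nu0 nu2).
    by apply: has_deriv_sub; [exact: has_deriv_id|exact: has_deriv_cst].
  by rewrite subr0 mulr1 mulr0 addr0.
- exact: integrable_cst_window.
- by move=> r s _; rewrite /= in_itv/=; apply: boundary_integrand_le; exact: HC.
Qed.

Lemma has_deriv_boundary_potential_y b y t : b < 1 -> 0 < y ->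
  has_deriv (V b ^~ t) y (- V (b - nu) y t).
Proof.
move=> b1 y0; have n0 := nu0; have b2 : b - nu < 1 by lra.
have y20 : 0 < y / 2 by lra.
have y2y : y / 2 < y < y + 1 by apply/andP; split; lra.
have [C C0 HC] := wU_le nu0 nu2 b2.
pose p := (1 - (b - nu)) / nu; pose D := C * (y / 2) `^ (- p).
have p0 : 0 <= p by rewrite divr_ge0 ?(ltW n0)//; lra.
have -> : - V (b - nu) y t = \int[mu]_(s in OO 0 S) (- 1 * (U (b - nu) y (t - s) * g s)).
  have := @RintegralZl _ _ _ mu _ _ (-1) (measurable_itv _) (integrable_boundary_integrand t b2 y0).
  by rewrite mulN1r => ->.
apply: (@has_deriv_Rintegral _ _ (fun y s => U b y (t - s) * g s)
  (fun y s => - 1 * (U (b - nu) y (t - s) * g s)) (fun=> D * G) y (y / 2) (y + 1)).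
- exact: measurable_itv.
- exact: y2y.
- by move=> z /andP[z0 _]; apply: integrable_boundary_integrand => //; exact: lt_trans z0.
- move=> z s /andP[z0 _] _; apply: has_deriv_eq.
    apply: has_deriv_mul; last exact: has_deriv_cst.
    by apply: (has_deriv_wU_y nu0 nu2) => //; exact: lt_trans z0.
  by rewrite mulr0 addr0 mulN1r mulNr.
- exact: integrable_cst_window.
- move=> z s /andP[z0 _]; rewrite /= in_itv/= => s0S.
  rewrite mulN1r normrN; apply: boundary_integrand_le => //.
  apply: le_trans (HC _ _ (lt_trans y20 z0)) _; rewrite /D ler_wpM2l// !powRN.
  have zp : 0 < z by exact: lt_trans z0.
  by rewrite lef_pV2 ?posrE ?powR_gt0//; apply: ge0_ler_powR; rewrite ?nnegrE ?(ltW zp) ?(ltW y20) ?(ltW z0).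
Qed.

Lemma boundary_potential_le0 b y t : b < 1 -> 0 < y -> t <= 0 -> V b y t = 0.
Proof.
move=> b1 y0 t0; transitivity (\int[mu]_(s in OO 0 S) cst 0 s); last first.
  by rewrite Rintegral_cst ?mul0r//; exact: measurable_itv.
apply: eq_Rintegral; move=> s; rewrite inE /= in_itv/= => /andP[s0 _]; by rewrite (wU_le0 nu0 nu2) ?mul0r//; lra.
Qed.

Lemma boundary_potential_window b y t : b < 1 -> 0 < y -> t <= S ->
  (mu.-integrable (OO 0 t) (EFin \o (fun s => U b y (t - s) * g s))) /\
  \int[mu]_(s in OO 0 t) (U b y (t - s) * g s) = V b y t.
Proof.
move=> b1 y0 tS.
have sub : OO 0 t `<=` OO 0 S.
  by move=> s; rewrite /= !in_itv/= => /andP[-> st]; rewrite (lt_le_trans st).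
have z s : OO 0 S s -> ~ OO 0 t s -> U b y (t - s) * g s = 0.
  rewrite /= !in_itv/= => /andP[s0 _] /negP; rewrite s0/= -leNgt => ts.
  by rewrite (wU_le0 nu0 nu2) ?mul0r// subr_le0.
have [h1 h2] := Rintegral_support (measurable_itv _) (measurable_itv _) sub z.
by split=> //; apply/h1; exact: integrable_boundary_integrand.
Qed.

Lemma boundary_potential_convolution a b y t : 0 < a -> a + b < 1 -> 0 < y ->
  mu.-integrable HL (EFin \o (fun s => s `^ (a - 1) * V b y (t - s))) /\
  \int[mu]_(s in HL) (s `^ (a - 1) * V b y (t - s)) = euler_integral a * V (a + b) y t.
Proof.
move=> a0 ab1 y0; have b1 : b < 1 by lra.
have mHL : measurable HL by exact: measurable_itv.
have mO : measurable (OO 0 S) by exact: measurable_itv.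
have [C C0 HC] := wU_bounded nu0 nu2 b1 y0.
pose f s r := s `^ (a - 1) * (U b y (t - s - r) * g r).
have mf : measurable_fun (HL `*` OO 0 S : set (mR * mR)) (fun z : mR * mR => f z.1 z.2).
  have m1 := measurable_fst (T1 := mR) (T2 := mR); have m2 := measurable_snd (T1 := mR) (T2 := mR).
  have mHO : measurable (HL `*` OO 0 S : set (mR * mR)) by exact: measurableX.
  apply: measurable_funM.
    by apply: measurable_funTS; exact: (measurableT_comp (measurable_powR _) m1).
  apply: measurable_funM.
    apply: measurable_funTS; apply: (measurableT_comp (f := U b y)).
      by apply: continuous_measurable_fun => s; exact: (wU_continuous nu0 nu2).
    by apply: measurable_funB => //; exact: measurable_funB.
  apply: (measurable_comp (F := OO 0 S) (f := g) (g := snd)) => //.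
    by move=> _ [z [_ z2] <-].
  exact: measurable_funTS.
have bnd s r : HL s -> OO 0 S r -> `|f s r| <= C * (1 + `|t|) `^ (a + 1) * dom a s * G.
  rewrite /= !in_itv/= andbT => s0 r0S; rewrite /f mulrA normrM.
  apply: ler_pM => //; last exact: gG.
  have [r0 _] := andP r0S.
  apply: (@powR_window_dom _ a `|t| C (fun s => U b y (t - s - r))) => // s' ts.
  apply: (wU_le0 nu0 nu2) => //; have := ler_norm t; lra.
have ig : mu.-integrable HL (EFin \o (fun s => C * (1 + `|t|) `^ (a + 1) * dom a s)).
  exact/integrableZ_half_line/integrable_dom.
have [iF eF] := Rfubini mHL mO mf ig (integrable_cst_window G) bnd.
have E s : \int[mu]_(r in OO 0 S) f s r = s `^ (a - 1) * V b y (t - s).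
  exact: (@RintegralZl _ _ _ mu _ _ _ mO (integrable_boundary_integrand (t - s) b1 y0)).
split; first by apply: (@eq_integrable _ _ _ mu) iF => // s _; rewrite /= E.
under eq_Rintegral do rewrite -E.
rewrite eF -(@RintegralZl _ _ _ mu _ _ _ mO); last exact: integrable_boundary_integrand.
apply: eq_Rintegral => r _.
transitivity (\int[mu]_(s in HL) (g r * (s `^ (a - 1) * U b y (t - r - s)))).
  by apply: eq_Rintegral_half_line => s _; rewrite /f addrAC mulrA mulrC.
rewrite RintegralZ_half_line; last exact: (integrable_conv nu0 nu2).
by rewrite (wU_convolution nu0 nu2)// mulrC mulrA.
Qed.

(** The potential vanishes at negative times, so the Caputo integral is a
    convolution over the half-line. *)
Lemma caputo_boundary_potential y t : 0 < y -> 0 < t ->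
  (forall e, 0 < e < t -> mu.-integrable (OO e t)
    (EFin \o (fun s => (t - s) `^ (- (2 * nu)) * V (nu - 1) y s))) /\
  \int[mu]_(s in OO e t) ((t - s) `^ (- (2 * nu)) * V (nu - 1) y s) @[e --> 0^'+] -->
  euler_integral (1 - 2 * nu) * V (- nu) y t.
Proof.
move=> y0 t0; have n0 := nu0; have n2 := nu2.
have a0 : 0 < 1 - 2 * nu by lra.
have ab1 : 1 - 2 * nu + (nu - 1) < 1 by lra.
have b1 : nu - 1 < 1 by lra.
have ea : 1 - 2 * nu - 1 = - (2 * nu) by ring.
have eab : 1 - 2 * nu + (nu - 1) = - nu by ring.
have [iH eH] := boundary_potential_convolution t a0 ab1 y0.
rewrite ea eab in iH eH.
(* the reflection s => t - s turns the convolution into the Caputo integral *)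
have z s : t <= s -> s `^ (- (2 * nu)) * V (nu - 1) y (t - s) = 0.
  by move=> ts; rewrite boundary_potential_le0 ?mulr0// subr_le0.
have [w1 w2] := half_line_window z.
have [ir er] := Rintegral_window_reflect (w1.2 iH).
have E s : (t - s) `^ (- (2 * nu)) * V (nu - 1) y (t - (t - s)) = (t - s) `^ (- (2 * nu)) * V (nu - 1) y s.
  by congr (_ * V _ _ _); exact: subKr.
have iO : mu.-integrable (OO 0 t) (EFin \o (fun s => (t - s) `^ (- (2 * nu)) * V (nu - 1) y s)).
  by apply: (@eq_integrable _ _ _ mu) ir => [|s _]; [exact: measurable_itv|exact: (congr1 EFin (E s))].
split.
  move=> e /andP[e0 et]; apply: (@integrableS _ _ _ mu (OO 0 t)); [exact: measurable_itv|exact: measurable_itv| |exact: iO].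
  by move=> s /=; rewrite !in_itv/= => /andP[es ->]; rewrite (lt_trans e0).
rewrite -eH -w2 er; under eq_Rintegral do rewrite E.
exact: Rintegral_cvg_left.
Qed.

(** U 0 y is an approximate identity of mass 1 acting on s => g (t - s). *)
Lemma boundary_potential_cvg0 t : 0 < t < S -> g (t - s) @[s --> 0^'+] --> g t ->
  V 0 y t @[y --> 0^'+] --> g t.
Proof.
move=> /andP[t0 tS] gt; have n0 := nu0; have n2 := nu2.
pose phi s := if s < t then g (t - s) else 0.
have phi0 s : t <= s -> phi s = 0 by rewrite /phi leNgt => /negbTE ->.
have phiE s : s < t -> phi s = g (t - s) by rewrite /phi => ->.
have iphi : mu.-integrable HL (EFin \o phi).
  apply/(half_line_window phi0).1.
  have ig : mu.-integrable (OO 0 t) (EFin \o g).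
    apply: (@integrableS _ _ _ mu (OO 0 S)); [exact: measurable_itv|exact: measurable_itv| |exact: integrable_window gG].
    by move=> s /=; rewrite !in_itv/= => /andP[-> st]; rewrite (lt_trans st).
  have := (Rintegral_window_reflect ig).1.
  apply: (@eq_integrable _ _ _ mu); first exact: measurable_itv.
  by move=> s; rewrite inE /= in_itv/= => /andP[_ st]; rewrite phiE.
have G0 : 0 <= G by apply: le_trans (gG (s := t) _); rewrite ?t0.
have phiB s : 0 < s < t -> `|phi s| <= G.
  by move=> /andP[s0 st]; rewrite phiE//; apply: gG; apply/andP; split; lra.
have phic : phi s @[s --> 0^'+] --> g t.
  by apply: (cvg_right_eq t0 _ gt) => s; rewrite add0r => /andP[_ st]; rewrite phiE.
have L := stable_approx_identity nu0 nu2 t0 G0 iphi phiB phic.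
rewrite (stable_mass1 nu0 nu2) mul1r in L.
apply: (cvg_right_eq ltr01 _ L) => y /andP[y0 _].
have [iw <-] := boundary_potential_window ltr01 y0 (ltW tS).
have [_ ->] := Rintegral_window_reflect iw.
have z s : t <= s -> U 0 y s * phi s = 0 by move=> ts; rewrite phi0 ?mulr0.
rewrite -(half_line_window z).2; apply: eq_Rintegral => s.
by rewrite inE /= in_itv/= => /andP[_ st]; rewrite subKr phiE.
Qed.

End BoundaryPotential.

(** * The candidate as a sum of potentials *)

Section CandidateFormula.
Context {R : realType} (nu : R) (nu0 : 0 < nu) (nu2 : 2 * nu < 1).
Local Notation mu := (@lebesgue_measure R).
Local Notation HL := [set` @Interval R (BRight 0%R) +oo%O].
Local Notation CL := [set` @Interval R (BLeft 0%R) +oo%O].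
Local Notation OO e t := [set` @Interval R (BRight e) (BLeft t)].
Local Notation mR := (measurableTypeR R).
Local Notation U := (wU nu).
Local Notation W := (wW nu).
Context (lam : R) (lam0 : 0 < lam).
Implicit Types (a b x y t s v xi tau : R).

Lemma wW_time_unit b y t : b < 1 -> 0 <= y -> 0 < t ->
  W b y t = t `^ (b - 1) * W b (y * t `^ (- nu)) 1.
Proof.
move=> b1 y0 t0; have n0 := nu0; have n2 := nu2.
have tV : 0 < t^-1 by rewrite invr_gt0.
have tt : t * t^-1 = 1 by rewrite mulfV// gt_eqF.
have e (p : R) : t^-1 `^ p = t `^ (- p) by rewrite -(powR_inv1 (ltW t0)) -powRrM mulN1r.
have ib : -1 < - b by lra.
rewrite /wW /wkernel (@Rintegral_ray_scale _ _ _ _ _ _ _ t^-1 tV).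
  rewrite !e mulrCA mulNr tt; congr (_ `^ _ * _); ring.
exact: (integrable_rayW nu0 nu2).
Qed.

Lemma mainardi_kernel v t : 0 <= v -> 0 < t ->
  mainardi nu (v / (lam * t `^ nu)) = t `^ nu * W (1 - nu) (v / lam) t.
Proof.
move=> v0 t0; have n0 := nu0; have n2 := nu2.
have tn : 0 < t `^ nu by rewrite powR_gt0.
have b1 : 1 - nu < 1 by lra.
have vl : 0 <= v / lam by rewrite divr_ge0// ltW.
rewrite (mainardiE nu0 nu2); last by rewrite divr_ge0// mulr_ge0 ?powR_ge0// ltW.
rewrite (wW_time_unit b1 vl t0) mulrA -powR_add//.
rewrite (_ : nu + (1 - nu - 1) = 0); last ring.
by rewrite powRr0 mul1r powRN -mulrA -invfM.
Qed.

Section Initial.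
Context (f : R -> R) (B : R).
Let k s := f `|lam * s|.
Context (ck : continuous k) (kB : forall s, `|k s| <= B).
Local Notation A := (potential nu k).

(** Even kernel against even extension of f.  Folding the line at s = 0 gives
    the integrand of the candidate, folding it at s = x gives the potentials at
    x and - x. *)
Definition initial_line x t s : R :=
  mainardi nu (`|x - s| / (lam * t `^ nu)) * f `|s|.

Lemma initial_line_potential x t : 0 < t ->
  mu.-integrable HL (EFin \o (fun v => initial_line x t (x - v))) /\
  \int[mu]_(v in HL) initial_line x t (x - v) = t `^ nu * (lam * A (1 - nu) (x / lam) t).
Proof.
move=> t0; have n0 := nu0; have n2 := nu2.
have lV : 0 < lam^-1 by rewrite invr_gt0.
have ln : lam != 0 by rewrite gt_eqF.
have iP := integrable_potential nu0 nu2 ck kB (x / lam) (lexx (1 - nu)) t0.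
have [iQ eQ] := Rintegral_scale_half_line lV iP.
have E v : 0 < v -> t `^ nu * (U (1 - nu) (lam^-1 * v) t * k (x / lam - lam^-1 * v)) =
    initial_line x t (x - v).
  move=> v0; have b1 : 1 - nu < 1 by lra.
  have vl0 : 0 < v / lam by rewrite divr_gt0.
  rewrite /initial_line subKr (gtr0_norm v0) mainardi_kernel ?(ltW v0)// /k.
  rewrite [lam^-1 * v]mulrC (wUW nu0 nu2)// mulrA; congr (_ * f `| _ |).
  by rewrite mulrBr mulrCA mulfV// mulr1 mulrCA mulfV// mulr1.
have iE := integrableZ_half_line (t `^ nu) iQ.
split.
  apply: (@eq_integrable _ _ _ mu) iE; first exact: measurable_itv.
  by move=> v; rewrite inE /= in_itv/= andbT => v0; rewrite E.
rewrite -(eq_Rintegral_half_line E) RintegralZ_half_line//; congr (_ * _).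
by rewrite /potential eQ mulrA mulfV// mul1r.
Qed.

Lemma initial_line_opp x t s : initial_line (- x) t (- s) = initial_line x t s.
Proof. by rewrite /initial_line opprK [- x + s]addrC distrC normrN. Qed.

Lemma initial_line_fold x t xi : 0 < x -> 0 < xi ->
  initial_line x t xi + initial_line x t (- xi) = initial_integrand (nu * 2) lam f x t xi.
Proof.
move=> x0 xi0; rewrite /initial_integrand /initial_line mulfK ?pnatr_eq0//.
rewrite opprK normrN (gtr0_norm xi0) (gtr0_norm (addr_gt0 x0 xi0)).
by rewrite [RHS]mulrDl addrC.
Qed.

Lemma initial_potential x t : 0 < x -> 0 < t ->
  mu.-integrable CL (EFin \o initial_integrand (nu * 2) lam f x t) /\
  1 / (2 * lam * t `^ nu) * (\int[mu]_(xi in CL) initial_integrand (nu * 2) lam f x t xi) =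
  2^-1 * (A (1 - nu) (x / lam) t + A (1 - nu) (- (x / lam)) t).
Proof.
move=> x0 t0; have tn : 0 < t `^ nu by rewrite powR_gt0.
have alg (l c a b : R) : l != 0 -> c != 0 ->
    1 / (2 * l * c) * (c * (l * a) + c * (l * b)) = 2^-1 * (a + b).
  by move=> l0 c0; field; rewrite l0 c0.
have [i1 e1] := initial_line_potential x t0.
have [i2 e2] := initial_line_potential (- x) t0.
have E2 v : initial_line (- x) t (- x - v) = initial_line x t (x - - v).
  by rewrite -initial_line_opp !opprK opprB opprK addrC.
(* the function on the line, as seen from x *)
pose L v := initial_line x t (x - v).
have iL2 : mu.-integrable HL (EFin \o (fun v => L (- v))).
  by apply: (@eq_integrable _ _ _ mu) i2; [exact: measurable_itv|move=> v _; rewrite /= E2].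
have iT := integrable_unfold i1 iL2.
have [_ _ eT] := integrable_fold iT.
have [iF eF] := integrable_reflect x iT.
have EF : (fun v => L (x - v)) = initial_line x t by apply/funext => v; rewrite /L subKr.
rewrite EF in iF eF; have [j1 j2 ej] := integrable_fold iF.
have EI xi := @initial_line_fold x t xi x0.
have iI : mu.-integrable HL (EFin \o initial_integrand (nu * 2) lam f x t).
  have := integrableD_half_line j1 j2; apply: (@eq_integrable _ _ _ mu); first exact: measurable_itv.
  by move=> xi; rewrite inE /= in_itv/= andbT => xi0; rewrite EI.
have [iC eC] := integrable_closed_half_line iI.
split=> //; rewrite eC -(eq_Rintegral_half_line EI) -ej -eF eT RintegralD_half_line//.
have -> : \int[mu]_(v in HL) L (- v) = t `^ nu * (lam * A (1 - nu) (- x / lam) t).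
  by rewrite -e2; apply: eq_Rintegral_half_line => v _; rewrite E2.
rewrite e1 mulNr; apply: alg; first by rewrite gt_eqF.
by rewrite gt_eqF.
Qed.

End Initial.

Section Boundary.
Context (g : R -> R) (G S : R).
Context (mg : measurable_fun (OO 0 S) g) (gG : forall s, 0 < s < S -> `|g s| <= G).
Local Notation V := (boundary_potential nu g S).

(** For tau < t this is t W_0 = nu y W_(1 - nu).  At tau = t both sides are
    0: nonzero powers of 0 and division by 0 give 0, and the kernel is causal. *)
Lemma boundary_integrandE t xi tau : 0 < xi -> 0 <= tau <= t ->
  boundary_integrand (nu * 2) lam g t xi tau = U 0 (xi / lam) (t - tau) * g tau.
Proof.
move=> xi0 /andP[tau0 taut]; have n0 := nu0; have n2 := nu2; have p01 := @ltr01 R.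
have y0 : 0 < xi / lam by rewrite divr_gt0.
rewrite /boundary_integrand mulfK ?pnatr_eq0//.
have [->|ne] := eqVneq tau t.
  rewrite subrr (wU_le0 nu0 nu2)// mul0r powR0; last by rewrite gt_eqF//; lra.
  rewrite powR0; last by rewrite gt_eqF//; lra.
  by rewrite mulr0 invr0 !mulr0 !mul0r.
have s0 : 0 < t - tau by rewrite subr_gt0 lt_neqAle ne.
move: (t - tau) s0 => s s0; have sn : 0 < s `^ nu by rewrite powR_gt0.
rewrite mainardi_kernel ?(ltW xi0)// (wUW nu0 nu2)//; congr (_ * _).
have e := wW0E nu0 nu2 (ltW y0) s0.
have -> : W 0 (xi / lam) s = s^-1 * (nu * (xi / lam) * W (1 - nu) (xi / lam) s).
  by rewrite -e mulKf// gt_eqF.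
rewrite powR_addr1//.
have s1 : s != 0 by rewrite gt_eqF.
have s2 : s `^ nu != 0 by rewrite gt_eqF.
have l1 : lam != 0 by rewrite gt_eqF.
by move: (W _ _ _) (s `^ nu) s2 => w p p0; field; rewrite s1 p0 l1.
Qed.

Lemma wU0_tail_le x : 0 < x -> exists2 C : R, 0 <= C &
  forall r s, 0 < r -> `|U 0 (x + r) s| <= C * (1 + r) `^ (- (1 + 1)).
Proof.
move=> x0; have n0 := nu0; have n2 := nu2; have p01 := @ltr01 R.
have [C C0 HC] := wU_le nu0 nu2 p01.
pose c := Num.min x 1; have c0 : 0 < c by rewrite lt_min x0 ltr01.
pose p := nu^-1; have p2 : 2 <= p by rewrite /p -[leLHS]invrK lef_pV2 ?posrE//; lra.
exists (C * c `^ (- p)); first by rewrite mulr_ge0 ?powR_ge0.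
move=> r s r0; have xr : 0 < x + r by rewrite addr_gt0.
have r1 : 0 < 1 + r by rewrite addr_gt0.
have h := HC (x + r) s xr; rewrite subr0 div1r -/p in h.
apply: (le_trans h); rewrite -mulrA ler_wpM2l//.
have h1 : c * (1 + r) <= x + r.
  by rewrite mulrDr mulr1 lerD ?ge_min ?lexx// -[leRHS]mul1r ler_wpM2r ?(ltW r0)// ge_min lexx orbT.
have cr : 0 < c * (1 + r) by rewrite mulr_gt0.
apply: (@le_trans _ _ ((c * (1 + r)) `^ (- p))).
  rewrite !powRN lef_pV2 ?posrE ?powR_gt0//.
  by apply: ge0_ler_powR; rewrite ?nnegrE ?(ltW cr) ?(ltW xr)//; lra.
rewrite powRM ?(ltW c0) ?(ltW r1)// ler_wpM2l ?powR_ge0//.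
by apply: ler_powR; lra.
Qed.

(** - U nu is a primitive of U 0 in y. *)
Lemma wU0_tail x s : 0 < x -> \int[mu]_(r in HL) U 0 (x + r) s = U nu x s.
Proof.
move=> x0; have n0 := nu0; have n2 := nu2; have p01 := @ltr01 R.
have nu1 : nu < 1 by lra.
have [C C0 HC] := wU0_tail_le x0.
have dU r : 0 < r -> has_deriv (fun r => - U nu (x + r) s) r (U 0 (x + r) s).
  move=> r0; have xr : 0 < x + r by rewrite addr_gt0.
  apply: has_deriv_eq.
    apply/has_deriv_opp/(has_deriv_comp (f := U nu ^~ s)).
      exact: (has_deriv_wU_y nu0 nu2).
    by apply: has_deriv_add; [exact: has_deriv_cst|exact: has_deriv_id].
  by rewrite add0r mulr1 opprK subrr.
have cU b r : b < 1 -> 0 <= r -> {for r, continuous (fun r => U b (x + r) s)}.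
  move=> b1 r0; apply: has_deriv_continuous; apply: (has_deriv_comp (f := U b ^~ s)).
    by apply: (has_deriv_wU_y nu0 nu2) => //; rewrite ltr_wpDr.
  by apply: has_deriv_add; [exact: has_deriv_cst|exact: has_deriv_id].
apply: (eq_trans (y := 0 - (- U nu x s))); last by rewrite sub0r opprK.
apply: (Rintegral_half_line dU).
- by move=> r r0; apply: cU => //; exact: ltW.
- apply: (le_integrable_half_line (g := fun r => C * (1 + r) `^ (- (1 + 1)))).
  + by apply: continuous_half_line_measurable => r r0; apply: cU => //; exact: ltW.
  + by apply/integrableZ_half_line/integrable_powR_1D.
  + by move=> r r0; exact: HC.
- apply: cvgN; have h := cU nu 0 nu1 (lexx 0).
  by have := cvg_at_right_filter h; rewrite addr0.
- rewrite -oppr0; apply: cvgN; apply: norm_cvg0.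
  have [D D0 HD] := wU_le nu0 nu2 nu1.
  apply: (@squeeze_cvgr _ _ _ _ (cst 0) (fun r => D * r^-1)).
  + near=> r; have r1 : 1 <= r by near: r; exact: nbhs_pinfty_ge.
    have r0 : 0 < r by exact: lt_le_trans r1.
    have xr : 0 < x + r by rewrite addr_gt0.
    rewrite normr_ge0/= (le_trans (HD _ _ xr))// ler_wpM2l//.
    rewrite powRN lef_pV2 ?posrE ?powR_gt0//.
    apply: (@le_trans _ _ (x + r)); first by rewrite lerDr ltW.
    rewrite -[leLHS]powRr1 ?(ltW xr)//; apply: ler_powR; first by rewrite (le_trans r1)// lerDr ltW.
    by rewrite ler_pdivlMr//; lra.
  + exact: cvg_cst.
  + rewrite -(mulr0 D); apply: cvgM; [exact: cvg_cst|exact: cvg_inv_pinfty].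
Unshelve. all: by end_near. Qed.

Lemma boundary_potential_tail x t : 0 < x -> 0 < t <= S ->
  mu.-integrable HL (EFin \o (fun r => V 0 (x + r) t)) /\
  \int[mu]_(r in HL) V 0 (x + r) t = V nu x t.
Proof.
move=> x0 /andP[t0 tS]; have n0 := nu0; have n2 := nu2; have p01 := @ltr01 R.
have nu1 : nu < 1 by lra.
have [C C0 HC] := wU0_tail_le x0.
have mHL : measurable HL by exact: measurable_itv.
have mO : measurable (OO 0 t) by exact: measurable_itv.
have sub : OO 0 t `<=` OO 0 S.
  by move=> s; rewrite /= !in_itv/= => /andP[-> st]; rewrite (lt_le_trans st).
pose F r s := U 0 (x + r) (t - s) * g s.
have mF : measurable_fun (HL `*` OO 0 t : set (mR * mR)) (fun z : mR * mR => F z.1 z.2).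
  have m1 := measurable_fst (T1 := mR) (T2 := mR); have m2 := measurable_snd (T1 := mR) (T2 := mR).
  have mHO : measurable (HL `*` OO 0 t : set (mR * mR)) by exact: measurableX.
  apply: measurable_funM.
    apply: (@measurable_wU R nu nu0 nu2 _ (mR * mR)%type (HL `*` OO 0 t) (fun z => x + z.1) (fun z => t - z.2) _ p01) => //.
    - by apply: measurable_funTS; exact: measurable_funD.
    - by apply: measurable_funTS; exact: measurable_funB.
    - by move=> z [/=]; rewrite in_itv/= andbT => z1 _; rewrite addr_gt0.
    - by move=> z [_] /=; rewrite in_itv/= subr_gt0 => /andP[].
  apply: (measurable_comp (F := OO 0 t) (f := g) (g := snd)) => //.
  - by move=> _ [z [_ z2] <-].
  - exact: measurable_funS mg.
  - exact: measurable_funTS.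
have ic : mu.-integrable (OO 0 t) (EFin \o (fun=> G)) by exact: integrable_cst_window.
have ig : mu.-integrable HL (EFin \o (fun r => C * (1 + r) `^ (- (1 + 1)))).
  by apply/integrableZ_half_line/integrable_powR_1D.
have bnd r s : HL r -> OO 0 t s -> `|F r s| <= C * (1 + r) `^ (- (1 + 1)) * G.
  move=> Hr /sub; rewrite /= in_itv/= => s0S; move: Hr; rewrite /= in_itv/= andbT => r0.
  by rewrite normrM; apply: ler_pM => //; [exact: HC|exact: gG].
have [iF eF] := Rfubini mHL mO mF ig ic bnd.
have EV r : HL r -> \int[mu]_(s in OO 0 t) F r s = V 0 (x + r) t.
  rewrite /= in_itv/= andbT => r0; have xr : 0 < x + r by rewrite addr_gt0.
  exact: (boundary_potential_window nu0 nu2 mg gG p01 xr tS).2.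
split.
  by apply: (@eq_integrable _ _ _ mu) iF => // r; rewrite inE => /EV /= ->.
transitivity (\int[mu]_(r in HL) (\int[mu]_(s in OO 0 t) F r s)).
  by apply: eq_Rintegral => r; rewrite inE => /EV ->.
rewrite eF -(boundary_potential_window nu0 nu2 mg gG nu1 x0 tS).2.
apply: eq_Rintegral => s _.
transitivity (\int[mu]_(r in HL) (g s * U 0 (x + r) (t - s))).
  by apply: eq_Rintegral_half_line => r _; rewrite /F mulrC.
rewrite RintegralZ_half_line; first by rewrite wU0_tail// mulrC.
apply: (le_integrable_half_line _ ig) => [|r r0]; last exact: HC.
apply: continuous_half_line_measurable => r r0; apply: has_deriv_continuous.
apply: (has_deriv_comp (f := U 0 ^~ (t - s))).
  by apply: (has_deriv_wU_y nu0 nu2) => //; rewrite addr_gt0.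
by apply: has_deriv_add; [exact: has_deriv_cst|exact: has_deriv_id].
Qed.

Lemma boundary_term x t : 0 < x -> 0 < t < S ->
  [/\ forall xi, x <= xi -> mu.-integrable `[0, t] (EFin \o boundary_integrand (nu * 2) lam g t xi),
   mu.-integrable `[x, +oo[ (EFin \o (fun xi =>
     \int[mu]_(tau in `[0, t]) boundary_integrand (nu * 2) lam g t xi tau)) &
   \int[mu]_(xi in `[x, +oo[) (\int[mu]_(tau in `[0, t]) boundary_integrand (nu * 2) lam g t xi tau) =
   lam * V nu (x / lam) t].
Proof.
move=> x0 /andP[t0 tS]; have p01 := @ltr01 R; have lV : 0 < lam^-1 by rewrite invr_gt0.
have H xi : 0 < xi -> mu.-integrable `[0, t] (EFin \o boundary_integrand (nu * 2) lam g t xi) /\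
    \int[mu]_(tau in `[0, t]) boundary_integrand (nu * 2) lam g t xi tau = V 0 (xi / lam) t.
  move=> xi0; have y0 : 0 < xi / lam by rewrite divr_gt0.
  have [iw <-] := boundary_potential_window nu0 nu2 mg gG p01 y0 (ltW tS).
  have [iC eC] := integrable_closed_window iw; split.
    apply: (@eq_integrable _ _ _ mu) iC; first exact: measurable_itv.
    by move=> s; rewrite inE /= in_itv/= => s0t; rewrite boundary_integrandE.
  rewrite -eC; apply: eq_Rintegral => s; rewrite inE /= in_itv/= => s0t.
  by rewrite boundary_integrandE.
have y0 : 0 < x / lam by rewrite divr_gt0.
have t0S : 0 < t <= S by rewrite t0 ltW.
have [iV eV] := boundary_potential_tail y0 t0S.
have [iP eP] := Rintegral_scale_half_line lV iV.
pose OX : set R := `]x, +oo[.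
have [iS eS] := Rintegral_shift_half_line x iP.
have EV z : 0 < z -> V 0 (x / lam + lam^-1 * (z - x)) t =
    \int[mu]_(tau in `[0, t]) boundary_integrand (nu * 2) lam g t z tau.
  move=> z0; rewrite (H z z0).2; congr (V 0 _ t).
  by rewrite [lam^-1 * _]mulrC mulrBl addrC subrK.
have iO : mu.-integrable OX (EFin \o (fun xi =>
     \int[mu]_(tau in `[0, t]) boundary_integrand (nu * 2) lam g t xi tau)).
  apply: (@eq_integrable _ _ _ mu) iS; first exact: measurable_itv.
  move=> z; rewrite inE /= in_itv/= andbT => xz; have z0 := lt_trans x0 xz.
  exact: (congr1 EFin (EV z z0)).
have [iC eC] := integrable_closed_half_line iO; split; [|exact: iC|].
- by move=> xi xxi; apply: (H xi _).1; exact: lt_le_trans xxi.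
- have ln : lam != 0 by rewrite gt_eqF.
  have e1 : lam * V nu (x / lam) t = \int[mu]_(r in HL) V 0 (x / lam + lam^-1 * r) t.
    by rewrite -eV; exact: (etrans (congr1 _ eP) (mulVKf ln _)).
  apply: (etrans eC); apply: esym; apply: (etrans e1); apply: (etrans eS).
  apply: eq_Rintegral => z; rewrite inE /= in_itv/= andbT => xz; have z0 := lt_trans x0 xz.
  exact: EV.
Qed.

End Boundary.
End CandidateFormula.

Section Solution.
Context {R : realType} (nu : R) (nu0 : 0 < nu) (nu2 : 2 * nu < 1).
Local Notation mu := (@lebesgue_measure R).
Local Notation OO e t := [set` @Interval R (BRight e) (BLeft t)].
Local Notation U := (wU nu).
Local Notation W := (wW nu).
Implicit Types (a b x y t s e : R).

Lemma Gamma_caputo : Gamma (1 - nu * 2) = euler_integral (1 - 2 * nu).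
Proof. by have n2 := nu2; rewrite /Gamma [nu * 2]mulrC ifT//; lra. Qed.

(** The coefficient of the local term, in the form in which it arises from
    the Caputo derivative. *)
Lemma wW_boundary t : 0 < t ->
  W (1 - nu - nu) 0 t = (euler_integral (1 - 2 * nu))^-1 * t `^ (- (2 * nu)).
Proof.
move=> t0; have n0 := nu0; have n2 := nu2; have s0 : 0 < 2 * nu by lra.
have := invGamma_reflection s0; rewrite -[in Gamma _](mulrC nu) Gamma_caputo => ->.
have b1 : 1 - nu - nu < 1 by lra.
rewrite (wW_0 nu0 nu2 b1 t0).
have e1 : 1 - nu - nu = 1 - 2 * nu by ring.
have e2 : 1 - (1 - 2 * nu) = 2 * nu by ring.
have e4 : 1 - 2 * nu - 1 = - (2 * nu) by ring.
have -> : sin (pi * (1 - nu - nu)) = sin (pi * (2 * nu)).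
  by rewrite e1 mulrBr mulr1 sinB sinpi cospi mul0r sub0r mulN1r opprK.
rewrite e1 e2 e4; move: (euler_integral _) (sin _) (_ `^ _) (pi^-1) => p q r u.
by ring.
Qed.

Lemma is_caputo_derivativeP al (u du : R -> R) t L :
  (forall s, 0 < s < t -> has_deriv u s (du s)) ->
  (forall e, 0 < e < t ->
    mu.-integrable (OO e t) (EFin \o (fun s => (t - s) `^ (- al) * du s))) ->
  0 < t ->
  \int[mu]_(s in OO e t) ((t - s) `^ (- al) * du s) @[e --> 0^'+] --> L ->
  is_caputo_derivative al u t ((Gamma (1 - al))^-1 * L).
Proof.
move=> dU iU t0 cL.
have E e s : 0 < e -> OO e t s -> (t - s) `^ (- al) * du s = caputo_integrand al u t s.
  move=> e0; rewrite /= in_itv/= => /andP[es st]; rewrite /caputo_integrand.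
  by rewrite (has_deriv_derive1 (dU s _))// (lt_trans e0).
split.
- by move=> s /dU[].
- move=> e /[dup] et /andP[e0 _]; apply: (@eq_integrable _ _ _ mu) (iU e et); first exact: measurable_itv.
  by move=> s; rewrite inE => Hs; exact: (congr1 EFin (E e s e0 Hs)).
- apply: cvgM; first exact: cvg_cst.
  apply: (cvg_right_eq t0 _ cL) => e; rewrite add0r => /andP[e0 _].
  by apply: eq_Rintegral => s; rewrite inE => /(E e s e0).
Qed.

Lemma cvg_right_scale (F : R -> R) (lam l : R) : 0 < lam ->
  F y @[y --> 0^'+] --> l -> F (x / lam) @[x --> 0^'+] --> l.
Proof.
move=> lam0 Fl; apply/cvg_at_rightP => u [u0 uc].
have /cvg_at_rightP := Fl; apply; split; first by move=> n; rewrite divr_gt0.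
by rewrite -(mul0r lam^-1); apply: cvgM => //; exact: cvg_cst.
Qed.

Lemma cvg_right_combination (F1 F2 F3 : R -> R) (l1 l2 l3 p q : R) :
  F1 e @[e --> 0^'+] --> l1 -> F2 e @[e --> 0^'+] --> l2 -> F3 e @[e --> 0^'+] --> l3 ->
  p * (F1 e + F2 e) - q * F3 e @[e --> 0^'+] --> p * (l1 + l2) - q * l3.
Proof.
by move=> c1 c2 c3; apply: cvgB; apply: cvgM; [exact: cvg_cst|exact: cvgD|exact: cvg_cst|].
Qed.

Context (lam : R) (lam0 : 0 < lam).
Context (f : R -> R) (B : R).
Let k s := f `|lam * s|.
Context (ck : continuous k) (kB : forall s, `|k s| <= B).
Context (g : R -> R) (G S : R).
Context (mg : measurable_fun (OO 0 S) g) (gG : forall s, 0 < s < S -> `|g s| <= G).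
Local Notation A := (potential nu k).
Local Notation V := (boundary_potential nu g S).

Let bn1 : 1 - nu <= 1 - nu := lexx _.
Let bn2 : 1 - nu - nu <= 1 - nu.
Proof. by have := nu0; lra. Qed.

Let k_even s : k (- s) = k s.
Proof. by rewrite /k mulrN normrN. Qed.

Definition even_potential b x t := 2^-1 * (A b (x / lam) t + A b (- (x / lam)) t).
Definition solution x t := even_potential (1 - nu) x t - lam * V nu (x / lam) t.
(** The derivative of the solution in x.  The local terms at x and - x cancel
    because the extension of f is even. *)
Definition flux x t :=
  lam^-1 * (2^-1 * (A (1 - nu - nu) (- (x / lam)) t - A (1 - nu - nu) (x / lam) t)) +
  V 0 (x / lam) t.
Definition flux_x x t := lam^-1 ^+ 2 *
  (even_potential (1 - 3 * nu) x t - W (1 - nu - nu) 0 t * k (x / lam) - lam * V (- nu) (x / lam) t).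

Let d_scale x : has_deriv (fun x => x / lam) x lam^-1.
Proof.
by apply: has_deriv_eq; [apply: has_deriv_mul; [exact: has_deriv_id|exact: has_deriv_cst]|rewrite mul1r mulr0 addr0].
Qed.

Let dA b x t : b <= 1 - nu -> 0 < t ->
  has_deriv (fun x => A b (x / lam) t) x ((W b 0 t * k (x / lam) - A (b - nu) (x / lam) t) * lam^-1).
Proof.
move=> bn t0; apply: (has_deriv_comp (f := A b ^~ t)); last exact: d_scale.
exact: (has_deriv_potential_x nu0 nu2 ck kB).
Qed.

Let dAN b x t : b <= 1 - nu -> 0 < t ->
  has_deriv (fun x => A b (- (x / lam)) t) x ((W b 0 t * k (x / lam) - A (b - nu) (- (x / lam)) t) * - lam^-1).
Proof.
move=> bn t0; rewrite -(k_even (x / lam)); apply: (has_deriv_comp (f := A b ^~ t)).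
  exact: (has_deriv_potential_x nu0 nu2 ck kB).
exact/has_deriv_opp/d_scale.
Qed.

Let dV b x t : b < 1 -> 0 < x ->
  has_deriv (fun x => V b (x / lam) t) x (- V (b - nu) (x / lam) t * lam^-1).
Proof.
move=> b1 x0; apply: (has_deriv_comp (f := V b ^~ t)); last exact: d_scale.
by apply: (has_deriv_boundary_potential_y nu0 nu2 mg gG) => //; exact: divr_gt0.
Qed.

Lemma has_deriv_solution_x x t : 0 < x -> 0 < t ->
  has_deriv (solution ^~ t) x (flux x t).
Proof.
move=> x0 t0; have n1 : nu < 1 by have := nu0; have := nu2; lra.
have alg (l w a b v c : R) : l != 0 ->
    2^-1 * ((w * c - a) * l^-1 + (w * c - b) * - l^-1) - l * (- v * l^-1) =
    l^-1 * (2^-1 * (b - a)) + v.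
  by move=> l0; field.
apply: has_deriv_eq.
  apply: has_deriv_sub; last exact/has_deriv_scale/dV.
  by apply: has_deriv_scale; apply: has_deriv_add; [apply: dA|apply: dAN].
by rewrite /flux subrr; apply: alg; rewrite gt_eqF.
Qed.

Lemma has_deriv_flux x t : 0 < x -> 0 < t -> has_deriv (flux ^~ t) x (flux_x x t).
Proof.
move=> x0 t0; have e3 : 1 - nu - nu - nu = 1 - 3 * nu by ring.
have alg (l w a b v c : R) : l != 0 ->
    l^-1 * (2^-1 * ((w * c - b) * - l^-1 - (w * c - a) * l^-1)) + - v * l^-1 =
    l^-1 ^+ 2 * (2^-1 * (a + b) - w * c - l * v).
  by move=> l0; field.
apply: has_deriv_eq.
  apply: has_deriv_add; last by apply: dV.
  by apply/has_deriv_scale/has_deriv_scale/has_deriv_sub; [apply: dAN|apply: dA].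
by rewrite /flux_x /even_potential e3 sub0r; apply: alg; rewrite gt_eqF.
Qed.

Lemma has_deriv_solution_t x t : 0 < x -> 0 < t ->
  has_deriv (solution x) t (even_potential (- nu) x t - lam * V (nu - 1) (x / lam) t).
Proof.
move=> x0 t0; have n1 : nu < 1 by have := nu0; have := nu2; lra.
have e1 : 1 - nu - 1 = - nu by ring.
have y0 : 0 < x / lam by rewrite divr_gt0.
have dAt y : has_deriv (A (1 - nu) y) t (A (- nu) y t).
  by rewrite -[in A (- nu)]e1; exact: (has_deriv_potential_t nu0 nu2 ck kB y bn1 t0).
apply: has_deriv_sub; apply: has_deriv_scale; first exact: has_deriv_add.
exact: (has_deriv_boundary_potential_t nu0 nu2 mg gG).
Qed.

Lemma solution_cvg0 x : 0 < x -> solution x t @[t --> 0^'+] --> f x.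
Proof.
move=> x0; have n1 : nu < 1 by have := nu0; have := nu2; lra.
have y0 : 0 < x / lam by rewrite divr_gt0.
have kx : k (x / lam) = f x.
  by rewrite /k mulrCA mulfV ?gt_eqF// mulr1 gtr0_norm.
have -> : f x = 2^-1 * (k (x / lam) + k (- (x / lam))) - lam * V nu (x / lam) 0.
  rewrite (boundary_potential_le0 nu0 nu2)// mulr0 subr0 k_even kx.
  by field.
apply: cvgB.
  apply: cvgM; first exact: cvg_cst.
  by apply: cvgD; exact: (potential_cvg0 nu0 nu2 ck kB).
apply: cvgM; first exact: cvg_cst.
apply: cvg_at_right_filter; apply: has_deriv_continuous.
exact: (has_deriv_boundary_potential_t nu0 nu2 mg gG).
Qed.

(** The part due to the initial values is odd in x and continuous. *)
Lemma flux_cvg0 t : 0 < t < S -> g (t - s) @[s --> 0^'+] --> g t ->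
  flux x t @[x --> 0^'+] --> g t.
Proof.
move=> /[dup] tS /andP[t0 _] gt.
have -> : g t = lam^-1 * (2^-1 * (A (1 - nu - nu) 0 t - A (1 - nu - nu) 0 t)) + g t.
  by rewrite subrr !mulr0 add0r.
apply: cvgD; last first.
  by apply: (cvg_right_scale (F := V 0 ^~ t)) => //; exact: (boundary_potential_cvg0 nu0 nu2 mg gG).
apply: cvgM; first exact: cvg_cst.
apply: cvgM; first exact: cvg_cst.
have cA : {for 0, continuous (A (1 - nu - nu) ^~ t)}.
  apply: has_deriv_continuous; exact: (has_deriv_potential_x nu0 nu2 ck kB _ bn2 t0).
have h : A (1 - nu - nu) (- y) t @[y --> 0^'+] --> A (1 - nu - nu) (- 0) t.
  apply: cvg_at_right_filter; apply: (has_deriv_continuous (f := fun y => A (1 - nu - nu) (- y) t)).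
  apply: (has_deriv_comp (f := A (1 - nu - nu) ^~ t)).
    exact: (has_deriv_potential_x nu0 nu2 ck kB _ bn2 t0).
  exact/has_deriv_opp/has_deriv_id.
rewrite oppr0 in h; apply: cvgB.
  exact: (cvg_right_scale (F := fun y => A (1 - nu - nu) (- y) t)).
apply: (cvg_right_scale (F := A (1 - nu - nu) ^~ t)) => //.
exact: cvg_at_right_filter.
Qed.

(** The weights produce the kernels of index 1 - 3 nu and - nu of flux_x, and
    the local terms agree by wW_boundary. *)
Lemma solution_caputo (u : R -> R) x t : 0 < x -> 0 < t < S ->
  (forall s, 0 < s < S -> u s = solution x s) ->
  is_caputo_derivative (nu * 2) u t (lam ^+ 2 * flux_x x t).
Proof.
move=> x0 /andP[t0 tS] uE; have n0 := nu0; have n2 := nu2.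
have y0 : 0 < x / lam by rewrite divr_gt0.
have s0 : 0 < 2 * nu by lra.
have algE (w a b v l : R) : w * (2^-1 * (a + b) - l * v) =
    2^-1 * (w * a + w * b) - l * (w * v) by ring.
have algH (l p a b z r v : R) : l != 0 -> p != 0 ->
    l ^+ 2 * (l^-1 ^+ 2 * (2^-1 * (a + b) - p^-1 * r * z - l * v)) =
    p^-1 * (2^-1 * (p * a - r * z + (p * b - r * z)) - l * (p * v)).
  by move=> l0 p0; field; rewrite l0 p0.
have [i1 c1] := caputo_potential nu0 nu2 ck kB (x / lam) t0.
have [i2 c2] := caputo_potential nu0 nu2 ck kB (- (x / lam)) t0.
have [i3 c3] := caputo_boundary_potential nu0 nu2 mg gG y0 t0.
have ln : lam != 0 by rewrite gt_eqF.
have GE := Gamma_caputo.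
have en : euler_integral (1 - 2 * nu) != 0 by apply: euler_integral_neq0; lra.
have WE := wW_boundary t0.
pose w s := (t - s) `^ (- (2 * nu)).
have E s : w s * (even_potential (- nu) x s - lam * V (nu - 1) (x / lam) s) =
    2^-1 * (w s * A (- nu) (x / lam) s + w s * A (- nu) (- (x / lam)) s) -
    lam * (w s * V (nu - 1) (x / lam) s).
  exact: algE.
have H : lam ^+ 2 * flux_x x t = (Gamma (1 - nu * 2))^-1 *
   (2^-1 * (euler_integral (1 - 2 * nu) * A (1 - 3 * nu) (x / lam) t - t `^ (- (2 * nu)) * k (x / lam) +
    (euler_integral (1 - 2 * nu) * A (1 - 3 * nu) (- (x / lam)) t - t `^ (- (2 * nu)) * k (- (x / lam)))) -
   lam * (euler_integral (1 - 2 * nu) * V (- nu) (x / lam) t)).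
  by rewrite GE k_even /flux_x /even_potential WE; exact: algH.
rewrite H; apply: (is_caputo_derivativeP (du := fun s =>
  even_potential (- nu) x s - lam * V (nu - 1) (x / lam) s)).
- move=> s /andP[s1 st]; apply: has_deriv_near (has_deriv_solution_t x0 s1).
  near=> r; apply: uE; apply/andP; split; near: r; first exact: lt_nbhsr.
  by apply: lt_nbhsl; exact: lt_trans tS.
- rewrite [nu * 2]mulrC => e et; have mO : measurable (OO e t) by exact: measurable_itv.
  have iS := RintegrableB mO (RintegrableZ 2^-1 mO (RintegrableD mO (i1 e et) (i2 e et))) (RintegrableZ lam mO (i3 e et)).
  by apply: (@eq_integrable _ _ _ mu) iS => // s _; exact: (congr1 EFin (esym (E s))).
- exact: t0.
- rewrite [nu * 2]mulrC.
  have L := cvg_right_combination (p := 2^-1) (q := lam) c1 c2 c3.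
  apply: (cvg_right_eq t0 _ L) => e; rewrite add0r => et.
  have mO : measurable (OO e t) by exact: measurable_itv.
  have iD := RintegrableD mO (i1 e et) (i2 e et).
  apply: esym; apply: (eq_trans (congr1 (Rintegral mu (OO e t)) (funext E))).
  rewrite (@RintegralB _ _ _ mu _ _ _ mO (RintegrableZ 2^-1 mO iD) (RintegrableZ lam mO (i3 e et))).
  rewrite (@RintegralZl _ _ _ mu _ _ _ mO iD) (@RintegralZl _ _ _ mu _ _ _ mO (i3 e et)).
  by rewrite (@RintegralD _ _ _ mu _ _ _ mO (i1 e et) (i2 e et)).
Unshelve. all: by end_near. Qed.

End Solution.

Section Data.
Context {R : realType}.
Local Notation mu := (@lebesgue_measure R).
Local Notation OO e t := [set` @Interval R (BRight e) (BLeft t)].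
Implicit Types (f g : R -> R).

Lemma even_extension_continuous f (lam : R) : {within `[0, +oo[, continuous f} ->
  continuous (fun s => f `|lam * s|).
Proof.
move=> /subspace_continuousP cf s.
have A0 : `[0, +oo[%classic `|lam * s| by rewrite /= in_itv/= normr_ge0.
have cn : {for s, continuous (fun s => `|lam * s|)}.
  by apply: cvg_norm; apply: cvgM; [exact: cvg_cst|exact: cvg_id].
apply/cvgrPdist_lt => e e0; have /cvgrPdist_lt/(_ _ e0) := cf _ A0.
rewrite near_withinE => h; have := cn _ h; apply: (@filterS _ (nbhs s)) => s' /= H; apply: H.
by rewrite in_itv/= normr_ge0.
Qed.

Lemma continuous_window g (S : R) : 0 <= S -> {within `[0, S], continuous g} ->
  measurable_fun (OO 0 S) g /\ exists G, forall s, 0 < s < S -> `|g s| <= G.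
Proof.
move=> S0 cg; split.
  apply: (@measurable_funS _ _ _ _ `[0, S]) => //; first exact: subset_itv_oo_cc.
  exact: subspace_continuous_measurable_fun.
have [c1 _ H1] := EVT_max S0 cg; have [c2 _ H2] := EVT_min S0 cg.
exists (`|g c1| + `|g c2|) => s /andP[s0 sS].
have sI : s \in `[0, S]%R by rewrite in_itv/= (ltW s0) (ltW sS).
have := H1 s sI; have := H2 s sI; have := ler_norm (g c1); have := ler_norm (- g c2).
have := normr_ge0 (g c1); have := normr_ge0 (g c2).
rewrite normrN ler_norml => *; apply/andP; split; lra.
Qed.

Lemma continuous_left_limit g (T t : R) : {within `[0, T[, continuous g} -> 0 < t < T ->
  g (t - s) @[s --> 0^'+] --> g t.
Proof.
move=> cg t0T.
have cO : {within `]0, T[, continuous g}.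
  by apply: continuous_subspaceW cg; exact: subset_itv_oo_co.
have ct : {for t, continuous g}.
  move: cO; rewrite continuous_open_subspace; last exact: interval_open.
  by apply; rewrite inE/= in_itv.
have h : t - s @[s --> 0^'+] --> t - 0.
  by apply: cvgB; [exact: cvg_cst|apply: cvg_at_right_filter; exact: cvg_id].
rewrite subr0 in h.
by apply: (@continuous_cvg _ _ _ (0 : R)^'+ _ _ g); [exact: ct|exact: h].
Qed.

End Data.

Theorem theorem5 (R : realType) (alpha lambda T : R) (f g : R -> R)
    (halpha : 0 < alpha < 1) (hlambda : 0 < lambda) (hT : 0 < T)
    (fcont : {within `[0, +oo[, continuous f})
    (fbdd : [bounded f x | x in `[0, +oo[])
    (gcont : {within `[0, T[, continuous g}) :
  candidate_well_defined alpha lambda f g T /\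
  solves_problem alpha lambda T f g (candidate alpha lambda f g).
Proof.
pose nu := alpha / 2.
have nuE : alpha = nu * 2 by rewrite /nu divfK// pnatr_eq0.
have [nu0 nu2] : 0 < nu /\ 2 * nu < 1.
  by move/andP: halpha => [a0 a1]; rewrite /nu; split; lra.
clearbody nu; subst alpha.
have ck := @even_extension_continuous R f lambda fcont.
have [B kB] : exists B : R, forall s, `|f `|lambda * s| | <= B.
  case: fbdd => M [_ HM]; exists (M + 1) => s.
  by apply: (HM (M + 1)); [rewrite ltrDl|rewrite /= in_itv/= normr_ge0].
have data (S : R) : 0 < S < T -> measurable_fun [set` @Interval R (BRight 0) (BLeft S)] g /\
    exists G, forall s, 0 < s < S -> `|g s| <= G.
  move=> /andP[S0 ST]; apply: (continuous_window (ltW S0)).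
  apply: continuous_subspaceW gcont => s; rewrite /= !in_itv/= => /andP[-> sS].
  exact: le_lt_trans ST.
(* boundary potentials are formed with any final time between t and T *)
have mid (t : R) : 0 < t < T -> t < (t + T) / 2 /\ 0 < (t + T) / 2 < T.
  by move=> /andP[t0 tT]; split; [lra|apply/andP; split; lra].
have candE (S x t : R) : 0 < S < T -> 0 < x -> 0 < t < S ->
    candidate (nu * 2) lambda f g x t = solution nu lambda f g S x t.
  move=> ST x0 tS; have [mg [G gG]] := data S ST; have /andP[t0 _] := tS.
  have [_ e1] := initial_potential nu0 nu2 hlambda ck kB x0 t0.
  have [_ _ e2] := boundary_term nu0 nu2 hlambda mg gG x0 tS.
  by rewrite /candidate mulfK ?pnatr_eq0// e1 e2.
split.
  split.
    move=> z; rewrite mulfK ?pnatr_eq0//; apply/cvg_ex; eexists; exact: (@mainardi_cvg R nu nu0 nu2 z).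
  move=> x t x0 tT; have [tS ST] := mid t tT; have /andP[t0 _] := tT.
  have [mg [G gG]] := data _ ST.
  have tS' : 0 < t < (t + T) / 2 by rewrite t0.
  have [i1 _] := initial_potential nu0 nu2 hlambda ck kB x0 t0.
  have [i2 i3 _] := boundary_term nu0 nu2 hlambda mg gG x0 tS'.
  by split.
split.
- move=> x t x0 tT; have [tS ST] := mid t tT; have /andP[t0 _] := tT.
  have [mg [G gG]] := data _ ST; move: ((t + T) / 2) tS ST mg gG => S tS ST mg gG.
  have tS' : 0 < t < S by rewrite t0.
  have eqx : \forall y \near x, candidate (nu * 2) lambda f g y t = solution nu lambda f g S y t.
    by near=> y; apply: candE => //; near: y; exact: lt_nbhsr.
  have d1 (y : R) : 0 < y -> has_deriv ((candidate (nu * 2) lambda f g) ^~ t) y (flux nu lambda f g S y t).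
    move=> y0; apply: (@has_deriv_near _ _ (solution nu lambda f g S ^~ t)).
      by near=> z; apply: candE => //; near: z; exact: lt_nbhsr.
    exact: (has_deriv_solution_x nu0 nu2 hlambda ck kB mg gG).
  have d2 : has_deriv (derive1 ((candidate (nu * 2) lambda f g) ^~ t)) x (flux_x nu lambda f g S x t).
    apply: (@has_deriv_near _ _ (flux nu lambda f g S ^~ t)).
      near=> z; apply: has_deriv_derive1; apply: d1; near: z; exact: lt_nbhsr.
    exact: (has_deriv_flux nu0 nu2 hlambda ck kB mg gG).
  split.
  + by have [] := d1 x x0.
  + by have [] := d2.
  + have -> : derive1n 2 ((candidate (nu * 2) lambda f g) ^~ t) x = flux_x nu lambda f g S x t.
      exact: (has_deriv_derive1 d2).
    by apply: (solution_caputo nu0 nu2 hlambda ck kB mg gG x0 tS') => s; exact: candE.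
- move=> x x0; have T2 : 0 < T / 2 < T by apply/andP; split; lra.
  have [mg [G gG]] := data _ T2; have /andP[T20 _] := T2.
  apply: (cvg_right_eq T20 _ (solution_cvg0 nu0 nu2 hlambda ck kB mg gG x0)) => t.
  by rewrite add0r => tT; rewrite (candE (T / 2)).
- move=> t tT; have [tS ST] := mid t tT; have /andP[t0 _] := tT.
  have [mg [G gG]] := data _ ST; move: ((t + T) / 2) tS ST mg gG => S tS ST mg gG.
  have tS' : 0 < t < S by rewrite t0.
  have h := flux_cvg0 nu0 nu2 hlambda ck kB mg gG tS' (continuous_left_limit gcont tT).
  apply: (cvg_right_eq ltr01 _ h) => x /andP[x0 _]; apply/esym/has_deriv_derive1.
  apply: (@has_deriv_near _ _ (solution nu lambda f g S ^~ t)).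
    by near=> z; apply: candE => //; near: z; exact: lt_nbhsr.
  exact: (has_deriv_solution_x nu0 nu2 hlambda ck kB mg gG).
Unshelve. all: by end_near.
Qed.
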